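(* Let $F$ be Thompson's group with symmetric generating set $X=\{x_0^{\pm1},x_1^{\pm1}\}$, let $\Sigma_T=\{e,r,(,),a,b\}$ be the alphabet of caret types, and let $\mathcal F\subset(\Sigma_T\times\Sigma_T)^*$ be the caret-type language of $F$. Then $F$ is nonblind deterministic $3$-counter graph automatic with quasigeodesic normal form $\mathcal F$. That is: $\mathcal F$ is a quasigeodesic normal form for $F$ with respect to $X$; $\mathcal F$ is accepted by a nonblind deterministic $3$-counter automaton; and for each $x\in X$ the language $L_x=\{\otimes(u,v)\mid u,v\in\mathcal F,\ \overline v=_F\overline u\,x\}$ is accepted by a nonblind deterministic $3$-counter automaton.
   Context: Thompson's group. $F$ is the group of piecewise linear homeomorphisms of $[0,1]$ (orientation preserving) with finitely many linear pieces, breakpoints with dyadic rational coordinates, and slopes powers of $2$; the product $gh$ is the composition $g\circ h$ ($h$ applied first). A finite rooted binary tree (with at least one caret) has carets: a caret is a non-leaf vertex together with its left and right downward edges. A caret $D$ is the left (right) child of caret $C$ if the vertex of $D$ is the endpoint of the left (right) edge of $C$. The tree determines a dyadic subdivision of $[0,1]$: the root corresponds to $[0,1]$, the two edges of a caret bisect its interval, and the leaves, from left to right, give the subintervals. A pair $(T,S)$ of such trees with the same number of carets represents the element of $F$ mapping the $i$-th leaf interval of $T$ affinely onto the $i$-th leaf interval of $S$ for all $i$. Carets of a tree are numbered in infix order (left subtree, then the caret, then right subtree). A caret is exposed if it has no children. The pair $(T,S)$ is reduced if no caret number $n$ is such that caret $n$ is exposed in both $T$ and $S$, except that the pair of single-caret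 trees is regarded as the reduced pair for the identity; each element of $F$ has a unique reduced pair. Caret types. A caret is exterior if at least one of its edges lies on the left or right side of the tree (this includes the root), and interior otherwise. The root caret has type $r$; every other exterior caret has type $e$. Call an interior caret ''of the first kind'' if it is the left child of an interior caret or a child of an exterior caret, and ''of the second kind'' otherwise. An interior caret of the first kind has type $($ if it has a right child and $a$ if it has none; an interior caret of the second kind has type $b$ if it has a right child and $)$ if it has none. The word of a tree is the list of its caret types in infix order, a word over $\Sigma_T=\{e,r,(,),a,b\}$. For $g\in F$ with reduced pair $(T,S)$, $\nu(g)\in(\Sigma_T\times\Sigma_T)^*$ is the word whose $i$-th letter is $\binom{t_i}{s_i}$, where $t_i,s_i$ are the $i$-th letters of the words of $T$ and $S$. The caret-type language is $\mathcal F=\{\nu(g)\mid g\in F\}$; for $u=\nu(g)$ write $\overline u=g$. Generators. $x_0$ is the element with $\nu(x_0)=\binom{r}{e}\binom{e}{r}$ and $x_1$ the element with $\nu(x_1)=\binom{r}{r}\binom{e}{a}\binom{e}{e}$; these generate $F$. Languages. For words $u,v$ over a finite alphabet $\Lambda$ and a symbol $\diamond\notin\Lambda$, $\otimes(u,v)$ is the word of length $\max(|u|,|v|)$ over $(\Lambda\cup\{\diamond\})^2$ whose $i$-th letter is the pair of $i$-th letters of $u$ and $v$, with $\diamond$ used past the end of a word. Here $\Lambda=\Sigma_T\times\Sigma_T$. A normal form for a group $G$ over $\Lambda$ is a set $L\subseteq\Lambda^*$ with a bijection $u\mapsto\overline u$ from $L$ to $G$. It is quasigeodesic with respect to a generating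 set $X$ if there is a constant $D$ with $|u|\le D(\|u\|_X+1)$ for all $u\in L$, where $|u|$ is the number of letters of $u$ and $\|u\|_X$ is the word length of $\overline u$ over $X$. A nonblind deterministic $k$-counter automaton is a deterministic finite state automaton augmented with $k$ integer counters, all initially zero, which can be incremented, decremented, compared to zero and set to zero during operation; for each configuration and subsequent input letter there is at most one possible move. It accepts a word exactly if upon reading the word it reaches an accepting state with all counters equal to zero. *)

(* Defs.v *)
From HB Require Import structures.
From mathcomp Require Import all_boot all_order all_algebra.
From mathcomp Require Import all_classical all_reals all_analysis.
From mathcomp Require Import ring.

Set Implicit Arguments.
Unset Strict Implicit.
Unset Printing Implicit Defensive.

Import Order.TTheory GRing.Theory Num.Theory.
Import numFieldNormedType.Exports.

Local Open Scope classical_set_scope.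
Local Open Scope ring_scope.

Section ThompsonGroup.
Variable R : realType.

Local Notation I01 := (set_type (`[0, 1]%classic : set R)).

Definition dyadic (x : R) : Prop :=
  exists (m : int) (n : nat), x = m%:~R / 2 ^+ n.

Definition homeomorphism (f : I01 -> I01) : Prop :=
  continuous f /\
  exists g : I01 -> I01, [/\ continuous g, cancel f g & cancel g f].

Definition orientation_preserving (f : I01 -> I01) : Prop :=
  forall x y : I01, val x < val y -> val (f x) < val (f y).

(* The list s contains all the breakpoints (and possibly other dyadic         *)
(* points): f is affine on every segment without points of s in its interior. *)
Definition dyadic_piecewise_linear (f : I01 -> I01) : Prop :=
  exists2 s : seq R, (forall b, b \in s -> dyadic b) &
    forall x y : I01, (forall b, b \in s -> ~~ (val x < b < val y)) ->
    exists (k : int) (c : R), forall z : I01,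
      val x <= val z <= val y -> val (f z) = 2 ^ k * val z + c.

Definition thompson_set : set (I01 -> I01) :=
  [set f | [/\ homeomorphism f, orientation_preserving f
             & dyadic_piecewise_linear f]].

Definition thompsonF : Type := set_type thompson_set.

HB.instance Definition _ := Choice.on thompsonF.

Lemma thompson_ext (g h : thompsonF) : val g =1 val h -> g = h.
Proof. by move=> gh; apply/val_inj/funext. Qed.

Lemma I01_ge0 (x : I01) : 0 <= val x.
Proof. by have := set_valP x; rewrite /= in_itv /= => /andP[]. Qed.

Lemma I01_le1 (x : I01) : val x <= 1.
Proof. by have := set_valP x; rewrite /= in_itv /= => /andP[]. Qed.

Lemma I01_subproof (x : R) : 0 <= x <= 1 -> x \in (`[0, 1]%classic : set R).
Proof. by move=> x01; rewrite inE /= in_itv. Qed.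

Lemma op_le (f : I01 -> I01) : orientation_preserving f ->
  forall x y : I01, val x <= val y -> val (f x) <= val (f y).
Proof.
move=> opf x y; rewrite le_eqVlt => /orP[/eqP/val_inj -> //|/opf].
exact: ltW.
Qed.

Lemma op_inv (f g : I01 -> I01) : cancel g f ->
  orientation_preserving f -> orientation_preserving g.
Proof.
move=> gK opf x y xy; rewrite ltNge; apply/negP => /(op_le opf).
by rewrite !gK leNgt xy.
Qed.

Lemma dyadicD (x y : R) : dyadic x -> dyadic y -> dyadic (x + y).
Proof.
move=> [m [n ->]] [m' [n' ->]].
exists (m * 2 ^+ n' + m' * 2 ^+ n), (n + n')%N.
rewrite rmorphD !rmorphM /= !rmorphXn /= exprD.
have h i : (2 : R) ^+ i != 0 by rewrite expf_neq0 // pnatr_eq0.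
by field; rewrite !h.
Qed.

Lemma dyadicN (x : R) : dyadic x -> dyadic (- x).
Proof. by move=> [m [n ->]]; exists (- m), n; rewrite rmorphN mulNr. Qed.

Lemma dyadicM2 (k : int) (x : R) : dyadic x -> dyadic (2 ^ k * x).
Proof.
move=> [m [n ->]].
have h i : (2 : R) ^+ i != 0 by rewrite expf_neq0 // pnatr_eq0.
case: k => k.
  exists (2 ^+ k * m), n; rewrite rmorphM rmorphXn /= -exprnP.
  by rewrite mulrA.
exists m, (n + k.+1)%N.
rewrite NegzE -exprnN exprD.
by field; rewrite !h.
Qed.

Lemma dyadicM2E (k : int) (x : R) : dyadic (2 ^ k * x) -> dyadic x.
Proof.
move=> /(dyadicM2 (- k)); rewrite mulrA -expfzDr ?pnatr_eq0 //.
by rewrite addNr expr0z mul1r.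
Qed.

Lemma dyadic_image (f : I01 -> I01) (s : seq R) :
  (forall b, b \in s -> dyadic b) ->
  (forall x y : I01, (forall b, b \in s -> ~~ (val x < b < val y)) ->
    exists (k : int) (c : R), forall z : I01,
      val x <= val z <= val y -> val (f z) = 2 ^ k * val z + c) ->
  forall a b : I01, val a <= val b -> dyadic (val a) -> dyadic (val (f a)) ->
  dyadic (val b) <-> dyadic (val (f b)).
Proof.
move=> sd sl a b.
have [n] := ubnP (count (fun t => val a < t < val b) s).
elim: n => // n IHn in a b *; rewrite ltnS => cn ab da dfa.
have [hs|/hasPn hs] := boolP (has (fun t => val a < t < val b) s); last first.
  have [k [c fE]] := sl a b hs.
  have fa := fE a; rewrite lexx ab in fa; have {}fa := fa isT.
  have fb := fE b; rewrite lexx ab in fb; have {}fb := fb isT.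
  have e : val (f b) = 2 ^ k * (val b - val a) + val (f a).
    by rewrite fa fb; ring.
  split=> [db|dfb].
    by rewrite e; apply: dyadicD => //; apply/dyadicM2/dyadicD/dyadicN.
  have : dyadic (2 ^ k * (val b - val a)).
    have -> : 2 ^ k * (val b - val a) = val (f b) - val (f a) by rewrite e; ring.
    exact/dyadicD/dyadicN.
  move=> /dyadicM2E dba; rewrite -(subrK (val a) (val b)).
  exact: dyadicD.
have [m ms /andP[am mb]] := hasP hs.
have m01 : 0 <= m <= 1.
  by rewrite (le_trans (I01_ge0 a) (ltW am)) (le_trans (ltW mb) (I01_le1 b)).
pose M : I01 := SigSub (I01_subproof m01).
have cnt (P Q : pred R) : (forall t, P t -> Q t) -> Q m -> ~~ P m ->
    (count P s < count Q s)%N.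
  move=> PQ Qm Pm; rewrite -(cat_take_drop (index m s) s) (drop_nth 0).
    rewrite nth_index // !count_cat /= Qm (negbTE Pm) add0n addnCA add1n ltnS.
    by rewrite leq_add ?sub_count.
  by rewrite index_mem.
have dfM : dyadic (val (f M)).
  apply/(IHn a M) => //=; [|exact: ltW|exact: sd].
  apply: leq_trans cn; apply: cnt => [t /andP[->]|/=|].
  - by move=> /lt_trans->.
  - by rewrite am.
  - by rewrite ltxx andbF.
apply: (IHn M b) => //=; [|exact: ltW|exact: sd].
apply: leq_trans cn; apply: cnt => [t /andP[+ ->]|/=|].
- by move=> /(lt_trans am)->.
- by rewrite am.
- by rewrite ltxx.
Qed.

Lemma thompson_dyadic (f : I01 -> I01) : thompson_set f ->
  forall b : I01, dyadic (val b) <-> dyadic (val (f b)).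
Proof.
move=> [[_ [g [_ fK gK]]] opf [s sd sl]] b.
have z01 : 0 <= (0 : R) <= 1 by rewrite lexx ler01.
pose z : I01 := SigSub (I01_subproof z01).
have d0 : dyadic 0 by exists 0, 0%N; rewrite mul0r.
apply: (dyadic_image sd sl (a := z)) => //; first exact: I01_ge0.
suff -> : val (f z) = 0 by [].
apply/eqP; rewrite eq_le I01_ge0 andbT -[leRHS]/(val z) -[X in _ <= val X]gK.
by apply: op_le => //; exact: I01_ge0.
Qed.

Lemma thompson_set_id : thompson_set idfun.
Proof.
split=> //.
  split; first by move=> x; exact: cvg_id.
  by exists idfun; split => // x; exact: cvg_id.
by exists [::] => // x y _; exists 0, 0 => z _; rewrite expr0z mul1r addr0.
Qed.

Lemma thompson_set_comp (f g : I01 -> I01) :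
  thompson_set f -> thompson_set g -> thompson_set (f \o g).
Proof.
move=> Tf Tg; have dg := thompson_dyadic Tg.
case: Tf Tg => [[cf [f' [cf' fK f'K]]] opf [s sd sl]].
move=> [[cg [g' [cg' gK g'K]]] opg [t td tl]].
split.
- split; first by move=> x; apply: continuous_comp; [exact: cg|exact: cf].
  exists (g' \o f'); split.
  + by move=> x; apply: continuous_comp; [exact: cf'|exact: cg'].
  + exact: can_comp fK gK.
  + exact: can_comp g'K f'K.
- by move=> x y /opg/opf.
exists (t ++ [seq val (g' u) | u <- pmap insub s]).
  move=> b; rewrite mem_cat => /orP[/td //|/mapP[u]].
  rewrite mem_pmap_sub => us ->; apply/dg; rewrite g'K; exact: sd.
move=> x y st.
have [|k [c gE]] := tl x y; first by move=> b bt; apply: st; rewrite mem_cat bt.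
have [|l [d fE]] := sl (g x) (g y).
  move=> b bs; apply/negP => /andP[xb by_].
  have b01 : 0 <= b <= 1.
    by rewrite (le_trans (I01_ge0 _) (ltW xb)) (le_trans (ltW by_) (I01_le1 _)).
  pose B : I01 := SigSub (I01_subproof b01).
  have /st/negP : val (g' B) \in t ++ [seq val (g' u) | u <- pmap insub s].
    rewrite mem_cat; apply/orP; right; apply/mapP; exists B => //.
    by rewrite mem_pmap_sub.
  apply; apply/andP; split.
    by rewrite -[x]gK; apply: (op_inv g'K).
  by rewrite -[y]gK; apply: (op_inv g'K).
exists (l + k), (2 ^ l * c + d) => z /[dup] xzy /andP[xz zy] /=.
rewrite fE; last by rewrite !op_le.
by rewrite (gE z xzy) expfzDr ?pnatr_eq0 // mulrDr mulrA addrA.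
Qed.

Definition thompson_one : thompsonF := SigSub (mem_set thompson_set_id).

Definition thompson_mul (g h : thompsonF) : thompsonF :=
  SigSub (mem_set (thompson_set_comp (set_valP g) (set_valP h))).

Lemma thompson_inv_ex (f : thompsonF) :
  {g : thompsonF | cancel (val f) (val g) & cancel (val g) (val f)}.
Proof.
apply/cid2; case: f => f /[dup] mf /set_mem /= Tf.
have df := thompson_dyadic Tf.
case: Tf => [[cf [g [cg fK gK]]] opf [s sd sl]].
have opg := op_inv gK opf.
suff Tg : thompson_set g.
  by exists (SigSub (mem_set Tg)).
split=> //; first by split; [exact: cg|exists f].
exists [seq val (f u) | u <- pmap insub s].
  by move=> b /mapP[u]; rewrite mem_pmap_sub => us ->; apply/(df u)/sd.
move=> x y st; have [|k [c fE]] := sl (g x) (g y).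
  move=> b bs; apply/negP => /andP[xb by_].
  have b01 : 0 <= b <= 1.
    by rewrite (le_trans (I01_ge0 _) (ltW xb)) (le_trans (ltW by_) (I01_le1 _)).
  pose B : I01 := SigSub (I01_subproof b01).
  have /st/negP : val (f B) \in [seq val (f u) | u <- pmap insub s].
    by apply/mapP; exists B => //; rewrite mem_pmap_sub.
  apply; apply/andP; split; first by rewrite -[x]gK; apply: opf.
  by rewrite -[y]gK; apply: opf.
exists (- k), (- (2 ^ (- k) * c)) => z /andP[xz zy].
rewrite -[z in RHS]gK fE; last by rewrite !op_le.
have e : (2 : R) ^ (- k) * 2 ^ k = 1.
  by rewrite -expfzDr ?pnatr_eq0 // addNr expr0z.
by rewrite mulrDr mulrA e mul1r addrK.
Qed.

Definition thompson_inv (f : thompsonF) : thompsonF := s2val (thompson_inv_ex f).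

Lemma thompson_mulA : associative thompson_mul.
Proof. by move=> f g h; apply: thompson_ext. Qed.

Lemma thompson_mul1 : left_id thompson_one thompson_mul.
Proof. by move=> f; apply: thompson_ext. Qed.

Lemma thompson_1mul : right_id thompson_one thompson_mul.
Proof. by move=> f; apply: thompson_ext. Qed.

Lemma thompson_mulV : left_inverse thompson_one thompson_inv thompson_mul.
Proof.
move=> f; apply: thompson_ext => x.
exact: (s2valP (thompson_inv_ex f)).
Qed.

Lemma thompson_Vmul : right_inverse thompson_one thompson_inv thompson_mul.
Proof.
move=> f; apply: thompson_ext => x.
exact: (s2valP' (thompson_inv_ex f)).
Qed.

HB.instance Definition _ := isGroup.Build thompsonF
  thompson_mulA thompson_mul1 thompson_1mul thompson_mulV thompson_Vmul.

End ThompsonGroup.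

Inductive tree : Type := Leaf | Node of tree & tree.

(* A caret is given by the address of its vertex, the path from the root to   *)
(* it: false is a left edge, true a right edge. carets t is in infix order.   *)
Fixpoint carets (t : tree) : seq (seq bool) :=
  if t is Node l r then
    map (cons false) (carets l) ++ [::] :: map (cons true) (carets r)
  else [::].

Definition has_left_child (t : tree) (p : seq bool) : bool :=
  rcons p false \in carets t.

Definition has_right_child (t : tree) (p : seq bool) : bool :=
  rcons p true \in carets t.

Definition exposed (t : tree) (p : seq bool) : bool :=
  ~~ has_left_child t p && ~~ has_right_child t p.

(* The left edge of p lies on the left side of the tree iff p consists of     *)
(* left edges only; symmetrically on the right.                               *)
Definition exterior (p : seq bool) : bool := all negb p || all id p.

Definition interior (p : seq bool) : bool := ~~ exterior p.

Definition parent (p : seq bool) : seq bool := take (size p).-1 p.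

Definition is_left_child (p : seq bool) : bool := ~~ last true p.

Definition first_kind (p : seq bool) : bool :=
  interior p &&
  (is_left_child p && interior (parent p) || exterior (parent p)).

(* Type_open and Type_close are the types written as parentheses.             *)
Inductive caret_type : Type :=
  Type_e | Type_r | Type_open | Type_close | Type_a | Type_b.

Definition caret_type_code (c : caret_type) : 'I_6 :=
  match c with
  | Type_e => inord 0 | Type_r => inord 1 | Type_open => inord 2
  | Type_close => inord 3 | Type_a => inord 4 | Type_b => inord 5
  end.

Definition caret_type_decode (i : 'I_6) : caret_type :=
  nth Type_e [:: Type_e; Type_r; Type_open; Type_close; Type_a; Type_b] i.

Lemma caret_type_codeK : cancel caret_type_code caret_type_decode.
Proof. by case; rewrite /caret_type_decode /= inordK. Qed.

HB.instance Definition _ := Finite.copy caret_type (can_type caret_type_codeK).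

Definition type_of_caret (t : tree) (p : seq bool) : caret_type :=
  if p == [::] then Type_r
  else if exterior p then Type_e
  else if first_kind p then
    (if has_right_child t p then Type_open else Type_a)
  else (if has_right_child t p then Type_b else Type_close).

Definition tree_word (t : tree) : seq caret_type :=
  map (type_of_caret t) (carets t).

Definition tree_pair (T S : tree) : Prop :=
  (0 < size (carets T))%N /\ size (carets T) = size (carets S).

Definition reduced (T S : tree) : Prop :=
  (T = Node Leaf Leaf /\ S = Node Leaf Leaf) \/
  forall n, (n < size (carets T))%N ->
    ~~ (exposed T (nth [::] (carets T) n) && exposed S (nth [::] (carets S) n)).

Notation Lambda := (caret_type * caret_type)%type.

Section CaretLanguage.
Variable R : realType.
Local Notation F := (thompsonF R).

Fixpoint leaf_intervals (a b : R) (t : tree) : seq (R * R) :=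
  if t is Node l r then
    leaf_intervals a ((a + b) / 2) l ++ leaf_intervals ((a + b) / 2) b r
  else [:: (a, b)].

Definition represents (T S : tree) (g : F) : Prop :=
  forall i, (i < size (leaf_intervals 0 1 T))%N ->
  let J := nth (0, 0) (leaf_intervals 0 1 T) i in
  let K := nth (0, 0) (leaf_intervals 0 1 S) i in
  forall x, J.1 <= val x <= J.2 ->
    val (val g x) = K.1 + (K.2 - K.1) / (J.2 - J.1) * (val x - J.1).

(* The default value [::] is never used, as every element of F has a unique   *)
(* reduced pair; similarly for bar below, which is only used on words nu g.   *)
Definition nu (g : F) : seq Lambda :=
  xget [::] [set w | exists T S : tree,
    [/\ tree_pair T S, reduced T S, represents T S g
      & w = zip (tree_word T) (tree_word S)]].

Definition caret_language : set (seq Lambda) := range nu.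

Definition bar (u : seq Lambda) : F := xget 1%g [set g | nu g = u].

Definition x0 : F := bar [:: (Type_r, Type_e); (Type_e, Type_r)].

Definition x1 : F :=
  bar [:: (Type_r, Type_r); (Type_e, Type_a); (Type_e, Type_e)].

End CaretLanguage.

Inductive instruction (k : nat) : Type :=
  | Increment of 'I_k
  | Decrement of 'I_k
  | Set_to_zero of 'I_k
  | If_zero of 'I_k
  | If_nonzero of 'I_k.

Section Execution.
Variable k : nat.

Definition counters : Type := {ffun 'I_k -> int}.

Definition update (c : counters) (i : 'I_k) (v : int) : counters :=
  [ffun j => if j == i then v else c j].

(* None means that the comparison fails, so that the move is not possible.    *)
Definition execute1 (c : counters) (o : instruction k) :
    option (counters) :=
  match o with
  | Increment i => Some (update c i (c i + 1))
  | Decrement i => Some (update c i (c i - 1))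
  | Set_to_zero i => Some (update c i 0)
  | If_zero i => if c i == 0 then Some c else None
  | If_nonzero i => if c i != 0 then Some c else None
  end.

Fixpoint execute (c : counters) (s : seq (instruction k)) :
    option (counters) :=
  if s is o :: s' then obind (execute^~ s') (execute1 c o) else Some c.

End Execution.

(* A move reads one input letter, executes a list of counter instructions     *)
(* from left to right, and changes the state.                                 *)
Record counter_automaton (A : finType) (k : nat) : Type := CounterAutomaton {
  state : finType;
  initial : state;
  accepting : {set state};
  moves : state -> A -> seq (seq (instruction k) * state)
}.

Section CounterAutomaton.
Variables (A : finType) (k : nat) (M : counter_automaton A k).

Definition configuration : Type := (state M * counters k)%type.

Definition successors (s : configuration) (a : A) : seq configuration :=
  pmap (fun m => omap (pair m.2) (execute s.2 m.1)) (moves s.1 a).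

Definition deterministic : Prop :=
  forall (s : configuration) (a : A), (size (successors s a) <= 1)%N.

Fixpoint accepts_from (s : configuration) (w : seq A) : bool :=
  if w is a :: w' then has (accepts_from^~ w') (successors s a)
  else (s.1 \in accepting M) && [forall i, s.2 i == 0].

Definition accepts (w : seq A) : bool := accepts_from (initial M, [ffun=> 0]) w.

End CounterAutomaton.

Definition deterministic_counter_language (A : finType) (k : nat)
    (L : set (seq A)) : Prop :=
  exists2 M : counter_automaton A k, deterministic M & [set w | accepts M w] = L.

(* The padding symbol is None.                                                *)
Definition otimes (A : Type) (u v : seq A) : seq (option A * option A) :=
  mkseq (fun i => (onth u i, onth v i)) (maxn (size u) (size v)).

Section GraphAutomatic.
Variables (A : finType) (G : groupType).
Implicit Types (X : set G) (L : set (seq A)) (f : seq A -> G).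

Definition expressible_in X (g : G) (n : nat) : Prop :=
  exists s : seq G, [/\ forall x, x \in s -> X x \/ X x^-1%g,
    g = \big[*%g/1%g]_(x <- s) x & size s = n].

Definition generating X : Prop := forall g, exists n, expressible_in X g n.

Definition word_length X (g : G) (n : nat) : Prop :=
  expressible_in X g n /\ forall m, expressible_in X g m -> (n <= m)%N.

Definition normal_form L f : Prop := set_bij L [set: G] f.

Definition quasigeodesic X L f : Prop :=
  generating X /\
  exists D : nat, forall u n, L u -> word_length X (f u) n ->
    (size u <= D * (n + 1))%N.

Definition multiplication_language L f (x : G) :
    set (seq (option A * option A)) :=
  [set w | exists u v, [/\ L u, L v, f v = (f u * x)%g & w = otimes u v]].

Definition counter_graph_automatic (k : nat) X L f : Prop :=
  [/\ normal_form L f, deterministic_counter_language k L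
    & forall x, X x ->
        deterministic_counter_language k (multiplication_language L f x)].

End GraphAutomatic.

(* Main.v *)
Require Import Defs.
From HB Require Import structures.
From mathcomp Require Import all_boot all_order all_algebra.
From mathcomp Require Import all_classical all_reals all_analysis.
From mathcomp Require Import zify ring lra.

(* The word of a tree is described by a grammar: the carets on the sides of    *)
(* the tree give the letters e and r, at depth 0, and the interior subtrees    *)
(* between them give balanced words in which b occurs only at positive depth;  *)
(* conversely, each such word is the word of exactly one tree. Whether a caret *)
(* is exposed depends only on its letter and the two neighbouring letters, so  *)
(* a finite automaton with one depth counter for each tree recognizes the      *)
(* words of the reduced pairs.                                                 *)
(*                                                                             *)
(* Multiplying on the right by x0 or x1 rotates the domain tree at the root or *)
(* at its right child, possibly after adding a caret to both trees or before   *)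
(* removing exposed carets at their right ends. In the words this changes a    *)
(* bounded number of letters and shifts the rest by at most two places, which  *)
(* a finite automaton can compare, with one exception: when x1 moves an        *)
(* interior caret to the right side, its parenthesis becomes e and a matching  *)
(* letter b or ) becomes ( or a; the third counter locates that letter.        *)
(* Inverses exchange the two words.                                            *)
(*                                                                             *)
(* Each multiplication changes the number of carets by at most two, which      *)
(* gives the quasigeodesic bound. Rotations at any place of the right side are *)
(* conjugates of x1 by powers of x0, and rotations turn every tree into a      *)
(* right comb, so x0 and x1 generate the group.                                *)

Set Implicit Arguments.
Unset Strict Implicit.
Unset Printing Implicit Defensive.

Import Order.TTheory GRing.Theory Num.Theory.
Import numFieldNormedType.Exports.

Local Open Scope classical_set_scope.

(** * Words of trees *)

Local Open Scope nat_scope.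

(** The theorem rests on a dictionary between trees and words, on reduced pairs being a normal form,
    and on multiplication by a generator being a local change of the domain tree.

    Words. By [tree_wordE] the word of a tree factors along the two sides of the tree, and the
    factors between boundary letters are balanced in the sense of [depth]. The words satisfying
    [valid_word] are the words of nonempty trees ([parse_word]), each of exactly one tree
    ([word_inj]), and [exposed_word] reads exposure from neighbouring letters. So being the word of
    a reduced pair is a regular condition together with one depth counter per tree
    ([reduced_wordE]).

    Normal form. Cutting [0,1] finely enough, an element of F maps each piece affinely onto a
    standard dyadic interval; the images tile [0,1] and are therefore the leaves of a tree
    ([tree_pair_exists]). Conversely, interpolation realizes every pair ([rep_exists]). Two
    different domain trees for one element cannot both be reduced: one of them has an exposed caret
    inside a leaf interval of the other, where the map is affine, so the range tree has the same
    caret exposed ([rep_not_compat], [reduced_rep_inj]).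

    Multiplication. Precomposing with a generator rotates the domain tree, after adding up to two
    missing carets or before cancelling up to two common ones. These steps lead from reduced pairs
    to reduced pairs ([x0_step_reduced], [x1_step_reduced]), so by uniqueness they are the graph of
    the multiplication ([step_wordsE]). On words a step is a concatenation of copies, bounded
    replacements and shifts, which is a regular relation; for [x1] it must also be checked that two
    changed letters belong together, a depth condition on one more counter
    ([rotation_checked_close], [rotation_checked_b]). [step_language_3counter] combines these tests,
    and inverses exchange the two tracks.

    Length. A step changes the number of carets by at most two, so an element of length n has a word
    of at most 1 + 2n letters ([expressible_size]). The generators suffice because rotations along
    the right side bring every tree to a comb ([generated_comb]). *)

Definition isleaf (t : tree) : bool := if t is Leaf then true else false.

Fixpoint ncarets (t : tree) : nat :=
  if t is Node l r then (ncarets l + (ncarets r).+1)%N else 0%N.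

Lemma size_carets t : size (carets t) = ncarets t.
Proof. by elim: t => //= l <- r <-; rewrite size_cat /= !size_map. Qed.

Fixpoint exposures (t : tree) : seq bool :=
  if t is Node l r then exposures l ++ (isleaf l && isleaf r) :: exposures r else [::].

Lemma size_exposures t : size (exposures t) = ncarets t.
Proof. by elim: t => //= l <- r <-; rewrite size_cat. Qed.

Lemma mem_carets_nil t : ([::] \in carets t) = ~~ isleaf t.
Proof. by case: t => // l r; rewrite mem_cat inE /= orbT. Qed.

Lemma mem_carets_cons l r b p :
  (b :: p \in carets (Node l r)) = (p \in carets (if b then r else l)).
Proof.
have inj c : injective (cons c : seq bool -> _) by move=> x y [].
rewrite /= mem_cat inE /=.
case: b; rewrite mem_map //.
  by case: (true :: p \in _) / mapP => [[]|].
by rewrite orbC; case: (false :: p \in _) / mapP => [[]|].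
Qed.

Lemma exposed_nil l r : exposed (Node l r) [::] = isleaf l && isleaf r.
Proof.
rewrite /exposed /has_left_child /has_right_child [rcons _ _]/= [rcons _ true]/=.
by rewrite !mem_carets_cons !mem_carets_nil !negbK.
Qed.

Lemma exposed_cons l r b p :
  exposed (Node l r) (b :: p) = exposed (if b then r else l) p.
Proof.
by rewrite /exposed /has_left_child /has_right_child !rcons_cons !mem_carets_cons.
Qed.

Lemma exposuresE t : map (exposed t) (carets t) = exposures t.
Proof.
elim: t => // l IHl r IHr.
rewrite [carets _]/= map_cat map_cons exposed_nil -!map_comp /= -IHl -IHr.
by congr (_ ++ _ :: _); apply: eq_map => p; rewrite /= exposed_cons.
Qed.

Lemma nth_exposures t n : (n < ncarets t)%N ->
  exposed t (nth [::] (carets t) n) = nth false (exposures t) n.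
Proof. by move=> nt; rewrite -exposuresE (nth_map [::]) // size_carets. Qed.

(* The words of a subtree hanging below the left side, below the right side,  *)
(* and of interior subtrees whose root is of the first and second kind.       *)
Fixpoint interior_word (first : bool) (t : tree) : seq caret_type :=
  if t is Node l r then
    interior_word true l ++
      (if first then if isleaf r then Type_a else Type_open
       else if isleaf r then Type_close else Type_b) ::
    interior_word false r
  else [::].
Notation wi1 := (interior_word true).
Notation wi2 := (interior_word false).

Fixpoint wl (t : tree) : seq caret_type :=
  if t is Node l r then wl l ++ Type_e :: wi1 r else [::].

Fixpoint wr (t : tree) : seq caret_type :=
  if t is Node l r then wi1 l ++ Type_e :: wr r else [::].

Definition word (t : tree) : seq caret_type :=
  if t is Node l r then wl l ++ Type_r :: wr r else [::].

Fixpoint subtree (t : tree) (p : seq bool) {struct p} : tree :=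
  if p is b :: p' then
    if t is Node l r then subtree (if b then r else l) p' else Leaf
  else t.

Lemma subtree_rcons t p b l r : subtree t p = Node l r ->
  subtree t (rcons p b) = if b then r else l.
Proof.
elim: p t => [|c p IH] [|tl tr] //=; first by case=> -> ->; case: b.
exact: IH.
Qed.

Lemma mem_carets_cat t p q : (~~ isleaf (subtree t p)) ->
  (p ++ q \in carets t) = (q \in carets (subtree t p)).
Proof.
elim: p t => // b p IH [|l r] //= ht.
by rewrite -/(carets (Node l r)) mem_carets_cons IH.
Qed.

Lemma has_right_childE t p l r : subtree t p = Node l r ->
  has_right_child t p = ~~ isleaf r.
Proof.
move=> e; rewrite /has_right_child -cats1 mem_carets_cat e //.
by rewrite mem_carets_cons mem_carets_nil.
Qed.

Lemma exteriorP_rcons p b : exterior (rcons p b) -> exterior p.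
Proof.
by rewrite /exterior !all_rcons => /orP[/andP[_ ->]|/andP[_ ->]]; rewrite ?orbT.
Qed.

Lemma parent_rcons p b : parent (rcons p b) = p.
Proof. by rewrite /parent size_rcons /= -cats1 take_size_cat. Qed.

Lemma is_left_child_rcons p b : is_left_child (rcons p b) = ~~ b.
Proof. by rewrite /is_left_child last_rcons. Qed.

Lemma rcons_nil_false (T : eqType) (p : seq T) b : (rcons p b == [::]) = false.
Proof. by case: p. Qed.

Lemma map_type_Node t p l r :
  [seq type_of_caret t (p ++ c) | c <- carets (Node l r)] =
  [seq type_of_caret t (rcons p false ++ c) | c <- carets l] ++
  type_of_caret t p ::
  [seq type_of_caret t (rcons p true ++ c) | c <- carets r].
Proof.
rewrite /= map_cat map_cons -!map_comp cats0.
by congr (_ ++ _ :: _); apply: eq_map => c /=; rewrite cat_rcons.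
Qed.

(** Below an interior caret the left child is of the first kind and the right child of the second,
    which is the flag passed on by [interior_word]; otherwise only the presence of a right child
    matters for the type. *)
Lemma map_type_interior t s p : Defs.interior p -> subtree t p = s ->
  [seq type_of_caret t (p ++ c) | c <- carets s] =
  interior_word (first_kind p) s.
Proof.
elim: s p => // l IHl r IHr p ip sp.
have inil : (p == [::]) = false by case: p ip {sp}.
have ib b : Defs.interior (rcons p b) by apply: contra ip => /exteriorP_rcons.
rewrite map_type_Node IHl ?(subtree_rcons _ sp) // IHr ?(subtree_rcons _ sp) //.
rewrite /type_of_caret inil (negbTE ip) (has_right_childE sp) /=.
rewrite {1 3}/first_kind !ib !parent_rcons !is_left_child_rcons ip /=.
rewrite (negbTE ip).
by case: first_kind; case: isleaf.
Qed.

(** A caret on a side of the tree has one child continuing that side; its other child is interior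
    with an exterior parent, hence of the first kind. *)
Lemma map_type_ext t s p b : p != [::] -> all (pred1 b) p -> subtree t p = s ->
  [seq type_of_caret t (p ++ c) | c <- carets s] = if b then wr s else wl s.
Proof.
elim: s p => [|l IHl r IHr] p p0 pb sp; first by case: b {pb}.
have ext q : all (pred1 b) q -> exterior q.
  move=> qb; rewrite /exterior; apply/orP; case: b qb {IHl IHr pb} => qb; [right|left];
    by apply: sub_all qb => x /eqP->.
have extp := ext p pb.
have ir : Defs.interior (rcons p (~~ b)).
  rewrite /Defs.interior /exterior !all_rcons.
  case: p p0 pb {sp extp} => // c p _ /= /andP[/eqP-> _].
  by case: b {ext IHl IHr}.
have fr : first_kind (rcons p (~~ b)) by rewrite /first_kind ir parent_rcons extp orbT.
rewrite map_type_Node {2}/type_of_caret (negbTE p0) extp.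
case: b pb ext ir fr IHl IHr => pb ext ir fr IHl IHr.
  rewrite map_type_interior ?(subtree_rcons _ sp) // fr.
  by rewrite IHr ?rcons_nil_false ?all_rcons ?pb ?(subtree_rcons _ sp).
rewrite [X in _ ++ _ :: X]map_type_interior ?(subtree_rcons _ sp) // fr.
by rewrite IHl ?rcons_nil_false ?all_rcons ?pb ?(subtree_rcons _ sp).
Qed.

Lemma tree_wordE t : tree_word t = word t.
Proof.
case: t => // l r; rewrite /tree_word.
have -> : [seq type_of_caret (Node l r) c | c <- carets (Node l r)] =
  [seq type_of_caret (Node l r) ([::] ++ c) | c <- carets (Node l r)] by [].
rewrite map_type_Node.
by rewrite (@map_type_ext _ l _ false) ?(@map_type_ext _ r _ true).
Qed.

Lemma size_interior_word b t : size (interior_word b t) = ncarets t.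
Proof. by elim: t b => //= l IHl r IHr b; rewrite size_cat /= IHl IHr. Qed.

Lemma size_wl t : size (wl t) = ncarets t.
Proof. by elim: t => //= l IHl r IHr; rewrite size_cat /= IHl size_interior_word. Qed.

Lemma size_wr t : size (wr t) = ncarets t.
Proof. by elim: t => //= l IHl r IHr; rewrite size_cat /= IHr size_interior_word. Qed.

Lemma size_word t : size (word t) = ncarets t.
Proof. by case: t => //= l r; rewrite size_cat /= size_wl size_wr. Qed.

Definition caret_type_eqb (c d : caret_type) : bool :=
  match c, d with
  | Type_e, Type_e | Type_r, Type_r | Type_open, Type_open
  | Type_close, Type_close | Type_a, Type_a | Type_b, Type_b => true
  | _, _ => false
  end.

(* The equality inherited from ['I_6] does not compute. *)
Lemma caret_type_eqE c d : (c == d) = caret_type_eqb c d.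
Proof. by apply/eqP/idP => [<-|]; [case: c|case: c d => [] []]. Qed.

(** * Exposure read from neighbouring letters *)

Definition boundary (c : caret_type) : bool :=
  if c is (Type_e | Type_r) then true else false.

Definition closing (c : caret_type) : bool :=
  if c is (Type_a | Type_close) then true else false.

(* Whether a caret is exposed can be read off its type and the types of its   *)
(* neighbours in infix order.                                                 *)
Definition exposed_type (p : option caret_type) (c : caret_type)
    (n : option caret_type) : bool :=
  match c with
  | Type_a | Type_close => ~~ oapp closing false p
  | Type_e => (p == None) && oapp boundary false n ||
              (n == None) && oapp boundary false p
  | Type_r => (p == None) && (n == None)
  | _ => false
  end.

Section Neighbours.
Variable A : Type.

Definition next_letter (w : seq A) (n : option A) := if w is x :: _ then Some x else n.
Definition prev_letter (p : option A) (w : seq A) :=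
  if w is x :: w' then Some (last x w') else p.

Lemma next_letter_cat w1 w2 n : next_letter (w1 ++ w2) n = next_letter w1
  (next_letter w2 n).
Proof. by case: w1. Qed.

Lemma prev_letter_cat p w1 w2 : prev_letter p (w1 ++ w2) = prev_letter
  (prev_letter p w1) w2.
Proof. by case: w1 => //= x w1; case: w2 => [|y w2]; rewrite ?cats0 // last_cat. Qed.

End Neighbours.

Fixpoint exposed_types (p : option caret_type) (w : seq caret_type)
    (n : option caret_type) : seq bool :=
  if w is x :: w' then exposed_type p x (next_letter w' n) :: exposed_types
    (Some x) w' n
  else [::].

Lemma exposed_types_cat p w1 w2 n : exposed_types p (w1 ++ w2) n =
  exposed_types p w1 (next_letter w2 n) ++ exposed_types (prev_letter p w1) w2 n.
Proof.
elim: w1 p => //= x w1 IH p; rewrite IH next_letter_cat; congr (_ :: _ ++ _).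
by case: w1 {IH} => //.
Qed.

Lemma interior_word_nil b t : (interior_word b t == [::]) = isleaf t.
Proof. by case: t => //= l r; rewrite -size_eq0 size_cat addnS. Qed.

(** The last caret of a nonempty interior subtree has no right child, so its letter is [Type_a] or
    [Type_close]. This is how the letter before an interior caret tells whether that caret has a
    left child. *)
Lemma prev_letter_interior b p t :
  oapp closing false (prev_letter p (interior_word b t)) =
  if isleaf t then oapp closing false p else true.
Proof.
elim: t b p => // l _ r IHr b p; rewrite /= prev_letter_cat.
have /= := IHr false (Some (if b then if isleaf r then Type_a else Type_open
       else if isleaf r then Type_close else Type_b)).
case: (interior_word false r) (interior_word_nil false r) => [<- _|x w <- e].
  by case: b.
exact: e.
Qed.

(** A caret with no right child is exposed unless the preceding letter ends its left subtree. The
    hypothesis on [p] keeps a letter in front of the whole subtree from being mistaken for such an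
    end. *)
Lemma exposed_interior b t p n : ~~ oapp closing false p ->
  exposed_types p (interior_word b t) n = exposures t.
Proof.
elim: t b p n => // l IHl r IHr b p n pc /=.
rewrite exposed_types_cat IHl //=; congr (_ ++ _).
case: (isleaf r) (interior_word_nil false r) (IHr false) => [/eqP-> e|_ ->].
- congr (_ :: _); last by rewrite -(e None None).
  by case: b; rewrite /= prev_letter_interior; case: isleaf.
- by case: b; rewrite andbF.
- by case: b.
Qed.

Lemma wl_nil t : (wl t == [::]) = isleaf t.
Proof. by rewrite -size_eq0 size_wl; case: t => //= l r; rewrite addnS. Qed.

Lemma wr_nil t : (wr t == [::]) = isleaf t.
Proof. by rewrite -size_eq0 size_wr; case: t => //= l r; rewrite addnS. Qed.

Lemma prev_letter_nil (A : eqType) (p : option A) (w : seq A) : (prev_letter p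
  w == None) =
  (p == None) && (w == [::]).
Proof. by case: w => [|x w]; rewrite ?eqxx ?andbT ?andbF. Qed.

Lemma next_letter_nil (A : eqType) (n : option A) (w : seq A) : (next_letter w
  n == None) =
  (n == None) && (w == [::]).
Proof. by case: w => [|x w]; rewrite ?eqxx ?andbT ?andbF. Qed.

Lemma next_letter_interior b t n : oapp boundary false (next_letter
  (interior_word b t) n) =
  isleaf t && oapp boundary false n.
Proof.
elim: t b n => // l IHl r _ b n; rewrite /= next_letter_cat IHl /=.
by case: b; case: (isleaf r); rewrite ?andbF.
Qed.

Lemma prev_letter_interior_boundary b t p :
  oapp boundary false (prev_letter p (interior_word b t)) =
  isleaf t && oapp boundary false p.
Proof.
case: t => // l r; have := prev_letter_interior b p (Node l r).
rewrite /= prev_letter_cat /=; set c := last _ _.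
by case: c.
Qed.

(** On the left side only the first caret lacks a left child, and its right child is missing exactly
    when the next letter is a boundary letter. *)
Lemma exposed_wl t n : oapp boundary false n ->
  exposed_types None (wl t) n = exposures t.
Proof.
elim: t n => // l IHl r _ n nb /=.
rewrite exposed_types_cat IHl //=; congr (_ ++ _ :: _); last first.
  exact: exposed_interior.
rewrite prev_letter_nil /= wl_nil next_letter_interior nb next_letter_nil.
by case: n nb => //= c _; rewrite andbT orbF.
Qed.

Lemma exposed_wr t p : oapp boundary false p ->
  exposed_types p (wr t) None = exposures t.
Proof.
elim: t p => // l _ r IHr p pb /=.
rewrite exposed_types_cat /= IHr // exposed_interior; last by case: p pb => // -[].
congr (_ ++ _ :: _).
rewrite prev_letter_nil prev_letter_interior_boundary pb next_letter_nil /= wr_nil.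
by case: p pb => //= c _; rewrite andbT andbC.
Qed.

Lemma exposed_word t : exposed_types None (word t) None = exposures t.
Proof.
case: t => // l r /=.
rewrite exposed_types_cat /= exposed_wl // exposed_wr //; congr (_ ++ _ :: _).
by rewrite prev_letter_nil next_letter_nil wl_nil wr_nil.
Qed.

(** * Depth of parentheses *)

Inductive counter_op : Type :=
  Nop | Push | Pop | Zero | Pos | Pos_push | Zero_push.

(** [None] is a failed test. [Pop] fails at zero, so depths are natural numbers and the integer
    counters simulating them never become negative. *)
Definition cstep (o : counter_op) (d : nat) : option nat :=
  match o with
  | Nop => Some d
  | Push => Some d.+1
  | Pop => if d is d'.+1 then Some d' else None
  | Zero => if d is 0 then Some 0 else None
  | Pos => if d is 0 then None else Some d
  | Pos_push => if d is 0 then None else Some d.+1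
  | Zero_push => if d is 0 then Some 1 else None
  end.

Fixpoint crun (s : seq counter_op) (d : nat) : option nat :=
  if s is o :: s' then obind (crun s') (cstep o d) else Some d.

Lemma crun_cat s1 s2 d : crun (s1 ++ s2) d = obind (crun s2) (crun s1 d).
Proof. by elim: s1 d => //= o s1 IH d; case: cstep => //=. Qed.

Definition depth_op (c : caret_type) : counter_op :=
  match c with
  | Type_open => Push
  | Type_close => Pop
  | Type_a => Nop
  | Type_b => Pos
  | _ => Zero
  end.

Definition depth (w : seq caret_type) : nat -> option nat :=
  crun (map depth_op w).

Lemma depth_cat w1 w2 d : depth (w1 ++ w2) d = obind (depth w2) (depth w1 d).
Proof. by rewrite /depth map_cat crun_cat. Qed.

Lemma depth_cons c w d :
  depth (c :: w) d = obind (depth w) (cstep (depth_op c) d).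
Proof. by []. Qed.

(** A first-kind caret with a right child opens a parenthesis; the second-kind carets down its right
    spine give letters [Type_b], and the last one closes it. So a first-kind subtree is balanced,
    while a second-kind subtree closes the parenthesis opened above it. *)
Lemma depth_interior t : (forall d, depth (wi1 t) d = Some d) /\
  (forall d, ~~ isleaf t -> depth (wi2 t) d.+1 = Some d).
Proof.
elim: t => // l [IHl _] r [_ IHr]; split=> d => [|_] /=;
  rewrite depth_cat IHl /=; case: r IHr => // r1 r2 /= IHr; exact: IHr.
Qed.

Lemma depth_wi1 t d : depth (wi1 t) d = Some d.
Proof. by have [] := depth_interior t. Qed.

Lemma depth_wi2 t d : ~~ isleaf t -> depth (wi2 t) d.+1 = Some d.
Proof. by have [_] := depth_interior t; apply. Qed.

Lemma depth_wl t : depth (wl t) 0 = Some 0.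
Proof. by elim: t => //= l IHl r _; rewrite depth_cat IHl /= depth_cons /=
  depth_wi1. Qed.

Lemma depth_wr t : depth (wr t) 0 = Some 0.
Proof. by elim: t => //= l _ r IHr; rewrite depth_cat depth_wi1 /= depth_cons /=. Qed.

Lemma boundary_interior b t : ~~ has boundary (interior_word b t).
Proof.
elim: t b => // l IHl r IHr b; rewrite /= has_cat /= !negb_or IHl IHr andbT /=.
by case: b; case: isleaf.
Qed.

Lemma notin_interior b t c : boundary c -> c \notin interior_word b t.
Proof. by move=> bc; apply: contra (boundary_interior b t) => ct; apply/hasP;
  exists c. Qed.

Lemma r_wl t : Type_r \notin wl t.
Proof.
by elim: t => // l IHl r _; rewrite /= mem_cat inE (negbTE IHl) caret_type_eqE
  (negbTE (notin_interior _ _ _)).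
Qed.

Lemma r_wr t : Type_r \notin wr t.
Proof.
elim: t => // l _ r IHr; rewrite /= mem_cat inE (negbTE IHr) caret_type_eqE /= orbF.
exact: notin_interior.
Qed.

(** The first and the last caret in infix order lie on the sides of the tree, whence the two
    boundary conditions. By [parse_word] these four conditions characterize the words of nonempty
    trees. *)
Definition valid_word (w : seq caret_type) : Prop :=
  [/\ depth w 0 = Some 0, oapp boundary false (next_letter w None),
      oapp boundary false (prev_letter None w) & count_mem Type_r w = 1].

Lemma valid_tree_word t : ~~ isleaf t -> valid_word (word t).
Proof.
case: t => // l r _; split.
- by rewrite /= depth_cat depth_wl /= depth_cons /= depth_wr.
- rewrite /= next_letter_cat; elim: l => // l1 IH l2 _ /=.
  by rewrite next_letter_cat; case: (wl l1) IH.
- rewrite /= prev_letter_cat /=.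
  elim: r (Type_r) (isT : boundary Type_r) => //= l1 _ r1 IH c pb.
  by rewrite last_cat /=; apply: IH.
- by rewrite /= count_cat /= eqxx !(elimT count_memPn) ?r_wl ?r_wr.
Qed.

(** * Reconstructing a tree from its word *)

(** Replacing the leftmost leaf puts the carets of [u] before those of [t] in infix order. Parsing
    removes letters at the front of a word, and this puts them back onto the tree found for the
    rest. *)
Fixpoint graft_left (t u : tree) : tree :=
  if t is Node l r then Node (graft_left l u) r else u.

Lemma interior_graft b t u : (b || ~~ isleaf t) ->
  interior_word b (graft_left t u) = wi1 u ++ interior_word b t.
Proof.
elim: t b => [|l IHl r _] b /=; first by case: b; rewrite ?cats0.
by rewrite IHl // catA.
Qed.

Lemma wl_graft t u : wl (graft_left t u) = wl u ++ wl t.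
Proof. by elim: t => [|l IHl r _] /=; rewrite ?cats0 // IHl catA. Qed.

Lemma isleaf_graft t u : ~~ isleaf t -> ~~ isleaf (graft_left t u).
Proof. by case: t. Qed.

(* Right after a point at depth d, d interior subtrees of the second kind are *)
(* still to be completed before the word returns to depth zero.               *)
Lemma parse_interior s d : depth s d = Some 0 ->
  exists Zs t w, [/\ size Zs = d, all (fun t => ~~ isleaf t) Zs,
    s = flatten (map wi2 Zs) ++ wi1 t ++ w, depth w 0 = Some 0 &
    if w is x :: _ then boundary x : Prop else True].
Proof.
elim: s d => [|x s IH] d; first by move=> [->]; exists [::], Leaf, [::].
have stop : boundary x -> depth (x :: s) d = Some 0 ->
  exists Zs t w, [/\ size Zs = d, all (fun t => ~~ isleaf t) Zs,
    x :: s = flatten (map wi2 Zs) ++ wi1 t ++ w, depth w 0 = Some 0 &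
    if w is x :: _ then boundary x : Prop else True].
  case: d => [|d]; last by case: x.
  by move=> bx e; exists [::], Leaf, (x :: s).
have graft d' u : depth s d' = Some 0 ->
    exists Zs t w, [/\ size Zs = d', all (fun t => ~~ isleaf t) Zs,
    wi1 u ++ s = flatten (map wi2 Zs) ++ wi1 t ++ w, depth w 0 = Some 0 &
    if w is x :: _ then boundary x : Prop else True].
  move=> /IH[[|Z Zs] [t [w [sZ nZ -> dw bw]]]].
    by exists [::], (graft_left t u), w; rewrite interior_graft //= catA.
  case/andP: nZ => nZ nZs.
  exists (graft_left Z u :: Zs), t, w; split => //=.
    by rewrite isleaf_graft.
  by rewrite interior_graft // -!catA.
case: x stop => stop; rewrite ?depth_cons /=; try exact: stop.
- move=> /IH[[|Z Zs] [t [w [//= [sZ] /andP[nZ nZs] -> dw bw]]]].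
  case: Zs nZs sZ => [|Y Zs] nZs sZ.
    exists [::], (graft_left t (Node Leaf Z)), w; split => //.
    by rewrite interior_graft //= (negbTE nZ) /= -!catA.
  case/andP: nZs => nY nZs; exists (graft_left Y (Node Leaf Z) :: Zs), t, w.
  split => //=; first by rewrite isleaf_graft.
  by rewrite interior_graft //= (negbTE nZ) /= -!catA.
- case: d stop => // d _ /IH[Zs [t [w [sZ nZ -> dw bw]]]].
  by exists (Node Leaf Leaf :: Zs), t, w; rewrite /= sZ nZ.
- exact: (graft d (Node Leaf Leaf)).
- case: d stop => // d _ /IH[[|Z Zs] [t [w [//= [sZ] /andP[nZ nZs] -> dw bw]]]].
  by exists (Node Leaf Z :: Zs), t, w; rewrite /= (negbTE nZ) sZ nZs.
Qed.

(** Up to the first boundary letter the word is one first-kind subtree, since the depth is zero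
    there; that letter is [Type_e], and the rest is parsed in the same way. The last letter excludes
    a trailing interior subtree, which would end in a closing letter; the default [Type_e] covers
    the empty word. *)
Lemma parse_right s : depth s 0 = Some 0 -> Type_r \notin s ->
  last Type_e s = Type_e -> exists t, s = wr t.
Proof.
have [n] := ubnP (size s); elim: n s => // n IH s sn ds rs ls.
have [Zs [t [w [/size0nil-> _ es dw bw]]]] := parse_interior ds.
move: sn rs ls; rewrite es /= {ds es}.
case: w dw bw => [_ _ _ _|x w dw bx sn rs].
  rewrite cats0; case: t => [|l r]; first by exists Leaf.
  have := prev_letter_interior true None (Node l r).
  case E: (interior_word _ _) => [|y z] //= hc hl.
  by rewrite hl in hc.
rewrite last_cat /= => ls.
have xe : x = Type_e.
  by case: x bx rs {dw ls sn} => // _; rewrite mem_cat inE eqxx orbT.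
rewrite {}xe in dw ls rs sn *.
have [||||u ->] := IH w.
- by move: sn; rewrite size_cat /=; lia.
- exact: dw.
- by apply: contra rs; rewrite mem_cat inE => ->; rewrite !orbT.
- exact: ls.
by exists (Node t u).
Qed.

(** The recursion goes through suffixes that start with an interior subtree, whence the extra factor
    [wi1 t]; it is empty when the word starts with a boundary letter. *)
Lemma parse_left s : depth s 0 = Some 0 -> count_mem Type_r s = 1 ->
  boundary (last Type_e s) ->
  exists t l r, s = wi1 t ++ wl l ++ Type_r :: wr r.
Proof.
have [n] := ubnP (size s); elim: n s => // n IH s sn ds rs ls.
have [Zs [t [w [/size0nil-> _ es dw bw]]]] := parse_interior ds.
move: sn rs ls; rewrite es /= {ds es} count_cat size_cat (elimT count_memPn)
  ?notin_interior //.
case: w dw bw => [//|x w dw bx sn rs].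
rewrite last_cat /= => ls; move: dw; rewrite depth_cons.
have [xr|xr] := eqVneq x Type_r.
  rewrite xr in ls sn rs *.
  move=> /= dw; move: rs; rewrite /= eqxx /= => -[rw].
  have rw' : Type_r \notin w by apply/count_memPn; rewrite -[RHS]rw.
  suff lw : last Type_e w = Type_e.
    by have [r ->] := parse_right dw rw' lw; exists t, Leaf, r.
  case: w ls rw' {dw rw sn} => //= y w ls rw'.
  have ll : last y w \in y :: w by exact: mem_last.
  by case: (last y w) ls ll => // _ h; rewrite h in rw'.
have xe : x = Type_e by case: x bx xr {ls sn rs} => //; rewrite eqxx.
rewrite xe in ls sn rs *; move: rs => /=.
rewrite caret_type_eqE /= add0n => rs dw.
have [||//|//|u [l [r ->]]] := IH w; first by move: sn => /=; lia.
  exact: dw.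
by exists t, (graft_left l (Node Leaf u)), r; rewrite wl_graft /= -!catA.
Qed.

Lemma parse_word w : valid_word w -> exists2 t, ~~ isleaf t & w = word t.
Proof.
move=> [dw bn bp cw]; have [|t [l [r ew]]] := parse_left dw cw.
  by case: w bp {dw bn cw}.
exists (Node l r) => //; move: bn; rewrite ew; case: t {ew} => // a b.
by rewrite next_letter_cat next_letter_interior.
Qed.

(* Reading an interior word from left to right rebuilds the tree: the stack   *)
(* holds, for every open parenthesis, the left subtrees of the right spine    *)
(* that it starts, and the second component is the tree completed so far.     *)
Definition parse_step (st : seq (seq tree) * tree) (c : caret_type) :=
  let: (stack, t) := st in
  match c, stack with
  | Type_a, _ => (stack, Node t Leaf)
  | Type_open, _ => ([:: t] :: stack, Leaf)
  | Type_b, ts :: stack' => ((t :: ts) :: stack', Leaf)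
  | Type_close, ts :: stack' =>
      (stack', foldl (fun r l => Node l r) (Node t Leaf) ts)
  | _, _ => st
  end.

Lemma parse_interior_word t :
  (forall stack, foldl parse_step (stack, Leaf) (wi1 t) = (stack, t)) /\
  (forall ts stack, ~~ isleaf t ->
    foldl parse_step (ts :: stack, Leaf) (wi2 t) =
    (stack, foldl (fun r l => Node l r) t ts)).
Proof.
elim: t => // l [IHl _] r [_ IHr]; split=> [|ts] stack => [|_] /=;
  rewrite foldl_cat IHl /=; case: r IHr => // r1 r2 IHr.
  exact: (IHr [:: l]).
exact: (IHr (l :: ts)).
Qed.

Lemma wi1_inj : injective wi1.
Proof.
move=> t u e; have [+ _] := parse_interior_word t; move=> /(_ [::]).
by rewrite e; have [-> _] := parse_interior_word u; case.
Qed.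

Lemma catI_notin (T : eqType) (x : T) s1 s2 t1 t2 : x \notin s1 -> x \notin s2 ->
  s1 ++ x :: t1 = s2 ++ x :: t2 -> s1 = s2 /\ t1 = t2.
Proof.
elim: s1 s2 => [|y s1 IH] [|z s2] //=; rewrite ?inE ?negb_or.
- by move=> _ _ [->].
- by move=> _ /andP[/eqP h _] [e]; case: h.
- by move=> /andP[/eqP h _] _ [e]; case: h.
- by move=> /andP[_ h1] /andP[_ h2] [-> /IH[]// -> ->].
Qed.

Lemma catI_notin_r (T : eqType) (x : T) s1 s2 t1 t2 :
  x \notin t1 -> x \notin t2 ->
  s1 ++ x :: t1 = s2 ++ x :: t2 -> s1 = s2 /\ t1 = t2.
Proof.
move=> h1 h2 /(congr1 rev); rewrite !rev_cat !rev_cons -!cats1 -!catA /=.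
by move=> /catI_notin; rewrite !mem_rev => /(_ h1 h2)[/(can_inj revK)->
  /(can_inj revK)->].
Qed.

Lemma wl_inj : injective wl.
Proof.
elim=> [|l IH r _] [|l' r'] //=; try by move/(congr1 size); rewrite size_cat addnS.
move=> /catI_notin_r[]; rewrite ?notin_interior //.
by move=> /IH-> /wi1_inj->.
Qed.

Lemma wr_inj : injective wr.
Proof.
elim=> [|l _ r IH] [|l' r'] //=; try by move/(congr1 size); rewrite size_cat addnS.
move=> /catI_notin[]; rewrite ?notin_interior //.
by move=> /wi1_inj-> /IH->.
Qed.

Lemma word_inj : injective word.
Proof.
move=> [|l r] [|l' r'] //=; try by move/(congr1 size); rewrite size_cat addnS.
move=> /catI_notin[]; rewrite ?r_wl //.
by move=> /wl_inj-> /wr_inj->.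
Qed.

(** * Adding and removing carets *)

Fixpoint add_caret (n : nat) (t : tree) : tree :=
  if t is Node l r then
    if n <= ncarets l then Node (add_caret n l) r
    else Node l (add_caret (n - (ncarets l).+1) r)
  else Node Leaf Leaf.

Lemma isleaf_add_caret n t : isleaf (add_caret n t) = false.
Proof. by case: t => //= l r; case: ifP. Qed.

Lemma ncarets_add_caret n t : ncarets (add_caret n t) = (ncarets t).+1.
Proof. by elim: t n => //= l IHl r IHr n; case: ifP => _ /=; rewrite ?IHl ?IHr;
  lia. Qed.

(* The new caret is the right child of its predecessor in infix order if the  *)
(* latter has no right child, and the left child of its successor otherwise.  *)
Fixpoint insert_caret (n : nat) (w : seq caret_type) : seq caret_type :=
  match n, w with
  | 0, _ => Type_a :: w
  | 1, c :: w' =>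
    match c with
    | Type_a => [:: Type_open, Type_close & w']
    | Type_close => [:: Type_b, Type_close & w']
    | _ => [:: c, Type_a & w']
    end
  | n'.+1, c :: w' => c :: insert_caret n' w'
  | _, _ => w
  end.

Lemma insert_caret_catl n w1 w2 : n <= size w1 ->
  insert_caret n (w1 ++ w2) = insert_caret n w1 ++ w2.
Proof.
elim: w1 n => [|c w1 IH] [|[|n]] // nw; first by case: c nw.
exact: (congr1 (cons c) (IH n.+1 nw)).
Qed.

Lemma insert_caret_catr n w1 w2 :
  insert_caret (size w1 + n.+1) (w1 ++ w2) = w1 ++ insert_caret n.+1 w2.
Proof.
elim: w1 => // c w1 IH; rewrite addSn addnS.
by move: IH; rewrite addnS => IH; exact: (congr1 (cons c) IH).
Qed.

(** Into an empty word [insert_caret] writes [Type_a], which is right for a first-kind position. A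
    caret added at a leaf of second-kind position also changes the letter of its parent, so that
    case is treated at the parent. *)
Lemma interior_add_caret n t b : n <= ncarets t -> b || ~~ isleaf t ->
  interior_word b (add_caret n t) = insert_caret n (interior_word b t).
Proof.
elim: t n b => [|l IHl r IHr] n b; first by case: n => //; case: b.
move=> nt _ /=; case: ifP => nl /=.
  by rewrite IHl // insert_caret_catl // size_interior_word.
rewrite isleaf_add_caret.
have -> : n = size (wi1 l) + (n - (ncarets l).+1).+1.
  by rewrite size_interior_word; lia.
rewrite insert_caret_catr size_interior_word.
have -> : ncarets l + (n - (ncarets l).+1).+1 - (ncarets l).+1 = n - (ncarets
  l).+1 by lia.
have : n - (ncarets l).+1 <= ncarets r by move: nt => /=; lia.
case: (n - _) => [|m] mr.
  case: r IHr {nt mr} => [|r1 r2] IHr; first by case: b.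
  by rewrite IHr //; case: b.
by case: r IHr mr {nt} => // r1 r2 IHr mr; rewrite IHr //; case: b.
Qed.

Lemma wl_add_caret n t : n <= ncarets t ->
  wl (add_caret n t) = if n == 0 then Type_e :: wl t else insert_caret n (wl t).
Proof.
elim: t n => [|l IHl r _] n; first by case: n.
move=> nt /=; case: ifP => nl /=.
  rewrite IHl //; case: eqP => // _.
  by rewrite insert_caret_catl // size_wl.
have -> : (n == 0) = false by lia.
have -> : n = size (wl l) + (n - (ncarets l).+1).+1 by rewrite size_wl; lia.
rewrite insert_caret_catr size_wl.
have -> : ncarets l + (n - (ncarets l).+1).+1 - (ncarets l).+1 = n - (ncarets
  l).+1 by lia.
have : n - (ncarets l).+1 <= ncarets r by move: nt => /=; lia.
case: (n - _) => [|m] mr; first by rewrite interior_add_caret.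
by rewrite interior_add_caret.
Qed.

Lemma wr_add_caret n t : n <= ncarets t ->
  wr (add_caret n t) =
  if n == ncarets t then rcons (wr t) Type_e else insert_caret n (wr t).
Proof.
elim: t n => [|l _ r IHr] n; first by case: n.
move=> nt /=; case: ifP => nl /=.
  rewrite interior_add_caret // insert_caret_catl ?size_interior_word //.
  by case: eqP => //; lia.
have -> : (n == ncarets l + (ncarets r).+1) = (n - (ncarets l).+1 == ncarets r) by lia.
have -> : n = size (wi1 l) + (n - (ncarets l).+1).+1 by rewrite size_interior_word; lia.
rewrite insert_caret_catr size_interior_word.
have -> : ncarets l + (n - (ncarets l).+1).+1 - (ncarets l).+1 = n - (ncarets
  l).+1 by lia.
have mr : n - (ncarets l).+1 <= ncarets r by move: nt => /=; lia.
rewrite IHr //; case: eqP => e; first by rewrite rcons_cat.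
by case: (n - _) e.
Qed.

Lemma word_add_caret n t : ~~ isleaf t -> n <= ncarets t ->
  word (add_caret n t) =
  if n == 0 then Type_e :: word t
  else if n == ncarets t then rcons (word t) Type_e else insert_caret n (word t).
Proof.
case: t => // l r _ nt /=; case: ifP => nl /=.
  rewrite wl_add_caret //; case: eqP => // _.
  rewrite insert_caret_catl ?size_wl //; case: eqP => //; lia.
have -> : (n == 0) = false by lia.
have -> : (n == ncarets l + (ncarets r).+1) = (n - (ncarets l).+1 == ncarets r) by lia.
have -> : n = size (wl l) + (n - (ncarets l).+1).+1 by rewrite size_wl; lia.
rewrite insert_caret_catr size_wl.
have -> : ncarets l + (n - (ncarets l).+1).+1 - (ncarets l).+1 = n - (ncarets
  l).+1 by lia.
have mr : n - (ncarets l).+1 <= ncarets r by move: nt => /=; lia.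
rewrite wr_add_caret //; case: eqP => e; first by rewrite rcons_cat.
by case: (n - _) e.
Qed.

(** Applied to the exposures of two trees this is reducedness, up to the exception made for the
    identity; see [reducedE]. *)
Definition compat (E1 E2 : seq bool) : bool :=
  all (fun x => ~~ (x.1 && x.2)) (zip E1 E2).

Lemma compat_cat E1 E2 E1' E2' : size E1 = size E2 ->
  compat (E1 ++ E1') (E2 ++ E2') = compat E1 E2 && compat E1' E2'.
Proof. by move=> e; rewrite /compat zip_cat // all_cat. Qed.

Lemma compatC E1 E2 : compat E1 E2 = compat E2 E1.
Proof.
elim: E1 E2 => [|x E1 IH] [|y E2] //=.
by rewrite /compat /= (andbC x); congr (_ && _); exact: IH.
Qed.

Lemma compat_mono E p p' : all2 implb p p' -> compat E p' -> compat E p.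
Proof.
elim: E p p' => [|x E IH] [|y p] [|y' p'] //= /andP[yy pp] /andP[/= xy Ep].
by apply/andP; split; [case: x y y' yy xy => [] [] []|exact: IH pp Ep].
Qed.

Lemma all2_cat (A B : Type) (r : A -> B -> bool) p p' q q' :
  all2 r p p' -> all2 r q q' -> all2 r (p ++ q) (p' ++ q').
Proof. by elim: p p' => [|x p IH] [|x' p'] //= /andP[-> /IH h] /h. Qed.

Lemma all2_implb_refl p : all2 implb p p.
Proof. by elim: p => // -[]. Qed.

(** The new caret is exposed and can only take exposure away from its parent; the comparisons by
    [implb] record that no old caret becomes exposed. *)
Lemma exposures_add_caret n t : n <= ncarets t -> exists p q p' q',
  [/\ exposures (add_caret n t) = p ++ true :: q, exposures t = p' ++ q', size p = n,
      all2 implb p p' & all2 implb q q'].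
Proof.
elim: t n => [|l IHl r IHr] n; first by case: n => // _; exists [::], [::], [::], [::].
move=> nt /=; case: ifP => nl /=.
  have [p [q [p' [q' [-> -> sp pp qq]]]]] := IHl _ nl.
  exists p, (q ++ false :: exposures r), p', (q' ++ (isleaf l && isleaf r) ::
    exposures r).
  rewrite isleaf_add_caret -!catA; split => //.
  by apply: all2_cat => //=; exact: all2_implb_refl.
have mr : n - (ncarets l).+1 <= ncarets r by move: nt => /=; lia.
have [p [q [p' [q' [-> -> sp pp qq]]]]] := IHr _ mr.
exists (exposures l ++ false :: p), q, (exposures l ++ (isleaf l && isleaf r)
  :: p'), q'.
rewrite isleaf_add_caret andbF -!catA; split => //.
  by rewrite size_cat size_exposures /= sp; lia.
by apply: all2_cat => //; exact: all2_implb_refl.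
Qed.

Lemma compat_add_caret E1 E2 t : size E1 + size E2 = ncarets t ->
  compat (E1 ++ E2) (exposures t) ->
  compat (E1 ++ false :: E2) (exposures (add_caret (size E1) t)).
Proof.
move=> sE; have [|p [q [p' [q' [-> et sp pp qq]]]]] := @exposures_add_caret (size E1) t.
  by lia.
have sp' : size p' = size E1 by rewrite -sp; move: pp; rewrite all2E => /andP[/eqP->].
rewrite et !compat_cat //= => /andP[c1 c2].
by apply/andP; split; [exact: compat_mono pp c1|exact: compat_mono qq c2].
Qed.

Lemma exposures_contract n t : nth false (exposures t) n ->
  exists2 t', t = add_caret n t' & n <= ncarets t'.
Proof.
elim: t n => [|l IHl r IHr] n /=; first by rewrite nth_nil.
rewrite nth_cat size_exposures; case: ltnP => nl.
  move=> /IHl[l' el nl']; exists (Node l' r) => /=; last by lia.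
  by rewrite nl' -el.
case E: (n - _) => [|m] /=.
  move=> /andP[]; case: l IHl nl E => //= _ nl E; case: r {IHr} => // _.
  by exists Leaf => //; lia.
move=> /IHr[r' er mr']; exists (Node l r') => /=; last by lia.
have -> : (n <= ncarets l) = false by lia.
have -> : n - (ncarets l).+1 = m by lia.
by rewrite -er.
Qed.

(** After the first insertion, leaf [ncarets t] is the left leaf of the new caret and no longer the
    last leaf. This double insertion is the one in [X1_add2]. *)
Lemma exposures_add_caret_last t : ~~ isleaf t -> exists E x,
  [/\ exposures t = rcons E x, exposures (add_caret (ncarets t) t) = E ++ [::
    false; true] &
      exposures (add_caret (ncarets t) (add_caret (ncarets t) t)) =
      E ++ [:: false; true; false]].
Proof.
elim: t => // l _ r IHr _ /=.
have h : (ncarets l + (ncarets r).+1 <= ncarets l) = false by lia.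
rewrite h /= h /=.
have -> : ncarets l + (ncarets r).+1 - (ncarets l).+1 = ncarets r by lia.
rewrite !isleaf_add_caret !andbF.
case: r IHr {h} => [_|r1 r2 /(_ isT)[E [x [-> -> ->]]]].
  by exists (exposures l), (isleaf l && true); rewrite cats1.
exists (exposures l ++ (isleaf l && isleaf (Node r1 r2)) :: E), x.
by rewrite rcons_cat andbF -!catA.
Qed.

(** * Piecewise affine maps *)

Local Open Scope ring_scope.

Section Analysis.
Variable R : realType.
Local Notation I01 := (set_type (`[0, 1]%classic : set R)).
Local Notation F := (thompsonF R).

Definition affine_on (g : I01 -> I01) (J K : R * R) : Prop :=
  forall x : I01, J.1 <= val x <= J.2 ->
    val (g x) = K.1 + (K.2 - K.1) / (J.2 - J.1) * (val x - J.1).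

Fixpoint piecewise (P : R * R -> R * R -> Prop) (Js Ks : seq (R * R)) : Prop :=
  match Js, Ks with
  | [::], [::] => True
  | J :: Js', K :: Ks' => P J K /\ piecewise P Js' Ks'
  | _, _ => False
  end.

Fixpoint chain (a : R) (Js : seq (R * R)) (b : R) : Prop :=
  if Js is J :: Js' then [/\ J.1 = a, a < J.2 & chain J.2 Js' b] else a = b.

Lemma piecewise_size P Js Ks : piecewise P Js Ks -> size Js = size Ks.
Proof. by elim: Js Ks => [|J Js IH] [|K Ks] //= [_ /IH->]. Qed.

Lemma piecewise_cat P Js1 Js2 Ks1 Ks2 : size Js1 = size Ks1 ->
  piecewise P (Js1 ++ Js2) (Ks1 ++ Ks2) <->
  piecewise P Js1 Ks1 /\ piecewise P Js2 Ks2.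
Proof.
elim: Js1 Ks1 => [|J Js IH] [|K Ks] //=; first by move=> _; split=> [|[]].
move=> [/IH h]; split=> [[p /h[]]|[[p q] r]] //; split => //.
by apply/h.
Qed.

Lemma piecewise_nth P Js Ks : size Js = size Ks -> piecewise P Js Ks <->
  forall i, (i < size Js)%N -> P (nth (0, 0) Js i) (nth (0, 0) Ks i).
Proof.
elim: Js Ks => [|J Js IH] [|K Ks] //= [/IH h]; split.
  by move=> [p /h q] [|i] //; apply: q.
by move=> q; split; [exact: (q 0%N)|apply/h => i; exact: (q i.+1)].
Qed.

Lemma piecewise_impl (P Q : R * R -> R * R -> Prop) Js Ks :
  (forall J K, J \in Js -> K \in Ks -> P J K -> Q J K) ->
  piecewise P Js Ks -> piecewise Q Js Ks.
Proof.
elim: Js Ks => [|J Js IH] [|K Ks] //= PQ [p /IH q]; split.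
  by apply: PQ => //; rewrite inE eqxx.
by apply: q => J' K' hJ hK; apply: PQ; rewrite inE ?hJ ?hK orbT.
Qed.

Lemma chain_cat a b c Js1 Js2 :
  chain a Js1 b -> chain b Js2 c -> chain a (Js1 ++ Js2) c.
Proof. by elim: Js1 a => [|J Js1 IH] a //= => [->|[h1 h2 /IH h] /h]. Qed.

Lemma chain_le a Js b : chain a Js b -> a <= b.
Proof. by elim: Js a => [|J Js IH] a /= => [->//|[_ aJ /IH]]; lra. Qed.

Lemma chain_lt a J Js b : chain a (J :: Js) b -> a < b.
Proof. by move=> [_ aJ /chain_le]; lra. Qed.

Lemma chain_mem a Js b J : chain a Js b -> J \in Js ->
  [/\ a <= J.1, J.1 < J.2 & J.2 <= b].
Proof.
elim: Js a => //= J' Js IH a [Ja aJ c]; rewrite inE => /orP[/eqP->|/(IH _ c)[]].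
  by split => //; rewrite ?Ja //; exact: chain_le c.
by split; lra.
Qed.

Lemma chain_cover a Js b x : chain a Js b -> a < b -> a <= x -> x <= b ->
  exists2 J, J \in Js & J.1 <= x <= J.2.
Proof.
elim: Js a => [|J Js IH] a /=; first by move=> ->; lra.
move=> [Ja aJ c] ab ax xb; case: (lerP x J.2) => xJ.
  by exists J; rewrite ?inE ?eqxx // Ja ax.
have [|||J' J's h] := IH _ c; try lra.
by exists J' => //; rewrite inE J's orbT.
Qed.

Lemma chain_no_break a Js b x y : chain a Js b -> a < b -> a <= x -> y <= b ->
  x <= y -> (forall J, J \in Js -> ~~ (x < J.2 < y)) ->
  exists2 J, J \in Js & J.1 <= x /\ y <= J.2.
Proof.
elim: Js a => [|J Js IH] a /=; first by move=> ->; lra.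
move=> [Ja aJ c] ab ax yb xy nb; case: (lerP y J.2) => yJ.
  by exists J; rewrite ?inE ?eqxx // Ja.
have := nb J; rewrite inE eqxx yJ andbT -leNgt => /(_ isT) Jx.
have [|||||J' J's h] := IH _ c; try lra.
- by move=> J' J's; apply: nb; rewrite inE J's orbT.
- by exists J' => //; rewrite inE J's orbT.
Qed.

Lemma piecewise_pick P Js Ks J : piecewise P Js Ks -> J \in Js ->
  exists2 K, K \in Ks & P J K.
Proof.
elim: Js Ks => // J' Js IH [|K Ks] //= [p /IH q]; rewrite inE =>
  /orP[/eqP->|/q[K' K's h]].
  by exists K; rewrite ?inE ?eqxx.
by exists K' => //; rewrite inE K's orbT.
Qed.

Lemma leaf_intervals_chain a b t : a < b -> chain a (leaf_intervals a b t) b.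
Proof.
elim: t a b => [|l IHl r IHr] a b ab //=.
by apply: chain_cat; [apply: IHl|apply: IHr]; lra.
Qed.

Lemma size_leaf_intervals (a b : R) t :
  size (leaf_intervals a b t) = (ncarets t).+1.
Proof.
by elim: t a b => //= l IHl r IHr a b; rewrite size_cat IHl IHr addSn.
Qed.

Definition rep (t s : tree) (g : I01 -> I01) : Prop :=
  piecewise (affine_on g) (leaf_intervals 0 1 t) (leaf_intervals 0 1 s).

Lemma representsE t s (g : F) : ncarets t = ncarets s ->
  represents t s g <-> rep t s (val g).
Proof.
move=> ts; rewrite /represents /rep piecewise_nth ?size_leaf_intervals ?ts //.
Qed.

Lemma I01_mem (x : R) : 0 <= x <= 1 -> {y : I01 | val y = x}.
Proof. by move=> h; exists (SigSub (I01_subproof h)). Qed.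

Lemma affine_bounds (J K : R * R) (x : R) : J.1 < J.2 -> K.1 < K.2 ->
  J.1 <= x <= J.2 ->
  K.1 <= K.1 + (K.2 - K.1) / (J.2 - J.1) * (x - J.1) <= K.2.
Proof.
move=> JJ KK /andP[h1 h2].
have e : (K.2 - K.1) / (J.2 - J.1) * (x - J.1) = (K.2 - K.1) * ((x - J.1) /
  (J.2 - J.1)).
  by rewrite mulrAC mulrA.
have t0 : 0 <= (x - J.1) / (J.2 - J.1) by apply: divr_ge0; lra.
have t1 : (x - J.1) / (J.2 - J.1) <= 1 by rewrite ler_pdivrMr; lra.
rewrite e; move: t0 t1; set t := _ / _ => t0 t1.
by apply/andP; split; nra.
Qed.

Lemma piecewise_comp a a' b b' Js Ks Ls (g h : I01 -> I01) :
  chain a Js a' -> chain b Ks b' ->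
  piecewise (affine_on h) Js Ks -> piecewise (affine_on g) Ks Ls ->
  piecewise (affine_on (g \o h)) Js Ls.
Proof.
elim: Js a b Ks Ls => [|J Js IH] a b [|K Ks] [|L Ls] //=.
move=> [Ja aJ cJ] [Kb bK cK] [hJ hJs] [gK gKs]; split; last exact: IH cJ cK hJs gKs.
move=> x xJ; rewrite -[val ((g \o h) x)]/(val (g (h x))).
have hx := hJ x xJ.
have xK : K.1 <= val (h x) <= K.2 by rewrite hx; apply: affine_bounds => //; lra.
rewrite (gK _ xK) hx.
field.
by apply/andP; split; lra.
Qed.

Lemma rep_comp u t s (g h : I01 -> I01) :
  rep u t h -> rep t s g -> rep u s (g \o h).
Proof. by apply: piecewise_comp; apply: leaf_intervals_chain ltr01. Qed.

Lemma piecewise_inv a b b' Js Ks (g g' : I01 -> I01) : cancel g g' ->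
  0 <= a -> chain a Js 1 -> chain b Ks b' ->
  piecewise (affine_on g) Js Ks -> piecewise (affine_on g') Ks Js.
Proof.
move=> gK; elim: Js a b Ks => [|J Js IH] a b [|K Ks] //= a0.
move=> [Ja aJ cJ] [Kb bK cK] [hJ hJs]; split; last by apply: IH cJ cK hJs; lra.
move=> x xK; set y := (X in _ = X).
have J1 := chain_le cJ.
have yJ : J.1 <= y <= J.2 by apply: affine_bounds => //; lra.
have [|z zy] := @I01_mem y; first by lra.
rewrite -zy -[z in RHS]gK; congr (val (g' _)); apply: val_inj.
rewrite hJ zy // /y; field.
by apply/andP; split; lra.
Qed.

Lemma rep_inv t s (g g' : I01 -> I01) : cancel g g' -> rep t s g -> rep s t g'.
Proof.
move=> gK; apply: (piecewise_inv gK (lexx 0));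
  exact: leaf_intervals_chain ltr01.
Qed.

Lemma rep_inj t s (g h : I01 -> I01) : rep t s g -> rep t s h -> g =1 h.
Proof.
move=> gr hr x; apply: val_inj.
have c := @leaf_intervals_chain 0 1 t ltr01.
have [||J Jt xJ] := chain_cover c ltr01 (x := val x); [exact: I01_ge0|exact: I01_le1|].
move: gr hr; rewrite /rep; elim: (leaf_intervals 0 1 t) (leaf_intervals 0 1 s)
  Jt => // J' Js IH [|K Ks] //.
rewrite inE => /orP[/eqP <-|Js_ /=] [h1 h2] [h3 h4]; first by rewrite h1 // h3.
exact: IH h2 h4.
Qed.

Lemma affine_half (g : I01 -> I01) a b a' b' : a < b ->
  affine_on g (a, b) (a', b') <->
  affine_on g (a, (a + b) / 2) (a', (a' + b') / 2) /\
  affine_on g ((a + b) / 2, b) ((a' + b') / 2, b').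
Proof.
move=> ab; have ba : b - a != 0 by lra.
split=> [h|[h1 h2] x /= xab].
  split=> x /= xab; rewrite h /=; try lra; field; do ?[apply/andP; split]; lra.
case: (lerP (sval x) ((a + b) / 2)) => xm; [rewrite h1 /=|rewrite h2 /=]; try lra;
  field; do ?[apply/andP; split]; lra.
Qed.

(** Halving an interval and its image keeps the slope, so hanging the same tree at corresponding
    leaves of two trees does not change the map that they represent. *)
Lemma affine_tree (g : I01 -> I01) a b a' b' t : a < b ->
  affine_on g (a, b) (a', b') <->
  piecewise (affine_on g) (leaf_intervals a b t) (leaf_intervals a' b' t).
Proof.
elim: t a b a' b' => [|l IHl r IHr] a b a' b' ab; first by split=> [//|[]].
rewrite affine_half // (IHl _ _ _ _ _); last by lra.
rewrite (IHr _ _ _ _ _); last by lra.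
by rewrite /= piecewise_cat ?size_leaf_intervals.
Qed.

End Analysis.

(** * Elements of F from dyadic subdivisions *)

Section Existence.
Variable R : realType.
Local Notation I01 := (set_type (`[0, 1]%classic : set R)).
Local Notation F := (thompsonF R).

(* The closest point to y in [0, w]. *)
Definition clamp (y w : R) : R := (`|y| - `|y - w| + w) / 2.

Lemma clamp_le y w : 0 <= w -> y <= 0 -> clamp y w = 0.
Proof. by move=> w0 y0; rewrite /clamp !ler0_norm; lra. Qed.

Lemma clamp_ge y w : 0 <= w -> w <= y -> clamp y w = w.
Proof. by move=> w0 y0; rewrite /clamp !ger0_norm; lra. Qed.

Lemma clamp_id y w : 0 <= y -> y <= w -> clamp y w = y.
Proof. by move=> y0 yw; rewrite /clamp ger0_norm // ler0_norm; lra. Qed.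

Lemma clamp_homo y z w : 0 <= w -> y <= z -> clamp y w <= clamp z w.
Proof.
move=> w0 yz; case: (lerP y 0) => y0; case: (lerP z w) => zw.
- rewrite (clamp_le w0 y0); case: (lerP z 0) => z0; first by rewrite clamp_le.
  by rewrite clamp_id; lra.
- by rewrite (clamp_le w0 y0) (clamp_ge w0 (ltW zw)).
- by rewrite !clamp_id; lra.
- rewrite (clamp_ge w0 (ltW zw)).
  by case: (lerP y w) => yw; [rewrite clamp_id|rewrite clamp_ge]; lra.
Qed.

(** A sum of ramps: the term of [J] and [K] rises from 0 to the length of [K] while [x] crosses [J]
    and is constant elsewhere. Continuity and monotonicity can thus be checked term by term. *)
Fixpoint interpolate (Js Ks : seq (R * R)) (x : R) : R :=
  match Js, Ks with
  | J :: Js', K :: Ks' =>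
      (K.2 - K.1) / (J.2 - J.1) * clamp (x - J.1) (J.2 - J.1) +
      interpolate Js' Ks' x
  | _, _ => 0
  end.

Lemma interpolate_continuous Js Ks : continuous (interpolate Js Ks).
Proof.
elim: Js Ks => [|J Js IH] [|K Ks] x /=; try exact: cst_continuous.
apply: cvgD; last exact: IH.
apply: cvgM; first exact: cvg_cst.
rewrite /clamp; apply: cvgM; last exact: cvg_cst.
have aux c : (fun y : R => `|y - c|) @ x --> `|x - c|.
  apply: (@cvg_norm _ R^o); apply: cvgB; [exact: cvg_id|exact: cvg_cst].
apply: cvgD; last exact: cvg_cst.
apply: cvgB; first exact: aux.
rewrite -addrA -opprD; under eq_fun do rewrite -addrA -opprD.
exact: aux.
Qed.

Lemma interpolate_lo a Js b Ks x : chain a Js b -> x <= a -> interpolate Js Ks x = 0.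
Proof.
elim: Js a Ks => [|J Js IH] a [|K Ks] //= [Ja aJ c] xa.
rewrite (IH J.2) ?clamp_le ?mulr0 ?addr0 //; lra.
Qed.

Lemma interpolate_piece a Js b a' Ks b' : chain a Js b -> chain a' Ks b' ->
  size Js = size Ks ->
  piecewise (fun J K => forall x, J.1 <= x <= J.2 ->
    a' + interpolate Js Ks x = K.1 + (K.2 - K.1) / (J.2 - J.1) * (x - J.1)) Js Ks.
Proof.
elim: Js a a' Ks => [|J Js IH] a a' [|K Ks] //= [Ja aJ c] [Ka aK c'] [s].
split.
  move=> x xJ; rewrite (interpolate_lo _ c) ?clamp_id; lra.
have := IH _ _ _ c c' s; apply: piecewise_impl => J' K' J's K's h x xJ.
rewrite -h // clamp_ge; try lra; last by have [] := chain_mem c J's; lra.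
by rewrite Ka divfK; lra.
Qed.

Lemma interpolate_homo a Js b a' Ks b' x y : chain a Js b -> chain a' Ks b' ->
  x <= y -> interpolate Js Ks x <= interpolate Js Ks y.
Proof.
elim: Js a a' Ks => [|J Js IH] a a' [|K Ks] //= [Ja aJ c] [Ka aK c'] xy.
apply: lerD; last exact: IH c c' xy.
apply: ler_wpM2l; first by apply: divr_ge0; lra.
apply: clamp_homo; lra.
Qed.

Lemma interpolate_lt a Js b a' Ks b' x y : chain a Js b -> chain a' Ks b' ->
  size Js = size Ks -> a <= x -> y <= b -> x < y ->
  interpolate Js Ks x < interpolate Js Ks y.
Proof.
elim: Js a a' Ks => [|J Js IH] a a' [|K Ks] //=; first by move=> ->; lra.
move=> [Ja aJ c] [Ka aK c'] [s] ax yb xy.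
have k0 : 0 < (K.2 - K.1) / (J.2 - J.1) by apply: divr_gt0; lra.
case: (lerP J.2 x) => xJ.
  rewrite !clamp_ge; try lra; rewrite ltrD2l.
  by apply: (IH _ _ _ c c') => //; lra.
apply: ltr_leD; last by apply: interpolate_homo c c' _; lra.
rewrite ltr_pM2l // (clamp_id (y := x - J.1)); try lra.
case: (lerP y J.2) => yJ; [rewrite clamp_id|rewrite clamp_ge]; lra.
Qed.

Lemma piecewise_and_flip P Q (Js Ks : seq (R * R)) : piecewise P Js Ks ->
  piecewise Q Ks Js -> piecewise (fun J K => P J K /\ Q K J) Js Ks.
Proof. by elim: Js Ks => [|J Js IH] [|K Ks] //= [p /IH h] [q /h]. Qed.

Lemma affine_cancel (J K : R * R) (x : R) : J.1 < J.2 -> K.1 < K.2 ->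
  J.1 + (J.2 - J.1) / (K.2 - K.1) *
    (K.1 + (K.2 - K.1) / (J.2 - J.1) * (x - J.1) - K.1) = x.
Proof. by move=> h1 h2; field; apply/andP; split; lra. Qed.

Lemma interpolate_bij Js Ks (x : R) : chain 0 Js 1 -> chain 0 Ks 1 ->
  size Js = size Ks -> 0 <= x <= 1 ->
  0 <= interpolate Js Ks x <= 1 /\
  interpolate Ks Js (interpolate Js Ks x) = x.
Proof.
move=> c c' s x01.
have [||J Jt xJ] := chain_cover c ltr01 (x := x); try lra.
have := piecewise_and_flip (interpolate_piece c c' s) (interpolate_piece c' c (esym s)).
move=> /(piecewise_pick)/(_ Jt)[K Kt [h1 h2]].
have [J1 J2 J3] := chain_mem c Jt; have [K1 K2 K3] := chain_mem c' Kt.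
have := h1 x xJ; rewrite add0r => e.
have b := affine_bounds J2 K2 xJ; split; first by rewrite e; lra.
have := h2 (interpolate Js Ks x); rewrite add0r => ->; rewrite e //.
exact: affine_cancel.
Qed.

Definition dyadic_interval (J : R * R) : Prop :=
  dyadic J.1 /\ exists n : nat, J.2 - J.1 = 2 ^- n.

Lemma dyadic_interval_right J : dyadic_interval J -> dyadic J.2.
Proof.
move=> [d [n e]]; have -> : J.2 = J.2 - J.1 + J.1 by ring.
by apply: dyadicD => //; exists 1, n; rewrite e mul1r.
Qed.

(** Interpolation with the two lists exchanged is the inverse. Lengths of standard intervals are
    powers of 2, hence so are the slopes, and the right ends of [Js] serve as breakpoints. *)
Lemma element_exists Js Ks : chain 0 Js 1 -> chain 0 Ks 1 ->
  size Js = size Ks -> (forall J, J \in Js -> dyadic_interval J) ->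
  (forall K, K \in Ks -> dyadic_interval K) ->
  exists g : F, piecewise (affine_on (val g)) Js Ks.
Proof.
move=> c c' s dJ dK.
pose f Ls Ms cL cM (h : size Ls = size Ms) (x : I01) : I01 :=
  SigSub (I01_subproof (interpolate_bij cL cM h (introT andP (conj (I01_ge0 x)
    (I01_le1 x)))).1).
have fE Ls Ms cL cM h x : val (@f Ls Ms cL cM h x) = interpolate Ls Ms (val x) by [].
have fK Ls Ms cL cM h h' : cancel (@f Ls Ms cL cM h) (@f Ms Ls cM cL h').
  move=> x; apply: val_inj; rewrite !fE.
  by have [|_ ->] := interpolate_bij cL cM h (x := val x); rewrite ?I01_ge0 ?I01_le1.
have fC Ls Ms cL cM h : continuous (@f Ls Ms cL cM h).
  apply: continuous_comp_initial => x.
  apply: (@continuous_comp _ _ _ (set_val : I01 -> R) (interpolate Ls Ms)).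
    exact: initial_continuous.
  exact: interpolate_continuous.
have fA : piecewise (affine_on (f _ _ c c' s)) Js Ks.
  apply: piecewise_impl (interpolate_piece c c' s) => J K _ _ h x xJ.
  by rewrite fE -h // add0r.
suff Tf : thompson_set (f _ _ c c' s).
  by exists (SigSub (mem_set Tf)).
split.
- split; first exact: fC.
  by exists (f _ _ c' c (esym s)); split; [exact: fC|exact: fK|exact: fK].
- move=> x y xy; rewrite !fE; apply: (interpolate_lt c c' s) => //.
    exact: I01_ge0.
  exact: I01_le1.
exists [seq J.2 | J <- Js] => [b /mapP[J Jt ->]|x y nb].
  exact/dyadic_interval_right/dJ.
(* If y < x, no point lies between them and any slope and constant will do. *)
case: (lerP (val x) (val y)) => xy; last first.
  by exists 0, 0 => z h; exfalso; move: (val z) h => z'; lra.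
have [|||J Jt [Jx yJ]] := chain_no_break c ltr01 _ _ xy.
- exact: I01_ge0.
- exact: I01_le1.
- by move=> J Jt; apply: nb; apply/mapP; exists J.
have [K Kt fJ] := piecewise_pick fA Jt.
have [_ [n en]] := dJ _ Jt; have [_ [m em]] := dK _ Kt.
exists (n%:Z - m%:Z), (K.1 - 2 ^ (n%:Z - m%:Z) * J.1) => z xzy.
rewrite fJ; last by move: (val z) xzy => z'; lra.
have -> : (2 : R) ^ (n%:Z - m%:Z) = (K.2 - K.1) / (J.2 - J.1).
  rewrite en em expfzDr ?pnatr_eq0 // -exprnN invrK mulrC.
  by rewrite -exprnP.
ring.
Qed.

End Existence.

(** * Reduced pairs of trees *)

Fixpoint leaves (t : tree) : seq (seq bool) :=
  if t is Node l r then map (cons false) (leaves l) ++ map (cons true) (leaves r)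
  else [:: [::]].

Lemma size_leaves t : size (leaves t) = (ncarets t).+1.
Proof. by elim: t => //= l IHl r IHr; rewrite size_cat !size_map IHl IHr addSn. Qed.

Lemma map_cons_inj (a a' b b' : seq (seq bool)) :
  map (cons false) a ++ map (cons true) b =
  map (cons false) a' ++ map (cons true) b' -> a = a' /\ b = b'.
Proof.
elim: a a' => [|x a IH] [|x' a'] //=.
- move=> h; split => //; apply: inj_map h => ? ? [] //.
- by case: b.
- by move=> {IH}; case: b'.
- by move=> [-> /IH[-> ->]].
Qed.

Lemma leaves_inj : injective leaves.
Proof.
elim=> [|l IHl r IHr] [|l' r'] //=; try by move/(congr1 size); rewrite size_cat
  !size_map !size_leaves /=; lia.
by move=> /map_cons_inj[/IHl-> /IHr->].
Qed.

Lemma nth_leaves_Node l r i : (i <= (ncarets (Node l r)))%N ->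
  nth [::] (leaves (Node l r)) i =
  if (i <= ncarets l)%N then false :: nth [::] (leaves l) i
  else true :: nth [::] (leaves r) (i - (ncarets l).+1).
Proof.
move=> /= h; rewrite nth_cat size_map size_leaves ltnS; case: leqP => il.
  by rewrite (nth_map [::]) // size_leaves.
by rewrite (nth_map [::]) // size_leaves; lia.
Qed.

Lemma isleaf_leaf t i : (i <= ncarets t)%N ->
  nth [::] (leaves t) i = [::] -> isleaf t.
Proof. by case: t => // l r it; rewrite nth_leaves_Node //; case: ifP. Qed.

Lemma exposures_siblings t n p : (n < ncarets t)%N ->
  nth [::] (leaves t) n = rcons p false ->
  nth [::] (leaves t) n.+1 = rcons p true -> nth false (exposures t) n.
Proof.
elim: t n p => // l IHl r IHr n p nt.
rewrite !nth_leaves_Node //; last exact: ltnW.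
rewrite /= nth_cat size_exposures; case: (ltngtP n (ncarets l)) => nl.
- case: p => [|c p] //= [<-] h1 [h2]; exact: IHl h1 h2.
- have [m mn] : exists m, n = (ncarets l).+1 + m by exists (n - (ncarets l).+1)%N; lia.
  have -> : (n - ncarets l)%N = m.+1 by lia.
  have -> : (n - (ncarets l).+1)%N = m by lia.
  have -> : (n.+1 - (ncarets l).+1)%N = m.+1 by lia.
  case: p => [|c p] //= [<-] h1 [h2]; apply: IHr h1 h2.
  by move: nt => /=; lia.
- rewrite nl !subnn; case: p => [|c p] /=; last by case=> <-.
  by move=> [/isleaf_leaf hl] [/isleaf_leaf hr]; rewrite hl // hr.
Qed.

(** Leaves [n] and [n.+1] of [t] are the two leaves of an exposed caret, and this caret sits at leaf
    [j] of [u] or below it. *)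
Definition caret_below_leaf (t u : tree) : Prop :=
  exists n j s, [/\ (n < ncarets t)%N, (j <= ncarets u)%N,
    nth [::] (leaves t) n = nth [::] (leaves u) j ++ rcons s false &
    nth [::] (leaves t) n.+1 = nth [::] (leaves u) j ++ rcons s true].

Lemma caret_below_Leaf t : ~~ isleaf t -> caret_below_leaf t Leaf.
Proof.
suff h : ~~ isleaf t -> exists n s, [/\ (n < ncarets t)%N,
    nth [::] (leaves t) n = rcons s false &
    nth [::] (leaves t) n.+1 = rcons s true].
  by move=> /h[n [s [h1 h2 h3]]]; exists n, 0%N, s.
elim: t => // l IHl r IHr _.
have [ll|/IHl[n [s [h1 h2 h3]]]] := boolP (isleaf l); last first.
  exists n, (false :: s); split; first by rewrite /=; lia.
    by rewrite nth_leaves_Node ?h2 /=; [case: ifP => //; lia|lia].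
  by rewrite nth_leaves_Node ?h3 /=; [case: ifP => //; lia|lia].
case: l ll {IHl} => // _.
have [rl|/IHr[n [s [h1 h2 h3]]]] := boolP (isleaf r).
  by case: r rl {IHr} => // _; exists 0%N, [::].
exists n.+1, (true :: s); split; first by rewrite /=; lia.
  by rewrite nth_leaves_Node ?h2 /= ?subn1 //= ?h2 //; lia.
by rewrite nth_leaves_Node ?h3 /= ?subn1 //= ?h3 //; lia.
Qed.

Lemma caret_below_left l r l' r' :
  caret_below_leaf l l' -> caret_below_leaf (Node l r) (Node l' r').
Proof.
move=> [n [j [s [h1 h2 h3 h4]]]]; exists n, j, s.
rewrite /= in h1 h2 *; split; try lia.
  by rewrite !nth_leaves_Node /=; try lia; rewrite h2 ltnW // h3.
by rewrite !nth_leaves_Node /=; try lia; rewrite h2 h1 h4.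
Qed.

Lemma caret_below_right l r l' r' :
  caret_below_leaf r r' -> caret_below_leaf (Node l r) (Node l' r').
Proof.
move=> [n [j [s [h1 h2 h3 h4]]]].
exists ((ncarets l).+1 + n)%N, ((ncarets l').+1 + j)%N, s.
have c (t : tree) i : ((ncarets t).+1 + i <= ncarets t)%N = false by lia.
have d (t : tree) i : ((ncarets t).+1 + i - (ncarets t).+1)%N = i by lia.
split; rewrite /=; try lia.
  by rewrite !nth_leaves_Node /=; try lia; rewrite !c !d h3.
by rewrite -addnS !nth_leaves_Node /=; try lia; rewrite !c !d h4.
Qed.

(** Going down from the root, two different trees disagree at a vertex that is a leaf of one and a
    caret of the other; below that caret there is an exposed one. *)
Lemma tree_dichotomy t u :
  [\/ t = u, caret_below_leaf t u | caret_below_leaf u t].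
Proof.
elim: t u => [|l IHl r IHr] [|l' r']; first by constructor 1.
- by constructor 3; exact: caret_below_Leaf.
- by constructor 2; exact: caret_below_Leaf.
case: (IHl l') => [->|h|h].
- case: (IHr r') => [->|h|h]; first by constructor 1.
    by constructor 2; exact: caret_below_right.
  by constructor 3; exact: caret_below_right.
- by constructor 2; exact: caret_below_left.
- by constructor 3; exact: caret_below_left.
Qed.

Lemma reducedE t s : ncarets t = ncarets s -> reduced t s <->
  (t = Node Leaf Leaf /\ s = Node Leaf Leaf) \/ compat (exposures t) (exposures s).
Proof.
move=> ts; rewrite /reduced.
suff -> : compat (exposures t) (exposures s) <-> forall n, (n < size (carets t))%N ->
    ~~ (exposed t (nth [::] (carets t) n) && exposed s (nth [::] (carets s) n)) by [].
rewrite size_carets; split=> [/(all_nthP (false, false)) h n nt|h].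
  have := h n; rewrite size_zip !size_exposures -ts minnn => /(_ nt).
  by rewrite nth_zip ?size_exposures //= !nth_exposures -?ts.
apply/(all_nthP (false, false)) => n; rewrite size_zip !size_exposures -ts minnn => nt.
by rewrite nth_zip ?size_exposures //= -!nth_exposures -?ts // h.
Qed.

(** * Uniqueness of the reduced pair *)

Section Pairs.
Variable R : realType.
Local Notation I01 := (set_type (`[0, 1]%classic : set R)).
Local Notation F := (thompsonF R).

Fixpoint itv (a b : R) (p : seq bool) : R * R :=
  if p is c :: p' then
    if c then itv ((a + b) / 2) b p' else itv a ((a + b) / 2) p'
  else (a, b).

Lemma leaf_intervalsE a b t : leaf_intervals a b t = map (itv a b) (leaves t).
Proof.
elim: t a b => //= l IHl r IHr a b.
by rewrite IHl IHr map_cat -!map_comp.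
Qed.

Lemma itv_cat a b p q :
  itv a b (p ++ q) = itv (itv a b p).1 (itv a b p).2 q.
Proof. by elim: p a b => //= -[] p IH a b; rewrite IH. Qed.

Lemma itv_bounds a b p : a < b ->
  [/\ a <= (itv a b p).1, (itv a b p).1 < (itv a b p).2 & (itv a b p).2 <= b].
Proof.
elim: p a b => [|c p IH] a b ab /=; first by split.
by case: c; [have [|h1 h2 h3] := IH ((a + b) / 2) b|
             have [|h1 h2 h3] := IH a ((a + b) / 2)]; try split; lra.
Qed.

Lemma itv_inj a b : a < b -> injective (itv a b).
Proof.
move=> ab p; elim: p a b ab => [|c p IH] a b ab [|c' q] //=;
  have [h1 h2] : a < (a + b) / 2 /\ (a + b) / 2 < b by split; lra.
- case: c' => e; [have := itv_bounds q h2|have := itv_bounds q h1];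
    by rewrite -e /= {e} => -[] ? ? ?; exfalso; lra.
- case: c => e; [have := itv_bounds p h2|have := itv_bounds p h1];
    by rewrite e /= {e} => -[] ? ? ?; exfalso; lra.
case: c; case: c' => // e; try by rewrite (IH _ _ _ _ e).
  have := itv_bounds p h2; have := itv_bounds q h1; rewrite e.
  by move=> {e} [? ? ?] [? ? ?]; exfalso; lra.
have := itv_bounds p h1; have := itv_bounds q h2; rewrite e.
by move=> {e} [? ? ?] [? ? ?]; exfalso; lra.
Qed.

Lemma affine_itv (g : I01 -> I01) a b a' b' p : a < b ->
  affine_on g (a, b) (a', b') -> affine_on g (itv a b p) (itv a' b' p).
Proof.
elim: p a b a' b' => //= c p IH a b a' b' ab /(affine_half _ _ _ ab)[h1 h2].
by case: c; apply: IH => //; lra.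
Qed.

Lemma affine_on_ends (g : I01 -> I01) (J K : R * R) x :
  J.1 < J.2 -> affine_on g J K ->
  (val x = J.1 -> val (g x) = K.1) /\ (val x = J.2 -> val (g x) = K.2).
Proof.
move=> J12 h; split=> e; rewrite h e ?lexx ?ltW //.
  by rewrite subrr mulr0 addr0.
by rewrite divfK; lra.
Qed.

Lemma affine_on_uniq (g : I01 -> I01) (J K K' : R * R) :
  0 <= J.1 -> J.1 < J.2 -> J.2 <= 1 ->
  affine_on g J K -> affine_on g J K' -> K = K'.
Proof.
move=> J0 J12 J1 h h'.
have [|x x1] := @I01_mem R J.1; first by lra.
have [|y y2] := @I01_mem R J.2; first by lra.
have [/(_ x1) e1 _] := affine_on_ends x J12 h.
have [/(_ x1) e1' _] := affine_on_ends x J12 h'.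
have [_ /(_ y2) e2] := affine_on_ends y J12 h.
have [_ /(_ y2) e2'] := affine_on_ends y J12 h'.
by case: K K' {h h'} e1 e1' e2 e2' => [? ?] [? ?] /= -> -> -> ->.
Qed.

Lemma rep_leaf t s (g : I01 -> I01) i : rep t s g -> (i <= ncarets t)%N ->
  affine_on g (itv 0 1 (nth [::] (leaves t) i)) (itv 0 1 (nth [::] (leaves s) i)).
Proof.
rewrite /rep => /[dup] /piecewise_size; rewrite !size_leaf_intervals => -[ts].
move/piecewise_nth; rewrite !size_leaf_intervals ts => /(_ erefl) h it.
have := h i it; rewrite !leaf_intervalsE !(nth_map [::]) ?size_leaves ?ts //.
Qed.

(** On a leaf interval of [t'] the map is affine onto a standard dyadic interval, so it carries the
    two halves of any standard subinterval to the two halves of its image. Hence the two leaves of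
    the exposed caret of [t] go to siblings in [s], and the caret with the same number is exposed
    there too. *)
Lemma rep_not_compat t s t' s' (g : I01 -> I01) : rep t s g -> rep t' s' g ->
  caret_below_leaf t t' -> ~~ compat (exposures t) (exposures s).
Proof.
move=> r r' [n [j [p [nt jt e0 e1]]]].
have ts : ncarets t = ncarets s.
  by move/piecewise_size: r; rewrite !size_leaf_intervals => -[].
have leafE c m : (m <= ncarets t)%N ->
    nth [::] (leaves t) m = nth [::] (leaves t') j ++ rcons p c ->
    nth [::] (leaves s) m = rcons (nth [::] (leaves s') j ++ p) c.
  move=> mt e; apply: (@itv_inj 0 1 ltr01).
  have [J0 J12 J1] := itv_bounds (nth [::] (leaves t) m) (ltr01 : 0 < 1 :> R).
  apply: (affine_on_uniq J0 J12 J1); first exact: rep_leaf r mt.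
  rewrite rcons_cat e !itv_cat.
  have := rep_leaf r' jt; have [_] := itv_bounds (nth [::] (leaves t') j)
    (ltr01 : 0 < 1 :> R).
  move: (itv 0 1 _) (itv 0 1 _) => -[a b] [a' b'] ab _; exact: affine_itv.
have h0 := leafE _ _ (ltnW nt) e0; have h1 := leafE _ _ nt e1.
have et : nth false (exposures t) n.
  by apply: (exposures_siblings (p := nth [::] (leaves t') j ++ p)); rewrite ?rcons_cat.
have es : nth false (exposures s) n.
  by apply: exposures_siblings h0 h1; rewrite -ts.
apply/negP => /(all_nthP (false, false)) /(_ n).
by rewrite size_zip !size_exposures -ts minnn nth_zip ?size_exposures //= et es
  => /(_ nt).
Qed.

Lemma reduced_rep_inj t s t' s' (g : I01 -> I01) : rep t s g -> rep t' s' g ->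
  ~~ isleaf t -> ~~ isleaf t' -> reduced t s -> reduced t' s' ->
  t = t' /\ s = s'.
Proof.
move=> r r' lt lt' red red'.
have sz u v : rep u v g -> ncarets u = ncarets v.
  by move/piecewise_size; rewrite !size_leaf_intervals => -[].
have not_below u v u' v' : rep u v g -> rep u' v' g -> ~~ isleaf u' ->
    reduced u v -> ~ caret_below_leaf u u'.
  move=> ru ru' lu' /(reducedE (sz _ _ ru))[[-> _]|c] b.
    (* In the exceptional pair the only exposed caret is the root, and it lies below a leaf of [u']
       only if [u'] is itself a leaf. *)
    case: b => -[|n] [j [p [// _ jt /esym e0 _]]].
    have e : nth [::] (leaves u') j = [::].
      case: (nth _ _ _) e0 => //= c q [_].
      by move/(congr1 size); rewrite size_cat size_rcons addnS.
    by move: (isleaf_leaf jt e); rewrite (negbTE lu').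
  by have := rep_not_compat ru ru' b; rewrite c.
have tt' : t = t'.
  case: (tree_dichotomy t t') => // b.
    by case: (not_below _ _ _ _ r r' lt' red b).
  by case: (not_below _ _ _ _ r' r lt red' b).
split=> //; apply: leaves_inj; apply: (@eq_from_nth _ [::]).
  by rewrite !size_leaves -(sz _ _ r) -(sz _ _ r') tt'.
move=> i; rewrite size_leaves ltnS -(sz _ _ r) => it.
apply: (@itv_inj 0 1 ltr01).
have [J0 J12 J1] := itv_bounds (nth [::] (leaves t) i) (ltr01 : 0 < 1 :> R).
apply: (affine_on_uniq J0 J12 J1); first exact: rep_leaf r it.
by rewrite tt'; apply: rep_leaf r' _; rewrite -tt'.
Qed.

Lemma itv_dyadic a b p : dyadic a -> dyadic b -> a < b ->
  dyadic (itv a b p).1 /\ (itv a b p).2 - (itv a b p).1 = (b - a) * 2 ^- size p.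
Proof.
elim: p a b => [|c p IH] a b da db ab /=; first by rewrite expr0 invr1 mulr1.
have dm : dyadic ((a + b) / 2).
  have -> : (a + b) / 2 = 2 ^ (- 1) * (a + b) by rewrite -exprN1; ring.
  exact/dyadicM2/dyadicD.
rewrite exprS invfM mulrA.
by case: c; [have [||| h ->] := IH ((a + b) / 2) b|have [||| h ->] := IH a ((a
  + b) / 2)];
  rewrite ?h //; try lra; split => //; congr (_ * _); field.
Qed.

Lemma leaf_dyadic t (J : R * R) : J \in leaf_intervals 0 1 t -> dyadic_interval J.
Proof.
rewrite leaf_intervalsE => /mapP[p _ ->].
have [||h1 h2] := @itv_dyadic 0 1 p _ _ ltr01.
- by exists 0, 0%N; rewrite mul0r.
- by exists 1, 0%N; rewrite expr0 divr1.
by split => //; exists (size p); rewrite h2 subr0 mul1r.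
Qed.

Lemma rep_exists t s : ncarets t = ncarets s -> exists g : F, rep t s (val g).
Proof.
move=> ts; apply: element_exists; try exact: leaf_dyadic;
  try exact: leaf_intervals_chain ltr01.
by rewrite !size_leaf_intervals ts.
Qed.

End Pairs.

(** * Every element has a tree pair *)

Section TreePairs.
Variable R : realType.
Local Notation I01 := (set_type (`[0, 1]%classic : set R)).
Local Notation F := (thompsonF R).

Lemma pow2_gt0 (z : int) : 0 < (2 : R) ^ z.
Proof. by rewrite exprz_gt0. Qed.

Lemma pow2B1 (z : int) : (2 : R) ^ (z - 1) = 2 ^ z / 2.
Proof. by rewrite expfzDr ?pnatr_eq0 // exprN1. Qed.

Lemma tile_right (a m b x : R) (qs : seq (seq bool)) : a < m -> m < b ->
  m = (a + b) / 2 -> all (fun q => q != [::]) qs -> m <= x ->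
  chain x (map (itv a b) qs) b ->
  exists2 L, qs = map (cons true) L & chain x (map (itv m b) L) b.
Proof.
move=> am mb em; elim: qs x => [|[//|c q] qs IH] x /=.
  by move=> _ _ ->; exists [::].
move=> nq mx [h1 h2 h3].
have [L eL cL] := IH _ nq (le_trans mx (ltW h2)) h3.
move: h1 h2 h3 cL; rewrite -!em; case: c => h1 h2 h3 cL.
  by exists (q :: L); rewrite ?eL.
by have [_] := itv_bounds q am; lra.
Qed.

Lemma tile_split (a m b x : R) (qs : seq (seq bool)) : a < m -> m < b ->
  m = (a + b) / 2 -> all (fun q => q != [::]) qs -> x <= m ->
  chain x (map (itv a b) qs) b ->
  exists L0 L1, [/\ qs = map (cons false) L0 ++ map (cons true) L1,
    chain x (map (itv a m) L0) m & chain m (map (itv m b) L1) b].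
Proof.
move=> am mb em; elim: qs x => [|[//|c q] qs IH] x /= nq xm; first by lra.
move=> h; have [h1 h2 h3] := h.
move: h h1 h2 h3; rewrite -!em; case: c => h h1 h2 h3.
  have exm : x = m by have [] := itv_bounds q mb; lra.
  have [|L eL cL] := @tile_right a m b m ((true :: q) :: qs) am mb em nq (lexx m).
    by rewrite /= -!em; split; [rewrite h1|lra|].
  by exists [::], L.
have [|L0 [L1 [-> c0 c1]]] := IH _ nq _ h3; first by have [] := itv_bounds q am.
by exists (q :: L0), L1.
Qed.

(** A standard dyadic interval other than the whole lies in one of the two halves, so a tiling with
    more than one piece splits at the midpoint and its halves give the two subtrees. The induction
    is on the total length of the addresses. *)
Lemma tile_tree (qs : seq (seq bool)) (a b : R) : a < b ->
  chain a (map (itv a b) qs) b -> exists t, leaves t = qs.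
Proof.
have [n] := ubnP (\sum_(q <- qs) (size q).+1)%N.
elim: n qs a b => // n IH qs a b + ab c.
have [nq|/allPn[[|//] nilq _]] := boolP (all (fun q => q != [::]) qs); last first.
  suff -> : qs = [:: [::]] by exists Leaf.
  case: qs nilq c => //= q qs; rewrite inE => /orP[/eqP<-|nilq] /= [h1 h2 h3].
    by case: qs h3 => // q' qs /chain_lt; rewrite ltxx.
  by have /= [] := chain_mem h3 (map_f _ nilq) => *; exfalso; lra.
have [am mb] : a < (a + b) / 2 /\ (a + b) / 2 < b by split; lra.
have [L0 [L1 [-> c0 c1]]] := tile_split am mb erefl nq (ltW am) c.
rewrite big_cat !big_map /= => sn.
have L00 : (0 < size L0)%N by case: L0 c0 {sn} => //= h; move: am; rewrite -h ltxx.
have L10 : (0 < size L1)%N by case: L1 c1 {sn} => //= h; move: mb; rewrite h ltxx.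
have sE (L : seq (seq bool)) : (\sum_(q <- L) (size q).+2 = \sum_(q <- L) (size
  q).+1 + size L)%N.
  by under eq_bigr do rewrite -addn1; rewrite big_split /= sum1_size.
have [|l <-] := IH L0 _ _ _ am c0; first by move: sn; rewrite !sE; lia.
have [|r <-] := IH L1 _ _ _ mb c1; first by move: sn; rewrite !sE; lia.
by exists (Node l r).
Qed.

Lemma itv_ex r (m : nat) (a b : R) : (m < 2 ^ r)%N ->
  exists2 q, size q = r & itv a b q =
    (a + (b - a) * (m%:R / 2 ^+ r), a + (b - a) * (m.+1%:R / 2 ^+ r)).
Proof.
elim: r m a b => [|r IH] m a b.
  rewrite expn0; case: m => // _; exists [::] => //=.
  by rewrite expr0; congr pair; field.
have p0 : (2 : R) ^+ r != 0 by rewrite expf_neq0 // pnatr_eq0.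
rewrite expnS => mr; have [mr'|mr'] := ltnP m (2 ^ r).
  have [q sq eq] := IH m a ((a + b) / 2) mr'.
  exists (false :: q); rewrite /= ?sq // eq exprS; congr pair; field; exact: p0.
have [|q sq eq] := IH (m - 2 ^ r)%N ((a + b) / 2) b; first by lia.
exists (true :: q); rewrite /= ?sq // eq exprS.
have -> : (m - 2 ^ r).+1 = (m.+1 - 2 ^ r)%N by lia.
by rewrite !natrB ?natrX; try lia; congr pair; field; exact: p0.
Qed.

Definition good (g : I01 -> I01) (p : seq bool) : Prop :=
  exists q, affine_on g (itv 0 1 p) (itv 0 1 q).

Definition covered (g : I01 -> I01) (p : seq bool) : Prop :=
  exists t, forall l, l \in leaves t -> good g (p ++ l).

Lemma covered_node g p : covered g (rcons p false) -> covered g (rcons p true) ->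
  covered g p.
Proof.
move=> [l hl] [r hr]; exists (Node l r) => x; rewrite /= mem_cat.
by move=> /orP[] /mapP[y yt ->]; rewrite -cat_rcons; [exact: hl|exact: hr].
Qed.

Lemma itv_rcons (a b : R) p c : itv a b (rcons p c) =
  let m := ((itv a b p).1 + (itv a b p).2) / 2 in
  if c then (m, (itv a b p).2) else ((itv a b p).1, m).
Proof. by rewrite -cats1 itv_cat /=; case: c. Qed.

(* If the image of I_p has length w and left endpoint a multiple of w / 2^e,  *)
(* then e bisections turn the images into standard dyadic intervals.          *)
Lemma covered_affine (g : I01 -> I01) (e : nat) p (u : R) (z m : int) :
  affine_on g (itv 0 1 p) (u, u + 2 ^ z) -> u = m%:~R * 2 ^ (z - e%:Z) ->
  covered g p.
Proof.
elim: e p u z m => [|e IH] p u z m h eu; have [J0 J12 J1] := itv_bounds p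
  (ltr01 : 0 < 1 :> R).
  exists Leaf => l; rewrite inE => /eqP->; rewrite cats0.
  have [|x x1] := @I01_mem R (itv 0 1 p).1; first by lra.
  have [|y y2] := @I01_mem R (itv 0 1 p).2; first by lra.
  have [/(_ x1)/= gx _] := affine_on_ends x J12 h.
  have [_ /(_ y2)/= gy] := affine_on_ends y J12 h.
  have u0 : 0 <= u by rewrite -gx; exact: I01_ge0.
  have u1 : u + 2 ^ z <= 1 by rewrite -gy; exact: I01_le1.
  have w0 := pow2_gt0 z.
  have [r ez] : exists r : nat, z = - r%:Z.
    case: z {h gy w0 eu} u1 => [r|r] u1; last by exists r.+1.
    exists 0%N; case: r u1 => // r u1; exfalso.
    have : (1 : R) < 2 ^+ r.+1 by rewrite exprn_egt1 // ltr1n.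
    by move: u1; rewrite -exprnP; lra.
  rewrite ez ?subr0 -exprnN in h eu u1 w0.
  have [k em] : exists k : nat, m = k.
    case: m eu => [k|k] eu; first by exists k.
    exfalso; move: u0; rewrite eu pmulr_lge0 // ler0z //.
  rewrite em -pmulrn in eu.
  have kr : (k < 2 ^ r)%N.
    rewrite -(ltr_nat R) natrX.
    have : k.+1%:R * 2 ^- r <= (1 : R) by rewrite -natr1 mulrDl mul1r -eu.
    rewrite ler_pdivrMr ?exprn_gt0 // mul1r; apply: lt_le_trans.
    by rewrite ltr_nat.
  have [q _ eq] := @itv_ex r k 0 1 kr.
  exists q; rewrite eq; move: h; congr (affine_on _ _ (_, _)).
    by rewrite eu; ring.
  by rewrite eu -natr1; ring.
have /affine_half h' : affine_on g ((itv 0 1 p).1, (itv 0 1 p).2) (u, u + 2 ^ z).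
  by case: (itv _ _ _) h.
have [h0 h1] := h' J12.
have hw : 2 ^ z = 2 ^ (z - 1) + 2 ^ (z - 1) :> R by rewrite pow2B1; field.
have mid : (u + (u + 2 ^ z)) / 2 = u + 2 ^ (z - 1) by rewrite pow2B1; field.
have ee : z - 1 - e%:Z = z - e.+1%:Z by lia.
apply: covered_node.
  apply: (IH _ u (z - 1) m); last by rewrite ee.
  by rewrite itv_rcons /= -mid.
apply: (IH _ (u + 2 ^ (z - 1)) (z - 1) (m + 2 ^+ e)).
  by move: h1; rewrite itv_rcons /= mid hw addrA.
rewrite ee eu rmorphD rmorphXn /= mulrDl; congr (_ + _).
rewrite exprnP -expfzDr ?pnatr_eq0 //; congr (_ ^ _); lia.
Qed.

Lemma covered_linear (g : F) p (k : int) (c : R) :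
  (forall z : I01, (itv 0 1 p).1 <= val z <= (itv 0 1 p).2 ->
    val (val g z) = 2 ^ k * val z + c) -> covered (val g) p.
Proof.
move=> gE; have [J0 J12 J1] := itv_bounds p (ltr01 : 0 < 1 :> R).
have [||dJ wJ] := @itv_dyadic R 0 1 p _ _ ltr01.
- by exists 0, 0%N; rewrite mul0r.
- by exists 1, 0%N; rewrite expr0 divr1.
have [|x x1] := @I01_mem R (itv 0 1 p).1; first by lra.
have gx := gE x; rewrite x1 lexx ltW // in gx; have {}gx := gx isT.
have : dyadic (val (val g x)).
  by apply: (iffLR (thompson_dyadic (set_valP g) x)); rewrite x1.
rewrite gx => -[m [M um]].
set n := size p in wJ; set u := _ + c in um.
rewrite subr0 mul1r exprnN in wJ.
(* The image has length 2^(k - n) and left end u = m / 2^M. With e = M + |k| bisections, the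
   exponent N = n + |k| - k is nonnegative and satisfies N + (k - n) - e = - M, so that u is an
   integer multiple of 2^(k - n - e). *)
have [N NE] : exists N : nat, N%:Z = n%:Z + (absz k)%:Z - k.
  by exists (absz (n%:Z + (absz k)%:Z - k)%R); lia.
apply: (@covered_affine _ (M + absz k)%N _ u (k - n%:Z) (m * 2 ^+ N)).
  move=> z zJ; rewrite gE //= [u + _ - u]addrC addKr expfzDr ?pnatr_eq0 // -wJ.
  rewrite mulfK /u; [ring|lra].
rewrite um rmorphM rmorphXn /= -mulrA; congr (_ * _).
rewrite [in RHS]exprnP -expfzDr ?pnatr_eq0 // exprnN; congr (_ ^ _).
by rewrite NE PoszD; ring.
Qed.

Lemma itv_grid p : exists m : nat, itv 0 1 p =
  (m%:R / 2 ^+ size p, m.+1%:R / 2 ^+ size p) :> R * R.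
Proof.
elim/last_ind: p => [|p c [m IH]].
  by exists 0%N; rewrite /= expr0 mul0r divr1.
have p0 : (2 : R) ^+ size p != 0 by rewrite expf_neq0 // pnatr_eq0.
rewrite itv_rcons IH size_rcons exprS /=.
have e1 : m.+1%:R = m%:R + 1 :> R by rewrite natr1.
have e2 : m.*2%:R = 2 * m%:R :> R by rewrite -mul2n natrM.
have e3 : m.*2.+1%:R = 2 * m%:R + 1 :> R by rewrite -e2 natr1.
have e4 : m.*2.+2%:R = 2 * m%:R + 2 :> R by rewrite -addn2 natrD e2.
case: c; [exists m.*2.+1|exists m.*2]; congr pair;
  rewrite ?e4 ?e3 ?e2 ?e1; field; exact: p0.
Qed.

Lemma dyadic_grid (s : seq R) : (forall b, b \in s -> dyadic b) ->
  exists N : nat, forall b, b \in s -> exists m : int, b = m%:~R / 2 ^+ N.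
Proof.
elim: s => [|b s IH] h; first by exists 0%N.
have [|N hN] := IH; first by move=> x xs; apply: h; rewrite inE xs orbT.
have [m [n eb]] := h b (mem_head _ _).
have p0 i : (2 : R) ^+ i != 0 by rewrite expf_neq0 // pnatr_eq0.
exists (N + n)%N => x; rewrite inE => /orP[/eqP->|/hN[m' ->]].
  exists (m * 2 ^+ N); rewrite eb rmorphM rmorphXn /= exprD.
  by field; rewrite !p0.
exists (m' * 2 ^+ n); rewrite rmorphM rmorphXn /= exprD.
by field; rewrite !p0.
Qed.

(** All listed breakpoints are multiples of 2^-N for one N. None is interior to a standard interval
    of depth N, so the map is affine there, and the resulting subdivisions are assembled towards the
    root. *)
Lemma covered_nil (g : F) : covered (val g) [::].
Proof.
have [_ _ [s sd sl]] := set_valP g.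
have [N hN] := dyadic_grid sd.
suff h i p : (size p + i)%N = N -> covered (val g) p by exact: (h N).
elim: i p => [|i IH] p sp; last first.
  by apply: covered_node; apply: IH; rewrite size_rcons; lia.
have [J0 J12 J1] := itv_bounds p (ltr01 : 0 < 1 :> R).
have [|x x1] := @I01_mem R (itv 0 1 p).1; first by lra.
have [|y y2] := @I01_mem R (itv 0 1 p).2; first by lra.
have [|k [c gE]] := sl x y; last by apply: (@covered_linear _ _ k c); rewrite -x1 -y2.
move=> b /hN[m ->]; rewrite x1 y2; have [j ->] := itv_grid p.
rewrite -sp addn0 /=; have p0 : 0 < (2 : R) ^+ size p by rewrite exprn_gt0.
rewrite !ltr_pM2r ?invr_gt0 // pmulrn [j.+1%:R]pmulrn !ltr_int.
by apply/negP; lia.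
Qed.

Lemma good_seq g (ls : seq (seq bool)) : (forall l, l \in ls -> good g l) ->
  exists qs, piecewise (affine_on g) (map (itv 0 1) ls) (map (itv 0 1) qs).
Proof.
elim: ls => [|l ls IH] h; first by exists [::].
have [|qs hqs] := IH; first by move=> x xs; apply: h; rewrite inE xs orbT.
by have [q hq] := h l (mem_head _ _); exists (q :: qs).
Qed.

Lemma chain_image (g : I01 -> I01) Js Ks x y : chain (val x) Js (val y) ->
  piecewise (affine_on g) Js Ks -> (forall K, K \in Ks -> K.1 < K.2) ->
  chain (val (g x)) Ks (val (g y)).
Proof.
elim: Js x Ks => [|J Js IH] x [|K Ks] //=; first by move=> /val_inj->.
move=> [Jx xJ cJ] [hJ hJs] hK.
have [|z zJ] := @I01_mem R J.2.
  by rewrite (le_trans (I01_ge0 x) (ltW xJ)) (le_trans (chain_le cJ) (I01_le1 y)).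
have J12 : J.1 < J.2 by rewrite Jx.
have [/(_ (esym Jx)) gx _] := affine_on_ends x J12 hJ.
have [_ /(_ zJ) gz] := affine_on_ends z J12 hJ.
split; first by rewrite gx.
  by rewrite gx; apply: hK (mem_head _ _).
rewrite -gz; apply: IH hJs _; first by rewrite zJ.
by move=> L h; apply: hK; rewrite inE h orbT.
Qed.

Lemma thompson_ends (g : F) x :
  (val x = 0 -> val (val g x) = 0) /\ (val x = 1 -> val (val g x) = 1).
Proof.
have [[_ [g' [_ gK g'K]]] op _] := set_valP g.
have [|z0 e0] := @I01_mem R 0; first by rewrite lexx ler01.
have [|z1 e1] := @I01_mem R 1; first by rewrite lexx ler01.
have h := op_le op; split=> ex; apply/eqP; rewrite eq_le.
  have : val (val g x) <= val (val g (g' z0)) by apply: h; rewrite ex I01_ge0.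
  by rewrite g'K e0 I01_ge0 andbT.
have : val (val g (g' z1)) <= val (val g x) by apply: h; rewrite ex I01_le1.
by rewrite g'K e1 I01_le1.
Qed.

Lemma tree_pair_exists (g : F) : exists t s, rep t s (val g).
Proof.
have [t ht] := covered_nil g.
have [qs hqs] := good_seq ht.
have [|x ex] := @I01_mem R 0; first by rewrite lexx ler01.
have [|y ey] := @I01_mem R 1; first by rewrite lexx ler01.
have [/(_ ex) gx _] := thompson_ends g x.
have [_ /(_ ey) gy] := thompson_ends g y.
have c : chain (val (val g x)) (map (itv 0 1) qs) (val (val g y)).
  apply: (chain_image _ hqs).
    by rewrite ex ey -leaf_intervalsE; exact: leaf_intervals_chain ltr01.
  by move=> K /mapP[q _ ->]; have [] := itv_bounds q (ltr01 : 0 < 1 :> R).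
rewrite gx gy in c; have [s es] := tile_tree ltr01 c.
by exists t, s; rewrite /rep !leaf_intervalsE es.
Qed.

End TreePairs.

(** * Multiplication by the generators *)

Local Open Scope nat_scope.

Lemma isleafE t : isleaf t = (ncarets t == 0)%N.
Proof. by case: t => //= l r; rewrite addnS. Qed.

Lemma ncarets1 t : ncarets t = 1%N -> t = Node Leaf Leaf.
Proof.
case: t => //= l r; rewrite addnS => -[/eqP]; rewrite addn_eq0 -!isleafE.
by case: l r => // -[].
Qed.

Lemma compat_rcons E1 E2 x y : size E1 = size E2 ->
  compat (rcons E1 x) (rcons E2 y) = compat E1 E2 && ~~ (x && y).
Proof. by move=> e; rewrite -!cats1 compat_cat // /compat /= andbT. Qed.

Lemma compat_monol E p p' : all2 implb p p' -> compat p' E -> compat p E.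
Proof. by move=> h; rewrite !(compatC _ E); exact: compat_mono. Qed.

Lemma exposures_rcons t : ~~ isleaf t ->
  exists E y, exposures t = rcons E y /\ ncarets t = (size E).+1.
Proof.
rewrite isleafE -size_exposures; case: (lastP (exposures t)) => // E y _.
by exists E, y; rewrite size_rcons.
Qed.

Lemma all2_implb_rcons E x y : x ==> y -> all2 implb (rcons E x) (rcons E y).
Proof. by move=> xy; rewrite -!cats1; apply: all2_cat; rewrite ?all2_implb_refl
  //= xy. Qed.

Lemma exposures_contract_last t E : (1 < ncarets t)%N -> exposures t = rcons E true ->
  exists t' E' x, [/\ ~~ isleaf t', t = add_caret (ncarets t') t',
    exposures t' = rcons E' x & E = rcons E' false].
Proof.
move=> t1 et; have sE : ncarets t = (size E).+1 by rewrite -size_exposures et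
  size_rcons.
have [t' e' nt'] : exists2 t', t = add_caret (size E) t' & (size E <= ncarets t')%N.
  by apply: exposures_contract; rewrite et nth_rcons ltnn eqxx.
have st' : ncarets t' = size E by move: sE; rewrite e' ncarets_add_caret => -[].
have lt' : ~~ isleaf t' by rewrite isleafE; lia.
have [E' [x [e1 e2 _]]] := exposures_add_caret_last lt'.
exists t', E', x; split; rewrite ?st' //.
move: et; rewrite e' -st' e2.
have -> : E' ++ [:: false; true] = rcons (rcons E' false) true.
  by rewrite -!cats1 -catA.
by case/rcons_inj.
Qed.

(** As [x0] takes [Node A (Node B C)] to [Node (Node A B) C], precomposing with it rotates the
    domain tree the opposite way. If the left caret is missing, a caret is added at leaf 0 of both
    trees; if the rotated caret is exposed at the right end, it may cancel against the last caret of
    the range tree. *)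
Inductive x0_step : tree -> tree -> tree -> tree -> Prop :=
| X0_rotate A B C S : x0_step (Node (Node A B) C) S (Node A (Node B C)) S
| X0_add C S :
    x0_step (Node Leaf C) S (Node Leaf (Node Leaf C)) (add_caret 0 S)
| X0_contract A S :
    x0_step (Node (Node A Leaf) Leaf) (add_caret (ncarets S) S) (Node A Leaf) S.

(** The rotation of [x0_step], at the right child of the root. If that child is missing, two carets
    have to be added; and once the rotated caret has cancelled, its parent may be exposed and cancel
    in turn. *)
Inductive x1_step : tree -> tree -> tree -> tree -> Prop :=
| X1_rotate A B C D S :
    x1_step (Node A (Node (Node B C) D)) S (Node A (Node B (Node C D))) S
| X1_add A D S :
    x1_step (Node A (Node Leaf D)) S
      (Node A (Node Leaf (Node Leaf D))) (add_caret (ncarets A).+1 S)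
| X1_add2 A S :
    x1_step (Node A Leaf) S (Node A (Node Leaf (Node Leaf Leaf)))
      (add_caret (ncarets S) (add_caret (ncarets S) S))
| X1_contract A B S :
    x1_step (Node A (Node (Node B Leaf) Leaf)) (add_caret (ncarets S) S)
      (Node A (Node B Leaf)) S
| X1_contract2 A S :
    x1_step (Node A (Node (Node Leaf Leaf) Leaf))
      (add_caret (ncarets S).+1 (add_caret (ncarets S) S)) (Node A Leaf) S.

(** The rotation newly exposes at most the caret between [B] and [C]. If both are leaves, this is
    the last caret, and the last caret of [s] decides whether it cancels; otherwise reducedness
    persists. *)
Lemma x0_step_reduced t s : ncarets t = ncarets s -> ~~ isleaf t ->
  reduced t s -> exists t' s', x0_step t s t' s' /\ reduced t' s'.
Proof.
case: t => // -[|A B] C ts _ /(reducedE ts).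
  move=> [[[->] ->]|c].
    exists (Node Leaf (Node Leaf Leaf)), (add_caret 0 (Node Leaf Leaf)).
    by split; [exact: X0_add|rewrite reducedE //; right].
  exists (Node Leaf (Node Leaf C)), (add_caret 0 s); split; first exact: X0_add.
  rewrite reducedE /= ?ncarets_add_caret -?ts //; right.
  apply: (@compat_add_caret [::] (exposures (Node Leaf C))) c.
  by rewrite size_exposures ts.
move=> [[//]|c].
have [h|h] := boolP (isleaf B && isleaf C); last first.
  exists (Node A (Node B C)), s; split; first exact: X0_rotate.
  rewrite reducedE; last by rewrite -ts /=; lia.
  right; apply: compat_monol c; rewrite /= (negbTE h) -catA andbF.
  apply: all2_cat; first exact: all2_implb_refl.
  by apply/andP; split => //; apply: all2_implb_refl.
case/andP: h; case: B ts c => // ts c _; case: C ts c => // ts c _.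
have s2 : 1 < ncarets s by rewrite -ts /=; lia.
have [|E [y [es sE]]] := @exposures_rcons s; first by rewrite isleafE; lia.
have sE' : size E = (ncarets A).+1 by move: sE; rewrite -ts /=; lia.
have e : exposures (Node (Node A Leaf) Leaf) = rcons (rcons (exposures A)
  (isleaf A)) false.
  by rewrite /= andbT !cats1.
have e' : exposures (Node A (Node Leaf Leaf)) = rcons (rcons (exposures A) false) true.
  by rewrite /= andbF -!cats1 -catA.
move: c; rewrite e es compat_rcons ?size_rcons ?size_exposures ?sE' // andbT => c.
case: y es => es; last first.
  exists (Node A (Node Leaf Leaf)), s; split; first exact: X0_rotate.
  rewrite reducedE -?ts; last by rewrite /=; lia.
  right; rewrite e' es compat_rcons ?size_rcons ?size_exposures ?sE' // andbT.
  exact: compat_monol (all2_implb_rcons _ _) c.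
have [s' [E' [z [ls' es' es'z eE]]]] := exposures_contract_last s2 es.
move: ts c; rewrite {}es' {}eE => ts c.
have ts' : ncarets (Node A Leaf) = ncarets s'.
  by move: ts; rewrite ncarets_add_caret /=; lia.
exists (Node A Leaf), s'; split; first exact: X0_contract.
have sE2 : size E' = ncarets A.
  by move: (size_exposures s'); rewrite es'z size_rcons -ts' /=; lia.
move: c; rewrite compat_rcons ?size_exposures ?sE2 // => /andP[c _].
(* If [A] is a leaf, the cancellation ends at the exceptional pair of the identity. *)
rewrite reducedE //; have [lA|lA] := boolP (isleaf A).
  by left; case: A lA {ts c sE2 e e' sE'} ts' => // _ /esym/ncarets1->.
by right; rewrite es'z /= cats1 (negbTE lA) compat_rcons ?size_exposures ?c.
Qed.

Lemma x1_step_reduced t s : ncarets t = ncarets s -> ~~ isleaf t ->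
  reduced t s -> exists t' s', x1_step t s t' s' /\ reduced t' s'.
Proof.
case: t => // A [|[|B C] D] ts _ /(reducedE ts) red.
- exists (Node A (Node Leaf (Node Leaf Leaf))), (add_caret (ncarets s)
  (add_caret (ncarets s) s)).
  split; first exact: X1_add2.
  rewrite reducedE; last by rewrite !ncarets_add_caret -ts /=; lia.
  right; have [|E [y [es _ ->]]] := @exposures_add_caret_last s.
    by rewrite isleafE -ts /=; lia.
  have sE : size E = ncarets A.
    by move: (size_exposures s); rewrite es size_rcons -ts /=; lia.
  rewrite /= !andbF -[_ ++ _]/(exposures A ++ [:: false; false; true]).
  rewrite compat_cat ?size_exposures ?sE // andbT.
  case: red => [[[eA] _]|]; first by rewrite eA; case: (E).
  by rewrite es /= cats1 compat_rcons ?size_exposures ?sE // => /andP[].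
- exists (Node A (Node Leaf (Node Leaf D))), (add_caret (ncarets A).+1 s).
  split; first exact: X1_add.
  rewrite reducedE; last by rewrite ncarets_add_caret -ts /=; lia.
  right; case: red => [[//]|c].
  have := @compat_add_caret (rcons (exposures A) false) (isleaf D :: exposures D) s.
  rewrite size_rcons !size_exposures /= !size_exposures -ts /= !cat_rcons => h.
  by move: c; rewrite /= !andbF => c; apply: h c; lia.
case: red => [[//]|c].
have [h|h] := boolP (isleaf C && isleaf D); last first.
  exists (Node A (Node B (Node C D))), s; split; first exact: X1_rotate.
  rewrite reducedE; last by rewrite -ts /=; lia.
  right; apply: compat_monol c; rewrite /= (negbTE h) !andbF.
  apply: all2_cat; first exact: all2_implb_refl.
  rewrite /= -catA; apply: all2_cat; first exact: all2_implb_refl.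
  by rewrite /=; apply: all2_cat; apply: all2_implb_refl.
case/andP: h; case: C ts c => // ts c _; case: D ts c => // ts c _.
have s2 : 1 < ncarets s by rewrite -ts /=; lia.
have [|E [y [es sE]]] := @exposures_rcons s; first by rewrite isleafE; lia.
have sE' : size E = (ncarets A + ncarets B).+2 by move: sE; rewrite -ts /=; lia.
pose P := exposures A ++ false :: exposures B.
have sP : size P = (ncarets A + ncarets B).+1.
  by rewrite size_cat /= !size_exposures addnS.
have e : exposures (Node A (Node (Node B Leaf) Leaf)) =
    rcons (rcons P (isleaf B)) false.
  by rewrite /= !andbF andbT -!cats1 -!catA.
have e' : exposures (Node A (Node B (Node Leaf Leaf))) = rcons (rcons P false) true.
  by rewrite /= !andbF -!cats1 -!catA.
move: c; rewrite e es compat_rcons ?size_rcons ?sP ?sE' // andbT => c.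
case: y es => es; last first.
  exists (Node A (Node B (Node Leaf Leaf))), s; split; first exact: X1_rotate.
  rewrite reducedE -?ts; last by rewrite /=; lia.
  right; rewrite e' es compat_rcons ?size_rcons ?sP ?sE' // andbT.
  exact: compat_monol (all2_implb_rcons _ _) c.
have [s' [E' [z [ls' es' es'z eE]]]] := exposures_contract_last s2 es.
move: ts c; rewrite {}es' {}eE => ts c.
have ts' : ncarets (Node A (Node B Leaf)) = ncarets s'.
  by move: ts; rewrite ncarets_add_caret /=; lia.
have sE2 : size E' = (ncarets A + ncarets B).+1.
  by move: (size_exposures s'); rewrite es'z size_rcons -ts' /=; lia.
move: c; rewrite compat_rcons ?sP ?sE2 // andbF andbT => c.
(* After one cancellation the caret to the right of [B] has no children when [B] is a leaf; it
   cancels as well if [z] says that the last caret of [s'] is exposed. *)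
have [bz|bz] := boolP (isleaf B && z); last first.
  exists (Node A (Node B Leaf)), s'; split; first exact: X1_contract.
  rewrite reducedE //; right.
  have -> : exposures (Node A (Node B Leaf)) = rcons P (isleaf B).
    by rewrite /= andbF andbT -cats1 -catA.
  by rewrite es'z compat_rcons ?sP ?sE2 // c.
move: bz ts' sE2; case: B ts @P sP e e' c sE' => // ts P sP e e' c sE' /= zz ts' sE2.
rewrite {}zz in es'z.
have [|s'' [E'' [z' [ls'' es'' es''z eE']]]] := exposures_contract_last _ es'z.
  by rewrite -ts' /=; lia.
move: c ts ts'; rewrite {}es'' eE' => c ts ts'.
have ts'' : ncarets (Node A Leaf) = ncarets s''.
  by move: ts'; rewrite ncarets_add_caret /=; lia.
exists (Node A Leaf), s''; split.
  rewrite ncarets_add_caret; exact: X1_contract2.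
have sE3 : size E'' = ncarets A.
  by move: (size_exposures s''); rewrite es''z size_rcons -ts'' /=; lia.
move: c; rewrite /P cats1 compat_rcons ?size_exposures ?sE3 // => /andP[c _].
rewrite reducedE //; have [lA|lA] := boolP (isleaf A).
  by left; case: A lA ts'' {ts ts' sE' sE2 sE3 c e e' P sP} => // _ /esym/ncarets1->.
by right; rewrite es''z /= cats1 (negbTE lA) compat_rcons ?size_exposures ?c.
Qed.

Local Open Scope ring_scope.

(** * The bijection between reduced words and F *)

Section NormalForm.
Variable R : realType.
Local Notation I01 := (set_type (`[0, 1]%classic : set R)).
Local Notation F := (thompsonF R).

Lemma leaf_intervals_add_caret t n (a b : R) : a < b -> (n <= ncarets t)%N ->
  exists Js J Ks, [/\ leaf_intervals a b t = Js ++ J :: Ks, size Js = n,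
    J.1 < J.2 & leaf_intervals a b (add_caret n t) =
      Js ++ [:: (J.1, (J.1 + J.2) / 2), ((J.1 + J.2) / 2, J.2) & Ks]].
Proof.
elim: t n a b => [|l IHl r IHr] n a b ab nt.
  by case: n nt => // _; exists [::], (a, b), [::].
rewrite /= in nt *; have [h1 h2] : a < (a + b) / 2 /\ (a + b) / 2 < b by split; lra.
case: ifP => nl /=.
  have [Js [J [Ks [-> sJ J12 ->]]]] := IHl n _ _ h1 nl.
  by exists Js, J, (Ks ++ leaf_intervals ((a + b) / 2) b r); rewrite -!catA.
have nr : (n - (ncarets l).+1 <= ncarets r)%N by lia.
have [Js [J [Ks [-> sJ J12 ->]]]] := IHr _ _ _ h2 nr.
exists (leaf_intervals a ((a + b) / 2) l ++ Js), J, Ks; rewrite !catA; split => //.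
by rewrite size_cat size_leaf_intervals sJ; lia.
Qed.

(** A caret at the same leaf of both trees halves one source interval and its image, by
    [affine_half] without effect on the map. *)
Lemma rep_add_caret t s n (g : I01 -> I01) : ncarets t = ncarets s ->
  (n <= ncarets t)%N -> rep (add_caret n t) (add_caret n s) g <-> rep t s g.
Proof.
move=> ts nt; have ns : (n <= ncarets s)%N by rewrite -ts.
rewrite /rep.
have [Js [J [Ks [-> sJ J12 ->]]]] := leaf_intervals_add_caret (ltr01 : 0 < 1 :> R) nt.
have [Js' [J' [Ks' [-> sJ' J12' ->]]]] := leaf_intervals_add_caret (ltr01 : 0 <
  1 :> R) ns.
rewrite !piecewise_cat ?sJ ?sJ' //=; case: J J12 => a b ab; case: J' J12' => a' b' ab'.
by rewrite (affine_half g a' b' ab) /=; tauto.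
Qed.

Lemma rep_ncarets t s (g : I01 -> I01) : rep t s g -> ncarets t = ncarets s.
Proof. by move/piecewise_size; rewrite !size_leaf_intervals => -[]. Qed.

Lemma rep_reduce t s (g : I01 -> I01) : rep t s g -> ~~ isleaf t ->
  exists t' s', [/\ rep t' s' g, ~~ isleaf t', reduced t' s' &
    (ncarets t' <= ncarets t)%N].
Proof.
have [n] := ubnP (ncarets t); elim: n t s => // n IH t s tn r lt.
have ts := rep_ncarets r.
have [c|] := boolP (compat (exposures t) (exposures s)).
  by exists t, s; split => //; apply/(reducedE ts); right.
rewrite -has_predC => /(has_nthP (false, false))[i].
rewrite size_zip !size_exposures -ts minnn => it.
rewrite nth_zip ?size_exposures //= negbK => /andP[/exposures_contract[t' et'
  it'] /exposures_contract[s' es' is']].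
rewrite et' es' in r ts tn *.
have ts' : ncarets t' = ncarets s' by move: ts; rewrite !ncarets_add_caret => -[].
have [lt'|lt'] := boolP (isleaf t').
  have s'0 : isleaf s' by rewrite isleafE -ts' -isleafE.
  case: t' s' lt' s'0 {et' es' ts' it' is' ts tn} r => // -[] // _ _ r.
  by exists (Node Leaf Leaf), (Node Leaf Leaf); split => //; left.
have [|t'' [s'' [r'' l'' red le]]] := IH t' s' _ (iffLR (rep_add_caret _ ts'
  it') r) lt'.
  by move: tn; rewrite ncarets_add_caret.
by exists t'', s''; split => //; rewrite ncarets_add_caret (leq_trans le).
Qed.

Lemma reduced_exists (g : F) : exists t s,
  [/\ rep t s (val g), ~~ isleaf t & reduced t s].
Proof.
have [t [s r]] := tree_pair_exists g; have ts := rep_ncarets r.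
(* The pair found may consist of two leaves; adding a caret at leaf 0 first makes both trees
   nonempty, as reduced pairs must be. *)
have := rep_reduce (iffRL (@rep_add_caret _ _ 0 _ ts (leq0n _)) r).
rewrite isleaf_add_caret => /(_ isT)[t' [s' [r' l' red _]]].
by exists t', s'.
Qed.

Lemma nu_rep t s (g : F) : rep t s (val g) -> ~~ isleaf t -> reduced t s ->
  nu g = zip (word t) (word s).
Proof.
move=> r lt red; rewrite /nu; case: xgetP => [w _ [t' [s' [[t'0 ts'] red' r' ->]]]|].
  rewrite !size_carets in t'0 ts'.
  move/(representsE _ ts'): r' => r'.
  have [|<- <-] := reduced_rep_inj r r' lt _ red red'; rewrite ?isleafE -?lt0n //.
  by rewrite !tree_wordE.
move=> /(_ (zip (word t) (word s))); case.
exists t, s; rewrite !tree_wordE /tree_pair !size_carets; split => //.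
  by rewrite lt0n -isleafE (rep_ncarets r).
by apply/representsE => //; exact: rep_ncarets r.
Qed.

Lemma caret_languageE : caret_language R = [set w | exists t s,
  [/\ ncarets t = ncarets s, ~~ isleaf t, reduced t s & w = zip (word t) (word s)]].
Proof.
apply/seteqP; split=> w /= [].
  move=> g _ <-; have [t [s [r lt red]]] := reduced_exists g.
  by exists t, s; rewrite (nu_rep r) // (rep_ncarets r).
move=> t [s [ts lt red ->]]; have [g r] := rep_exists R ts.
by exists g => //; exact: nu_rep.
Qed.

Lemma zip_word_inj t s t' s' : ncarets t = ncarets s -> ncarets t' = ncarets s' ->
  zip (word t) (word s) = zip (word t') (word s') -> t = t' /\ s = s'.
Proof.
move=> ts ts' e; split; apply: word_inj.
  by rewrite -[LHS](@unzip1_zip _ _ _ (word s)) ?e ?unzip1_zip ?size_word ?ts ?ts'.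
by rewrite -[LHS](@unzip2_zip _ _ (word t)) ?e ?unzip2_zip ?size_word ?ts ?ts'.
Qed.

Lemma nu_inj : injective (@nu R).
Proof.
move=> g h e; have [t [s [r lt red]]] := reduced_exists g.
have [t' [s' [r' lt' red']]] := reduced_exists h.
move: e; rewrite (nu_rep r) // (nu_rep r') // => /zip_word_inj[].
- exact: rep_ncarets r.
- exact: rep_ncarets r'.
move=> et es; rewrite -et -es in r'.
exact/thompson_ext/(rep_inj r r').
Qed.

Lemma bar_nu (g : F) : bar R (nu g) = g.
Proof.
rewrite /bar; case: xgetP => [h _|/(_ g)] /=; first exact: nu_inj.
by case.
Qed.

Lemma caret_normal_form : normal_form (caret_language R) (@bar R).
Proof.
split=> //; last by move=> g _; exists (nu g); [exists g|rewrite bar_nu].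
by move=> u v; rewrite !inE => -[g _ <-] [h _ <-]; rewrite !bar_nu => ->.
Qed.

Lemma bar_rep t s (g : F) : rep t s (val g) -> ~~ isleaf t -> reduced t s ->
  bar R (zip (word t) (word s)) = g.
Proof. by move=> r lt red; rewrite -(nu_rep r) // bar_nu. Qed.

(** The word defining [x0] is that of a reduced pair with three leaves in each tree; [A], [B] and
    [C] are hung at these leaves by [affine_tree]. *)
Lemma x0_rep A B C :
  rep (Node A (Node B C)) (Node (Node A B) C) (val (x0 R)).
Proof.
have [g r] : exists g : F, rep (Node Leaf (Node Leaf Leaf)) (Node (Node Leaf
  Leaf) Leaf) (val g).
  exact: rep_exists.
have -> : x0 R = g.
  apply: (bar_rep r) => //; apply/reducedE => //; by right.
move: r; rewrite /rep /= => -[h1 [h2 [h3 _]]].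
rewrite -catA !piecewise_cat ?size_leaf_intervals //.
by split; [|split]; apply/affine_tree => //; lra.
Qed.

Lemma x1_rep A B C D :
  rep (Node A (Node B (Node C D))) (Node A (Node (Node B C) D)) (val (x1 R)).
Proof.
have [g r] : exists g : F, rep (Node Leaf (Node Leaf (Node Leaf Leaf)))
    (Node Leaf (Node (Node Leaf Leaf) Leaf)) (val g).
  exact: rep_exists.
have -> : x1 R = g.
  apply: (bar_rep r) => //; apply/reducedE => //; by right.
move: r; rewrite /rep /= => -[h1 [h2 [h3 [h4 _]]]].
rewrite -catA !piecewise_cat ?size_leaf_intervals //.
by split; [|split; [|split]]; apply/affine_tree => //; lra.
Qed.

End NormalForm.

Local Open Scope group_scope.

(** * Products with generators as steps between pairs *)

Section Multiplication.
Variable R : realType.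
Local Notation F := (thompsonF R).

Lemma add_caret_right A B n : add_caret ((ncarets A).+1 + n)%N (Node A B) =
  Node A (add_caret n B).
Proof.
rewrite /=; have -> : ((ncarets A).+1 + n <= ncarets A)%N = false by lia.
by have -> : ((ncarets A).+1 + n - (ncarets A).+1)%N = n by lia.
Qed.

Lemma rep_mul t s u (g h : F) : rep t s (val h) -> rep s u (val g) -> rep t u
  (val (g * h)).
Proof. exact: rep_comp. Qed.

Lemma x0_step_rep t s t' s' (g : F) : x0_step t s t' s' -> rep t s (val g) ->
  rep t' s' (val (g * x0 R)).
Proof.
case=> {t s t' s'} [A B C S r|C S r|A S r].
- exact: rep_mul (x0_rep R A B C) r.
- have := iffRL (rep_add_caret (n := 0) (val g) (rep_ncarets r) (leq0n _)) r.
  exact: rep_mul (x0_rep R Leaf Leaf C).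
have AS : ncarets (Node A Leaf) = ncarets S.
  by have := rep_ncarets r; rewrite ncarets_add_caret /=; lia.
have := rep_mul (x0_rep R A Leaf Leaf) r.
have -> : Node A (Node Leaf Leaf) = add_caret (ncarets S) (Node A Leaf).
  by rewrite -AS [ncarets _]/= addn1 -[_.+1]addn0 add_caret_right.
by move/rep_add_caret; apply=> //; rewrite AS.
Qed.

Lemma x1_step_rep t s t' s' (g : F) : x1_step t s t' s' -> rep t s (val g) ->
  rep t' s' (val (g * x1 R)).
Proof.
case=> {t s t' s'} [A B C D S r|A D S r|A S r|A B S r|A S r].
- exact: rep_mul (x1_rep R A B C D) r.
- have le : ((ncarets A).+1 <= ncarets (Node A (Node Leaf D)))%N by rewrite /=; lia.
  have := iffRL (rep_add_caret (val g) (rep_ncarets r) le) r.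
  rewrite -{1}[(ncarets A).+1]addn0 add_caret_right.
  exact: rep_mul (x1_rep R A Leaf Leaf D).
- have AS := rep_ncarets r.
  have AS' : ncarets S = ((ncarets A).+1 + 0)%N by rewrite -AS /=; lia.
  have r1 := iffRL (rep_add_caret (val g) AS _) r.
  have {r1} := r1 (ncarets S); rewrite AS leqnn => /(_ isT) r1.
  have AS2 := rep_ncarets r1.
  have r2 := iffRL (rep_add_caret (val g) AS2 _) r1.
  have {r2} := r2 (ncarets S); rewrite AS2 ncarets_add_caret leqnSn => /(_ isT).
  rewrite {1 2}AS' !add_caret_right; exact: rep_mul (x1_rep R A Leaf Leaf Leaf).
- have AS : ncarets (Node A (Node B Leaf)) = ncarets S.
    by have := rep_ncarets r; rewrite ncarets_add_caret /=; lia.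
  have := rep_mul (x1_rep R A B Leaf Leaf) r.
  have -> : Node A (Node B (Node Leaf Leaf)) = add_caret (ncarets S) (Node A
    (Node B Leaf)).
    have -> : ncarets S = ((ncarets A).+1 + ((ncarets B).+1 + 0))%N by rewrite
      -AS /=; lia.
    by rewrite !add_caret_right.
  by move/rep_add_caret; apply=> //; rewrite AS.
have AS : ncarets (Node A Leaf) = ncarets S.
  by have := rep_ncarets r; rewrite !ncarets_add_caret /=; lia.
have := rep_mul (x1_rep R A Leaf Leaf Leaf) r.
have -> : Node A (Node Leaf (Node Leaf Leaf)) =
    add_caret (ncarets S).+1 (add_caret (ncarets S) (Node A Leaf)).
  have -> : (ncarets S).+1 = ((ncarets A).+1 + 1)%N by rewrite -AS /=; lia.
  have -> : ncarets S = ((ncarets A).+1 + 0)%N by rewrite -AS /=; lia.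
  by rewrite !add_caret_right.
move/rep_add_caret => h; have {h} := h _ _; rewrite !ncarets_add_caret AS leqnn
  => /(_ erefl isT).
by move/rep_add_caret; apply=> //; rewrite AS.
Qed.

(** A step computes a product with [x], and from each reduced pair some step ends at a reduced pair.
    Since reduced pairs are unique, the steps between reduced pairs then form the graph of the
    multiplication by [x]. *)
Definition step_of (x : F) (step : tree -> tree -> tree -> tree -> Prop) : Prop :=
  (forall t s t' s' (g : F), step t s t' s' -> rep t s (val g) ->
     rep t' s' (val (g * x))) /\
  (forall t s, ncarets t = ncarets s -> ~~ isleaf t -> reduced t s ->
     exists t' s', step t s t' s' /\ reduced t' s').

Lemma x0_step_of : step_of (x0 R) x0_step.
Proof. by split; [exact: x0_step_rep|exact: x0_step_reduced]. Qed.

Lemma x1_step_of : step_of (x1 R) x1_step.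
Proof. by split; [exact: x1_step_rep|exact: x1_step_reduced]. Qed.

Definition step_words (step : tree -> tree -> tree -> tree -> Prop)
    (u v : seq Lambda) : Prop :=
  exists t s t' s',
  [/\ ncarets t = ncarets s /\ ~~ isleaf t, ncarets t' = ncarets s' /\ ~~ isleaf t',
    reduced t s /\ reduced t' s', step t s t' s' &
    u = zip (word t) (word s) /\ v = zip (word t') (word s')].

Lemma step_wordsE x step : step_of x step ->
  (forall t s t' s', step t s t' s' -> ~~ isleaf t') -> forall u v : seq Lambda,
  [/\ caret_language R u, caret_language R v & bar R v = bar R u * x] <->
  step_words step u v.
Proof.
move=> [step_rep step_red] step_leaf u v; split.
  rewrite !caret_languageE => -[[t [s [ts lt red ->]]] [t1 [s1 [ts1 lt1 red1 ->]]]].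
  have [g r] := rep_exists R ts; rewrite (bar_rep r) //.
  have [g1 r1] := rep_exists R ts1; rewrite (bar_rep r1) // => e1.
  have [t' [s' [st red']]] := step_red _ _ ts lt red.
  have r' := step_rep _ _ _ _ _ st r; rewrite -e1 in r'.
  have [|e2 e3] := reduced_rep_inj r' r1 _ lt1 red' red1.
    exact: step_leaf st.
  by exists t, s, t', s'; split=> //; rewrite ?e2 ?e3.
move=> [t [s [t' [s' [[ts lt] [ts' lt'] [red red'] st [-> ->]]]]]].
have [g r] := rep_exists R ts; have r' := step_rep _ _ _ _ _ st r.
rewrite (bar_rep r) // (bar_rep r') //; split => //; rewrite caret_languageE.
  by exists t, s.
by exists t', s'.
Qed.

Lemma x0_step_leaf t s t' s' : x0_step t s t' s' -> ~~ isleaf t'.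
Proof. by case. Qed.

Lemma x1_step_leaf t s t' s' : x1_step t s t' s' -> ~~ isleaf t'.
Proof. by case. Qed.

Lemma x0_step_size t s t' s' : x0_step t s t' s' ->
  (ncarets t' <= ncarets t + 2 /\ ncarets t <= ncarets t' + 2)%N.
Proof. by case=> * /=; lia. Qed.

Lemma x1_step_size t s t' s' : x1_step t s t' s' ->
  (ncarets t' <= ncarets t + 2 /\ ncarets t <= ncarets t' + 2)%N.
Proof. by case=> * /=; lia. Qed.

Lemma step_size x step : step_of x step ->
  (forall t s t' s', step t s t' s' -> ~~ isleaf t') ->
  (forall t s t' s', step t s t' s' ->
    (ncarets t' <= ncarets t + 2 /\ ncarets t <= ncarets t' + 2)%N) ->
  forall g, (size (nu (g * x)%g) <= size (nu g) + 2 /\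
             size (nu g) <= size (nu (g * x)%g) + 2)%N.
Proof.
move=> sx sl ss g; have [|t [s [t' [s' [[ts _] [ts' _] _ /ss st [-> ->]]]]]] :=
  iffLR (step_wordsE sx sl (nu g) (nu (g * x))).
  by split; [exists g|exists (g * x)|rewrite !bar_nu].
by rewrite !size_zip !size_word -ts -ts' !minnn.
Qed.

(** * Word length and generation *)

Local Notation X := [set x0 R; (x0 R)^-1; x1 R; (x1 R)^-1].

Lemma generator_size (x g : F) : X x \/ X x^-1 ->
  (size (nu (g * x)%g) <= size (nu g) + 2)%N.
Proof.
have h0 := step_size x0_step_of x0_step_leaf x0_step_size.
have h1 := step_size x1_step_of x1_step_leaf x1_step_size.
have inv y : (forall g, (size (nu (g * y)%g) <= size (nu g) + 2 /\
             size (nu g) <= size (nu (g * y)%g) + 2)%N) ->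
  (size (nu (g * y)%g) <= size (nu g) + 2)%N /\
  (size (nu (g * y^-1)%g) <= size (nu g) + 2)%N.
  move=> h; split; first by have [] := h g.
  by have [_] := h (g * y^-1); rewrite mulgVK.
have [h01 h02] := inv _ h0; have [h11 h12] := inv _ h1.
move=> [] /=; first by move=> [[[->|->]|->]|->].
by move=> [[[e|e]|e]|e]; rewrite -[x]invgK e ?invgK.
Qed.

Lemma nu1 : nu (1 : F) = [:: (Type_r, Type_r)].
Proof.
have r : rep (Node Leaf Leaf) (Node Leaf Leaf) (val (1 : F)).
  by split; [|split] => // x /= h; field; lra.
by rewrite (nu_rep r) //; left.
Qed.

Lemma expressible_size (g : F) n : expressible_in X g n ->
  (size (nu g) <= 1 + 2 * n)%N.
Proof.
move=> [s [sX -> <-]]; elim/last_ind: s sX => [|s x IH] sX.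
  by rewrite big_nil nu1.
rewrite big_rcons /= size_rcons.
apply: leq_trans (generator_size _ _) _.
  by apply: sX; rewrite mem_rcons inE eqxx.
have : (size (nu (\big[*%g/1]_(x <- s) x)%g) <= 1 + 2 * size s)%N.
  by apply: IH => y ys; apply: sX; rewrite mem_rcons inE ys orbT.
move=> h; apply: leq_trans (leq_add h (leqnn 2)) _.
by rewrite mulnS (addnC 2%N) addnA.
Qed.

Definition expressible (g : F) : Prop := exists n, expressible_in X g n.

Lemma expressible_mul g h : expressible g -> expressible h -> expressible (g * h).
Proof.
move=> [n [s [sX -> _]]] [m [s' [s'X -> _]]].
exists (size (s ++ s')), (s ++ s'); split=> // [x|]; last by rewrite big_cat.
by rewrite mem_cat => /orP[/sX|/s'X].
Qed.

Lemma expressible_gen x : X x \/ X x^-1 -> expressible x.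
Proof.
move=> xX; exists 1%N, [:: x]; split => //; last by rewrite big_seq1.
by move=> y; rewrite inE => /eqP->.
Qed.

Lemma expressible1 : expressible 1.
Proof. by exists 0%N, [::]; split => //; rewrite big_nil. Qed.

Lemma expressible_inv g : expressible g -> expressible g^-1.
Proof.
move=> [n [s [sX -> _]]]; elim: s sX => [|x s IH] sX.
  by rewrite big_nil invg1; exact: expressible1.
rewrite big_cons invgM; apply: expressible_mul.
  by apply: IH => y ys; apply: sX; rewrite inE ys orbT.
apply: expressible_gen; rewrite invgK.
by case: (sX x (mem_head _ _)); [right|left].
Qed.

(** Two trees with equally many carets represent exactly one element, so generation turns into a
    question about pairs of trees; among trees of one size this relation is an equivalence. *)
Definition generated_pair t s : Prop :=
  forall g : F, rep t s (val g) -> expressible g.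

Lemma rep_elt_inj t s (g h : F) : rep t s (val g) -> rep t s (val h) -> g = h.
Proof. by move=> r r'; apply/thompson_ext/(rep_inj r r'). Qed.

Lemma rep_elt_inv t s (g : F) : rep t s (val g) -> rep s t (val g^-1).
Proof.
apply: rep_inv => x.
have := congr1 (fun h : F => val h x) (thompson_mulV g).
by [].
Qed.

Lemma generated_refl t : generated_pair t t.
Proof.
move=> g r; suff -> : g = 1 by exact: expressible1.
apply: rep_elt_inj r _; apply/affine_tree => [|x /= _]; first exact: ltr01.
by rewrite !subr0 divr1 mul1r add0r.
Qed.

Lemma generated_sym t s : generated_pair t s -> generated_pair s t.
Proof. by move=> h g /rep_elt_inv/h/expressible_inv; rewrite invgK. Qed.

Lemma generated_trans t u s : ncarets t = ncarets u ->
  generated_pair t u -> generated_pair u s -> generated_pair t s.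
Proof.
move=> tu h1 h2 g r; have [h rh] := rep_exists R tu.
have -> : g = (g * h^-1) * h by rewrite mulgVK.
apply: expressible_mul; last exact: h1 rh.
by apply: h2; apply: rep_mul r; exact: rep_elt_inv.
Qed.

Lemma generated_x0 A B C :
  generated_pair (Node A (Node B C)) (Node (Node A B) C).
Proof.
move=> g r; rewrite (rep_elt_inj r (x0_rep R A B C)).
by apply: expressible_gen; left; left; left; left.
Qed.

Lemma generated_x1 A B C D :
  generated_pair (Node A (Node B (Node C D))) (Node A (Node (Node B C) D)).
Proof.
move=> g r; rewrite (rep_elt_inj r (x1_rep R A B C D)).
by apply: expressible_gen; left; left; right.
Qed.

Lemma ncarets_foldr ts t u : ncarets t = ncarets u ->
  ncarets (foldr Node t ts) = ncarets (foldr Node u ts).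
Proof. by move=> tu; elim: ts => //= s ts ->. Qed.

(* Conjugation by x0 moves a rotation one step up along the right side.       *)
Lemma generated_rotation ts B C D :
  generated_pair (foldr Node (Node B (Node C D)) ts)
                 (foldr Node (Node (Node B C) D) ts).
Proof.
have BCD : ncarets (Node B (Node C D)) = ncarets (Node (Node B C) D).
  by rewrite /=; lia.
have [n] := ubnP (size ts); elim: n ts => // n IH [|A1 [|A2 ts]] sn /=.
- exact: generated_x0.
- exact: generated_x1.
refine (generated_trans _ (@generated_x0 A1 A2 _) _); first by rewrite /=; lia.
refine (generated_trans _ _ (generated_sym (@generated_x0 A1 A2 _))).
  by rewrite /= (ncarets_foldr ts BCD).
exact: (IH (Node A1 A2 :: ts)).
Qed.

Definition comb n : tree := iter n (Node Leaf) Leaf.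

Lemma ncarets_comb n : ncarets (comb n) = n.
Proof. by elim: n => //= n ->. Qed.

(** The list [ts] holds the left subtrees already passed on the right side. A rotation brings a
    caret of the left subtree [l] onto the right side and so lowers [ncarets l]; when [l] is a leaf,
    it joins [ts] and the right child is next. *)
Lemma generated_comb n t ts : ncarets t = n ->
  generated_pair (foldr Node t ts) (foldr Node (comb n) ts).
Proof.
elim: n t ts => [|n IH] t ts tn.
  by case: t tn => [_|l r /=]; [exact: generated_refl|rewrite addnS].
case: t tn => // l r; have [m] := ubnP (ncarets l).
elim: m l r => // m IHm [|b c] d ml tn.
  have := IH d (rcons ts Leaf); rewrite !foldr_rcons; apply.
  by move: tn => [].
have e : ncarets (Node (Node b c) d) = ncarets (Node b (Node c d)).
  by rewrite /=; lia.
refine (generated_trans _ (generated_sym (@generated_rotation ts b c d)) _).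
  exact: ncarets_foldr.
by apply: IHm; [move: ml => /=; lia|rewrite -e].
Qed.

Lemma generated_all t s : ncarets t = ncarets s -> generated_pair t s.
Proof.
move=> ts; refine (generated_trans _ (@generated_comb _ t [::] erefl) _).
  by rewrite /= ncarets_comb.
by apply: generated_sym; rewrite ts; exact: (@generated_comb _ s [::] erefl).
Qed.

Lemma X_generating : generating X.
Proof.
move=> g; have [t [s r]] := tree_pair_exists g.
exact: (generated_all (rep_ncarets r) r).
Qed.

Lemma caret_quasigeodesic : quasigeodesic X (caret_language R) (@bar R).
Proof.
split; first exact: X_generating.
(* The identity has one letter and each generator adds at most two: 1 + 2n is at most 2(n + 1). *)
exists 2%N => u n [g _ <-] [e _]; rewrite bar_nu in e.
by apply: leq_trans (expressible_size e) _; lia.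
Qed.

End Multiplication.

(** * Regular languages and counter automata *)

Local Open Scope nat_scope.

Section Regular.
Variable A : finType.
Implicit Types (P : pred A) (L : set (seq A)) (w : seq A).

Definition regular L : Prop :=
  exists (Q : finType) (q0 : Q) (d : Q -> A -> Q) (f : pred Q),
    forall w, L w <-> f (foldl d q0 w).

Definition all_letters P : set (seq A) := [set w | all P w].

Definition one_letter P : set (seq A) := [set w | exists2 a, w = [:: a] & P a].

Definition cat_language L1 L2 : set (seq A) :=
  [set w | exists w1 w2, [/\ L1 w1, L2 w2 & w = w1 ++ w2]].

Lemma regular_all P : regular (all_letters P).
Proof.
exists bool, true, (fun b a => b && P a), id => w; rewrite /all_letters /=.
have -> : foldl (fun b a => b && P a) true w = true && all P w.
  by elim: w true => [|a w IH] b /=; rewrite ?andbT // IH andbA.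
by [].
Qed.

Lemma regular_one P : regular (one_letter P).
Proof.
pose d (q : option bool) a := if q is None then Some (P a) else Some false.
exists (option bool), None, d, (fun q => q == Some true) => w.
have dead w' : foldl d (Some false) w' = Some false by elim: w'.
case: w => [|a [|b w]] /=; first by split=> // -[].
  by split=> [[_ [<-] /= ->]|/eqP[Pa]] //; exists a.
by rewrite dead; split=> // -[].
Qed.

Lemma regularU L1 L2 : regular L1 -> regular L2 -> regular (L1 `|` L2).
Proof.
move=> [Q1 [q1 [d1 [f1 h1]]]] [Q2 [q2 [d2 [f2 h2]]]].
pose d (q : Q1 * Q2) a := (d1 q.1 a, d2 q.2 a).
exists (Q1 * Q2)%type, (q1, q2), d, (fun q => f1 q.1 || f2 q.2) => w.
have -> : foldl d (q1, q2) w = (foldl d1 q1 w, foldl d2 q2 w).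
  by elim: w q1 q2 {h1 h2} => //= a w IH q1 q2; rewrite IH.
split=> [[/h1|/h2] /= ->|/= /orP[/h1|/h2]]; rewrite ?orbT //; by [left|right].
Qed.

Lemma regularI L1 L2 : regular L1 -> regular L2 -> regular (L1 `&` L2).
Proof.
move=> [Q1 [q1 [d1 [f1 h1]]]] [Q2 [q2 [d2 [f2 h2]]]].
pose d (q : Q1 * Q2) a := (d1 q.1 a, d2 q.2 a).
exists (Q1 * Q2)%type, (q1, q2), d, (fun q => f1 q.1 && f2 q.2) => w.
have -> : foldl d (q1, q2) w = (foldl d1 q1 w, foldl d2 q2 w).
  by elim: w q1 q2 {h1 h2} => //= a w IH q1 q2; rewrite IH.
by split=> [[/h1 /= -> /h2 ->]|/andP[/h1 ? /h2]].
Qed.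

Lemma regular_bigU (I : finType) (L : I -> set (seq A)) :
  (forall i, regular (L i)) -> regular [set w | exists i, L i w].
Proof.
move=> h.
have -> : [set w | exists i, L i w] =
    [set w | exists2 i, i \in enum I & L i w].
  apply/seteqP; split=> w /= [i]; first by exists i; rewrite ?mem_enum.
  by exists i.
elim: (enum I) => [|i s IH].
  exists unit, tt, (fun q _ => q), (fun _ => false) => w; split => // -[].
  by [].
have -> : [set w | exists2 j, j \in i :: s & L j w] =
   L i `|` [set w | exists2 j, j \in s & L j w].
  apply/seteqP; split=> w /=.
    by move=> [j]; rewrite inE => /orP[/eqP->|js]; [left|right; exists j].
  move=> [Li|[j js Lj]]; first by exists i; rewrite ?inE ?eqxx.
  by exists j; rewrite ?inE ?js ?orbT.
exact: regularU.
Qed.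

(** Subset construction: besides the state of the first automaton, the set of states that the second
    can have reached after some prefix in [L1] is stored. The result is deterministic, as the
    counters attached later require. *)
Lemma regular_cat L1 L2 : regular L1 -> regular L2 -> regular (cat_language L1 L2).
Proof.
move=> [Q1 [q1 [d1 [f1 h1]]]] [Q2 [q2 [d2 [f2 h2]]]].
pose start (q : Q1) : {set Q2} := if f1 q then [set q2]%SET else finset.set0.
pose d (q : Q1 * {set Q2}) a := let q1' := d1 q.1 a in
  (q1', [set d2 x a | x in q.2]%SET :|: start q1')%SET.
exists (Q1 * {set Q2})%type, (q1, start q1), d,
  (fun q : Q1 * {set Q2} => [exists x in q.2, f2 x]) => w.
have fst_d w' : (foldl d (q1, start q1) w').1 = foldl d1 q1 w'.
  by elim/last_ind: w' => // w' a IH; rewrite !foldl_rcons /= IH.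
have snd_d x w' : x \in (foldl d (q1, start q1) w').2 <->
    exists w1 w2, [/\ w' = w1 ++ w2, f1 (foldl d1 q1 w1) & x = foldl d2 q2 w2].
  elim/last_ind: w' x => [|w' a IH] x.
    rewrite /= /start; split.
      by case: ifP => f1q; rewrite inE // => /eqP->; exists [::], [::].
    by move=> [[|a w1] [[|b w2] [// _ /= -> ->]]]; rewrite inE.
  rewrite foldl_rcons /= !inE fst_d; split.
    move=> /orP[/imsetP[y /IH[w1 [w2 [-> fw1 ->]]] ->]|].
      by exists w1, (rcons w2 a); rewrite rcons_cat foldl_rcons.
    rewrite /start; case: ifP => fw; rewrite inE // => /eqP->.
    by exists (rcons w' a), [::]; rewrite cats0 foldl_rcons.
  move=> [w1 [w2 [e fw1 ->]]]; case: (lastP w2) e => [|w2' b] e.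
    apply/orP; right; move: fw1; rewrite -[w1]cats0 -e foldl_rcons /start => ->.
    by rewrite inE.
  move: e; rewrite -rcons_cat => /rcons_inj[e <-]; apply/orP; left.
  rewrite foldl_rcons; apply/imsetP; exists (foldl d2 q2 w2') => //.
  by apply/IH; exists w1, w2'.
split.
  move=> [w1 [w2 [/h1 fw1 /h2 fw2 ->]]].
  apply/existsP; exists (foldl d2 q2 w2); rewrite fw2 andbT.
  by apply/snd_d; exists w1, w2.
move=> /existsP[x /andP[/snd_d[w1 [w2 [-> fw1 ->]]] fw2]].
by exists w1, w2; split => //; [apply/h1|apply/h2].
Qed.

Fixpoint windowed (P : option A -> A -> option A -> bool) (p : option A) w : bool :=
  if w is x :: w' then P p x (next_letter w' None) && windowed P (Some x) w'
  else true.

(* The automaton checks the window around a letter when it reads the next one. *)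
Lemma regular_windowed (P : option A -> A -> option A -> bool) :
  regular [set w | windowed P None w].
Proof.
pose d (q : option (option (option A * A))) (y : A) : option (option (option A * A)) :=
  match q with
  | None => None
  | Some None => Some (Some (None, y))
  | Some (Some (p, x)) => if P p x (Some y) then Some (Some (Some x, y)) else None
  end.
pose f (q : option (option (option A * A))) :=
  match q with
  | None => false
  | Some None => true
  | Some (Some (p, x)) => P p x None
  end.
exists (option (option (option A * A))), (Some None), d, f => w.
have dead w' : foldl d None w' = None by elim: w'.
suff h w' p x : f (foldl d (Some (Some (p, x))) w') = windowed P p (x :: w').
  by case: w => //= x w; rewrite h.
elim: w' p x => [|y w' IH] p x /=; first by rewrite andbT.
by case: (P p x _) => /=; rewrite ?IH // dead.
Qed.

End Regular.

Lemma regular_pmap (A B : finType) (h : A -> option B) (L : set (seq B)) :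
  regular L -> regular [set w | L (pmap h w)].
Proof.
move=> [Q [q0 [d [f hL]]]].
exists Q, q0, (fun q a => if h a is Some b then d q b else q), f => w /=.
rewrite hL; suff -> : foldl d q0 (pmap h w) =
  foldl (fun q a => if h a is Some b then d q b else q) q0 w by [].
by elim: w q0 {hL} => //= a w IH q; case: (h a) => [b|] /=; rewrite IH.
Qed.

(** * Counters added to a finite automaton *)

Section Machine.
Variables (A : finType) (k : nat).

Definition instructions (i : 'I_k) (o : counter_op) : seq (instruction k) :=
  match o with
  | Nop => [::]
  | Push => [:: Increment i]
  | Pop => [:: If_nonzero i; Decrement i]
  | Zero => [:: If_zero i]
  | Pos => [:: If_nonzero i]
  | Pos_push => [:: If_nonzero i; Increment i]
  | Zero_push => [:: If_zero i; Increment i]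
  end.

Definition counter_values (n : 'I_k -> nat) : counters k := [ffun i => (n i)%:Z]%R.

Lemma execute_cat (c : counters k) s1 s2 :
  execute c (s1 ++ s2) = obind (fun c' => execute c' s2) (execute c s1).
Proof. by elim: s1 c => //= o s1 IH c; case: execute1 => //=. Qed.

Lemma execute_instructions n i o :
  execute (counter_values n) (instructions i o) =
  omap (fun m => counter_values (fun j => if j == i then m else n j)) (cstep o (n i)).
Proof.
have same : counter_values (fun j => if j == i then n i else n j) = counter_values n.
  by apply/ffunP => j; rewrite !ffunE; case: eqP => // ->.
have inc : update (counter_values n) i (counter_values n i + 1)%R =
    counter_values (fun j => if j == i then (n i).+1 else n j).
  by apply/ffunP => j; rewrite !ffunE; case: eqP => // _; lia.
have e m : n i = m -> (counter_values n i == 0)%R = (m == 0).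
  by move=> <-; rewrite ffunE; lia.
case: o => /=; rewrite ?same ?inc //; case ni : (n i) => [|m];
  rewrite ?(e _ ni) //= -?ni ?same ?inc //.
by congr Some; apply/ffunP => j; rewrite !ffunE ni; case: eqP => // _; lia.
Qed.

Definition step_values (o : 'I_k -> counter_op) (n : 'I_k -> nat)
    (l : seq 'I_k) : 'I_k -> nat :=
  fun i => if i \in l then odflt 0 (cstep (o i) (n i)) else n i.

(** Each operation tests and changes its own counter only, so executing them one after another
    agrees with performing all of them on the initial values. *)
Lemma execute_all o n l : uniq l ->
  execute (counter_values n) (flatten [seq instructions i (o i) | i <- l]) =
  if all (fun i => isSome (cstep (o i) (n i))) l
  then Some (counter_values (step_values o n l)) else None.
Proof.
elim: l n => [|i l IH] n //= /andP[il ul].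
rewrite execute_cat execute_instructions; case E: (cstep _ _) => [m|] //=.
pose n' := fun j : 'I_k => if j == i then m else n j.
rewrite (IH n') //.
have n'E j : j \in l -> n' j = n j.
  by rewrite /n'; case: eqP => // ->; rewrite (negbTE il).
rewrite (eq_in_all (a2 := fun i => isSome (cstep (o i) (n i)))); last first.
  by move=> j jl /=; rewrite n'E.
case: ifP => // _; congr Some; apply/ffunP => j; rewrite !ffunE /step_values inE.
case: (boolP (j \in l)) => jl; first by rewrite orbT n'E.
rewrite orbF.
by rewrite /n'; case: eqP => // ->; rewrite E.
Qed.

Variables (C : finType) (dc : C -> A -> C) (op : C -> A -> 'I_k -> counter_op).

Fixpoint counter_trace (c : C) (w : seq A) (i : 'I_k) : seq counter_op :=
  if w is a :: w' then op c a i :: counter_trace (dc c a) w' i else [::].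

(** State and letter determine the operations on all counters, so there is one move per letter and
    it is blocked when a test fails; this gives determinism. *)
Lemma counter_machine c0 (L : set (seq A)) : regular L ->
  deterministic_counter_language k
    [set w | L w /\ forall i, crun (counter_trace c0 w i) 0 = Some 0].
Proof.
move=> [Q [q0 [d [f hL]]]].
pose M : counter_automaton A k := @CounterAutomaton A k (Q * C)%type (q0, c0)
  [set q | f q.1]%SET
  (fun q a => [:: (flatten [seq instructions i (op q.2 a i) | i <- enum 'I_k],
                   (d q.1 a, dc q.2 a))]).
exists M.
  by move=> [q c] a; rewrite /successors /= /oapp; case: omap.
have acceptsE q c n w : @accepts_from _ _ M ((q, c), counter_values n) w =
    f (foldl d q w) && [forall i, crun (counter_trace c w i) (n i) == Some 0].
  elim: w q c n => [|a w IH] q c n /=.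
    rewrite inE; congr (_ && _); apply: eq_forallb => i.
    by rewrite ffunE; apply/eqP/eqP => [[->]|[->]].
  rewrite /successors /= execute_all ?enum_uniq //.
  case: ifP => [/allP h|/negbT/allPn[i _ h]] /=.
    rewrite orbF IH; congr (_ && _); apply: eq_forallb => i.
    rewrite /step_values mem_enum /=.
    have := h i (mem_enum _ _); case: cstep => //.
  symmetry; apply/negbTE; rewrite negb_and; apply/orP; right.
  by apply/forallPn; exists i; move: h; case: cstep.
apply/seteqP; split=> w /=; rewrite /accepts.
all: have -> : [ffun=> 0%R] = counter_values (fun _ : 'I_k => 0) by
  apply/ffunP => i; rewrite !ffunE.
all: rewrite acceptsE hL.
  by move=> /andP[-> /forallP h]; split => // i; apply/eqP.
by move=> [-> h]; apply/forallP => i; apply/eqP.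
Qed.

End Machine.

Section LocalLanguages.
Variable A : finType.

Lemma regular_first (P : pred A) :
  regular [set w | oapp P false (next_letter w None)].
Proof.
suff -> : [set w | oapp P false (next_letter w None)] =
    cat_language (one_letter P) (all_letters predT).
  by apply: regular_cat; [exact: regular_one|exact: regular_all].
apply/seteqP; split=> [[|a w] //= Pa|w [w1 [w2 [[a -> Pa] _ ->]]] //].
by exists [:: a], w; split => //; [exists a|apply/allP].
Qed.

Lemma regular_last (P : pred A) :
  regular [set w | oapp P false (prev_letter None w)].
Proof.
suff -> : [set w | oapp P false (prev_letter None w)] =
    cat_language (all_letters predT) (one_letter P).
  by apply: regular_cat; [exact: regular_all|exact: regular_one].
apply/seteqP; split=> [w|w [w1 [w2 [_ [a -> Pa] ->]]]] /=.
  case: (lastP w) => // w' a; rewrite -cats1 prev_letter_cat /= => Pa.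
  by exists w', [:: a]; split => //; [apply/allP|exists a].
by rewrite prev_letter_cat.
Qed.

Lemma regular_count1 (P : pred A) : regular [set w | count P w = 1].
Proof.
suff -> : [set w | count P w = 1] = cat_language (all_letters (predC P))
    (cat_language (one_letter P) (all_letters (predC P))).
  apply: regular_cat; first exact: regular_all.
  by apply: regular_cat; [exact: regular_one|exact: regular_all].
have count0 w : all (predC P) w = (count P w == 0).
  by rewrite all_predC has_count lt0n negbK.
apply/seteqP; split=> [w /= cw|w [w1 [_ [h1 [_ [w2 [[a -> Pa] h2 ->]]] ->]]]].
  have hP : has P w by rewrite has_count cw.
  case: (split_find hP) cw => a w1 w2 Pa h1.
  rewrite cat_rcons count_cat /= Pa => cw.
  exists w1, (a :: w2); split => //.
    by rewrite /all_letters /= all_predC.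
  exists [:: a], w2; split => //; first by exists a.
  rewrite /all_letters /= count0; apply/eqP.
  move: h1; rewrite has_count -eqn0Ngt => /eqP h1; move: cw; rewrite h1 /=; lia.
move: h1 h2; rewrite /all_letters /= !count0 => /eqP h1 /eqP h2.
by rewrite count_cat /= Pa h1 h2.
Qed.

End LocalLanguages.

(** * The caret-type language *)

Definition both_exposed (p : option Lambda) (x : Lambda) (n : option Lambda) :=
  exposed_type (omap fst p) x.1 (omap fst n) &&
  exposed_type (omap snd p) x.2 (omap snd n).

Lemma windowed_exposed p (w1 w2 : seq caret_type) : size w1 = size w2 ->
  windowed (fun p x n => ~~ both_exposed p x n) p (zip w1 w2) =
  compat (exposed_types (omap fst p) w1 None) (exposed_types (omap snd p) w2 None).
Proof.
elim: w1 w2 p => [|a w1 IH] [|b w2] p //= [s].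
rewrite IH // /compat /=; congr (~~ (_ && _) && _).
  by case: w1 w2 s {IH} => [|? ?] [|? ?].
by case: w1 w2 s {IH} => [|? ?] [|? ?].
Qed.

Lemma windowed_compat t s : ncarets t = ncarets s ->
  windowed (fun p x n => ~~ both_exposed p x n) None (zip (word t) (word s)) =
  compat (exposures t) (exposures s).
Proof.
by move=> ts; rewrite windowed_exposed ?size_word // !exposed_word.
Qed.

(* The conditions on the word of a reduced pair that a finite automaton can   *)
(* check; the matching of parentheses is what is left.                        *)
Definition local_word (u : seq Lambda) : Prop :=
  [/\ [/\ oapp (boundary \o fst) false (next_letter u None),
          oapp (boundary \o fst) false (prev_letter None u) &
          count (preim fst (pred1 Type_r)) u = 1],
      [/\ oapp (boundary \o snd) false (next_letter u None),
          oapp (boundary \o snd) false (prev_letter None u) &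
          count (preim snd (pred1 Type_r)) u = 1] &
      windowed (fun p x n => ~~ both_exposed p x n) None u \/
      u = [:: (Type_r, Type_r)]].

Lemma regular_local_word : regular local_word.
Proof.
have -> : local_word = ([set u | oapp (boundary \o fst) false (next_letter u None)]
  `&` [set u | oapp (boundary \o fst) false (prev_letter None u)]
  `&` [set u | count (preim fst (pred1 Type_r)) u = 1])
  `&` ([set u | oapp (boundary \o snd) false (next_letter u None)]
  `&` [set u | oapp (boundary \o snd) false (prev_letter None u)]
  `&` [set u | count (preim snd (pred1 Type_r)) u = 1])
  `&` ([set u | windowed (fun p x n => ~~ both_exposed p x n) None u] `|`
     one_letter (pred1 (Type_r, Type_r))).
  apply/seteqP; split=> [u [[h1 h2 h3] [h4 h5 h6] h7]|u].
    do !split => //; case: h7 => [h|->]; [by left|right].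
    by exists (Type_r, Type_r) => /=.
  move=> [[[[h1 h2] h3] [[h4 h5] h6]] h7]; split => //.
  by case: h7 => [h|[a -> /eqP->]]; [left|right].
have f P : regular [set u : seq Lambda | oapp P false (next_letter u None)] by
  exact: regular_first.
have l P : regular [set u : seq Lambda | oapp P false (prev_letter None u)] by
  exact: regular_last.
have c P : regular [set u : seq Lambda | count P u = 1] by exact: regular_count1.
by do ![apply: regularI|apply: regularU]; rewrite ?regular_one ?regular_windowed; auto;
  [exact: regular_windowed|exact: regular_one].
Qed.

Lemma next_letter_map (A B : Type) (f : A -> B) w p :
  next_letter (map f w) (omap f p) = omap f (next_letter w p).
Proof. by case: w. Qed.

Lemma prev_letter_map (A B : Type) (f : A -> B) w p :
  prev_letter (omap f p) (map f w) = omap f (prev_letter p w).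
Proof. by case: w => //= x w; rewrite last_map. Qed.

Lemma valid_unzip (f : Lambda -> caret_type) (u : seq Lambda) :
  valid_word (map f u) <->
  depth (map f u) 0 = Some 0 /\
  [/\ oapp (boundary \o f) false (next_letter u None),
      oapp (boundary \o f) false (prev_letter None u) &
      count (preim f (pred1 Type_r)) u = 1].
Proof.
rewrite /valid_word -[None in next_letter _ None]/(omap f None) next_letter_map.
rewrite -[None in prev_letter None _]/(omap f None) prev_letter_map count_map.
by case: next_letter => [a|]; case: prev_letter => [b|]; split=> [[]|[? []]].
Qed.

Lemma zip_unzip (A B : Type) (u : seq (A * B)) : zip (unzip1 u) (unzip2 u) = u.
Proof. by elim: u => //= -[a b] u ->. Qed.

Lemma local_word_reduced t s : ncarets t = ncarets s ->
  (windowed (fun p x n => ~~ both_exposed p x n) None (zip (word t) (word s)) \/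
    zip (word t) (word s) = [:: (Type_r, Type_r)]) <-> reduced t s.
Proof.
move=> ts; rewrite windowed_compat // reducedE //.
have e : zip (word t) (word s) = [:: (Type_r, Type_r)] <->
    (t = Node Leaf Leaf /\ s = Node Leaf Leaf).
  split=> [h|[-> ->] //].
  exact: (@zip_word_inj t s (Node Leaf Leaf) (Node Leaf Leaf)).
by rewrite e; tauto.
Qed.

Definition depth_matched (u : seq Lambda) : Prop :=
  depth (unzip1 u) 0 = Some 0 /\ depth (unzip2 u) 0 = Some 0.

Definition reduced_word (u : seq Lambda) : Prop :=
  exists t s, [/\ ncarets t = ncarets s, ~~ isleaf t, reduced t s &
    u = zip (word t) (word s)].

(** Each coordinate of such a word satisfies [valid_word] and is the word of a tree by [parse_word];
    the condition on windows is then reducedness of the two trees. *)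
Lemma reduced_wordE u : reduced_word u <-> local_word u /\ depth_matched u.
Proof.
split=> [[t [s [ts lt red ->]]]|[[h1 h2 h3] [d1 d2]]].
  have ls : ~~ isleaf s by rewrite isleafE -ts -isleafE.
  have /valid_unzip[d1 c1] : valid_word (unzip1 (zip (word t) (word s))).
    by rewrite unzip1_zip ?size_word ?ts //; exact: valid_tree_word.
  have /valid_unzip[d2 c2] : valid_word (unzip2 (zip (word t) (word s))).
    by rewrite unzip2_zip ?size_word ?ts //; exact: valid_tree_word.
  split; last by split.
  by split => //; apply/local_word_reduced.
have [t lt et] : exists2 t, ~~ isleaf t & unzip1 u = word t.
  by apply: parse_word; apply/valid_unzip; split.
have [s ls es] : exists2 s, ~~ isleaf s & unzip2 u = word s.
  by apply: parse_word; apply/valid_unzip; split.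
have eu : u = zip (word t) (word s) by rewrite -et -es zip_unzip.
have ts : ncarets t = ncarets s by rewrite -!size_word -et -es !size_map.
by exists t, s; split => //; apply/local_word_reduced => //; rewrite -eu.
Qed.

Lemma forall_I3 (P : nat -> Prop) :
  (forall i : 'I_3, P i) <-> [/\ P 0, P 1 & P 2].
Proof.
split=> [h|[h0 h1 h2] [[|[|[|//]]] i3] //].
by split; [exact: (h (@Ordinal 3 0 isT))|exact: (h (@Ordinal 3 1 isT))|
  exact: (h (@Ordinal 3 2 isT))].
Qed.

Lemma caret_language_3counter :
  deterministic_counter_language 3 [set u | reduced_word u].
Proof.
pose op (_ : unit) (a : Lambda) (i : 'I_3) : counter_op :=
  match (i : nat) with 0 => depth_op a.1 | 1 => depth_op a.2 | _ => Nop end.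
have := @counter_machine _ 3 unit (fun _ _ => tt) op tt _ regular_local_word.
congr (deterministic_counter_language _ _); apply/seteqP.
pose trace (u : seq Lambda) (i : nat) : seq counter_op :=
  match i with
  | 0 => map depth_op (unzip1 u) | 1 => map depth_op (unzip2 u)
  | _ => nseq (size u) Nop
  end.
have traceE u (i : 'I_3) : counter_trace (fun _ _ => tt) op tt u i = trace u i.
  elim: u => [|a u IH] /=; first by case: i => [[|[|[|]]]].
  by rewrite IH /op /trace; case: i {IH} => [[|[|[|]]]].
have nop n d : crun (nseq n Nop) d = Some d by elim: n.
have iffE u : (forall i : 'I_3, crun (counter_trace (fun _ _ => tt) op tt u i)
  0 = Some 0)
    <-> depth_matched u.
  have -> : (forall i : 'I_3, crun (counter_trace (fun _ _ => tt) op tt u i) 0 = Some 0)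
     <-> forall i : 'I_3, crun (trace u i) 0 = Some 0.
    by split=> h i; rewrite -?traceE ?h ?traceE.
  rewrite (forall_I3 (fun i => crun (trace u i) 0 = Some 0)) /depth_matched /depth /=.
  by split=> [[h1 h2 _]|[h1 h2]] //; split; rewrite ?nop.
by split=> u /=; rewrite iffE reduced_wordE.
Qed.

(** * Multiplication in terms of words *)

Definition inner (c : caret_type) : bool := ~~ boundary c.

Lemma all_inner b t : all inner (interior_word b t).
Proof. by rewrite all_predC boundary_interior. Qed.

Lemma e_notin_inner w : all inner w -> Type_e \notin w.
Proof. by move=> /allP h; apply/negP => /h. Qed.

Lemma catI_notin_l (T : eqType) (x : T) s1 s2 t1 t2 : x \notin s1 -> x \notin t1 ->
  s1 ++ x :: t1 = s2 ++ x :: t2 -> s1 = s2 /\ t1 = t2.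
Proof.
move=> h1 h2 e; have := congr1 (count_mem x) e.
rewrite !count_cat /= eqxx (elimT count_memPn h1) (elimT count_memPn h2) => c.
by apply: catI_notin e => //; apply/count_memPn; lia.
Qed.

Lemma word_split t X W : word t = X ++ Type_r :: W ->
  exists A B, [/\ t = Node A B, X = wl A & W = wr B].
Proof.
case: t => [|A B] /=; first by case: X.
by move=> /catI_notin_l[]; rewrite ?r_wl ?r_wr // => <- <-; exists A, B.
Qed.

Lemma wr_split t Y Z : wr t = Y ++ Type_e :: Z -> all inner Y ->
  exists l D, [/\ t = Node l D, Y = wi1 l & Z = wr D].
Proof.
case: t => [|l D] /= e iY; first by case: Y e iY.
move: e => /catI_notin[]; rewrite ?notin_interior ?e_notin_inner // => <- <-.
by exists l, D.
Qed.

Lemma wl_split t X Y : wl t = X ++ Type_e :: Y -> all inner Y ->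
  exists A B, [/\ t = Node A B, X = wl A & Y = wi1 B].
Proof.
case: t => [|A B] /= e iY; first by case: X e.
move: e => /catI_notin_r[]; rewrite ?notin_interior ?e_notin_inner // => <- <-.
by exists A, B.
Qed.

Lemma parse_wi1 Y : depth Y 0 = Some 0 -> all inner Y -> exists t, Y = wi1 t.
Proof.
move=> /parse_interior[Zs [t [w [/size0nil-> _ /= -> _ bw]]]].
case: w bw => [_ _|x w bx]; first by exists t; rewrite cats0.
by rewrite all_cat /= /inner bx andbF.
Qed.

(* Depth operations that moreover forbid letters at depth 0, so that depth 0  *)
(* is reached only at the end.                                                *)
Definition strict_op (c : caret_type) : counter_op :=
  match c with
  | Type_open => Pos_push
  | Type_close => Pop
  | Type_a | Type_b => Pos
  | _ => Nop
  end.

Definition strict_depth (w : seq caret_type) : nat -> option nat :=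
  crun (map strict_op w).

Lemma strict_depth_cat w1 w2 d :
  strict_depth (w1 ++ w2) d = obind (strict_depth w2) (strict_depth w1 d).
Proof. by rewrite /strict_depth map_cat crun_cat. Qed.

Lemma strict_depth_cons c w d :
  strict_depth (c :: w) d = obind (strict_depth w) (cstep (strict_op c) d).
Proof. by []. Qed.

Lemma strict_depth_depth w d d' : all inner w ->
  strict_depth w d = Some d' -> depth w d = Some d'.
Proof.
elim: w d => // c w IH d /= /andP[ic iw].
rewrite strict_depth_cons depth_cons.
by case: c ic => // _; case: d => //= d h; exact: IH h.
Qed.

Lemma strict_interior t : (forall d, strict_depth (wi1 t) d.+1 = Some d.+1) /\
  (forall d, ~~ isleaf t -> strict_depth (wi2 t) d.+1 = Some d).
Proof.
elim: t => // l [IHl _] r [_ IHr]; split=> d => [|_] /=;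
  rewrite strict_depth_cat IHl /= strict_depth_cons; case: r IHr => // r1 r2 /=
    IHr; exact: IHr.
Qed.

Lemma strict_wi2 t d : ~~ isleaf t -> strict_depth (wi2 t) d.+1 = Some d.
Proof. by have [_] := strict_interior t; apply. Qed.

(** [parse_interior] yields one second-kind subtree followed by a first-kind one. The latter is
    empty, because the strict run has already reached zero and forbids an interior letter there. *)
Lemma parse_wi2 Y : strict_depth Y 1 = Some 0 -> all inner Y ->
  exists2 t, ~~ isleaf t & Y = wi2 t.
Proof.
move=> sY iY; have := strict_depth_depth iY sY.
move=> /parse_interior[Zs [t [w [sZ nZ eY _ bw]]]].
case: Zs sZ nZ eY => [|Z [|? ?]] //= _ /andP[nZ _] eY.
move: sY iY; rewrite {}eY /= cats0.
case: w bw => [_|x w bx]; last by rewrite !all_cat /= /inner bx !andbF.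
rewrite cats0 strict_depth_cat strict_wi2 //= => st _.
exists Z => //; have := all_inner true t.
case: (wi1 t) st => [|c w]; first by rewrite cats0.
by rewrite strict_depth_cons /=; case: c.
Qed.

Lemma word_last_boundary t : ~~ isleaf t ->
  exists w c, boundary c /\ word t = rcons w c.
Proof.
move=> /valid_tree_word[_ _ + _]; case: (lastP (word t)) => // w c.
by rewrite -cats1 prev_letter_cat /= => bc; exists w, c; rewrite cats1.
Qed.

Lemma word_add_last t : ~~ isleaf t ->
  word (add_caret (ncarets t) t) = rcons (word t) Type_e.
Proof. by move=> lt; rewrite word_add_caret // -isleafE (negbTE lt) eqxx. Qed.

(** A boundary letter followed by a final [Type_e] means that the last caret of the right side has
    no left subtree, so it is exposed and can be removed. *)
Lemma word_rcons_e s W c : boundary c -> word s = rcons (rcons W c) Type_e ->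
  exists2 s', s = add_caret (ncarets s') s' & ~~ isleaf s' /\ word s' = rcons W c.
Proof.
move=> bc es.
have [|d0 f l c1] := @valid_tree_word s; first by case: s es => //; case: W.
have [s' ls' es'] : exists2 s', ~~ isleaf s' & rcons W c = word s'.
  apply: parse_word; split.
  - move: d0; rewrite es -[rcons (rcons _ _) _]cats1 depth_cat; case: (depth _
    0) => //= -[] //.
  - by move: f; rewrite es -!cats1 -catA; case: W {es}.
  - by rewrite -cats1 prev_letter_cat.
  - by move: c1; rewrite es -[rcons (rcons _ _) _]cats1 count_cat /=
    caret_type_eqE !addn0.
exists s'; last by [].
by apply: word_inj; rewrite word_add_last // -es'.
Qed.

Lemma rcons_wi1 l Y : wi1 l = rcons Y Type_a ->
  exists2 B, l = Node B Leaf & Y = wi1 B.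
Proof.
move=> e; have d := depth_wi1 l 0.
have iY : all inner Y by have := all_inner true l; rewrite e all_rcons => /andP[].
have [B eB] : exists B, Y = wi1 B.
  apply: parse_wi1 => //; move: d.
  by rewrite e -cats1 depth_cat; case: (depth Y 0).
by exists B => //; apply: wi1_inj; rewrite e eB /= cats1.
Qed.

(** As [Y'] is balanced, the final letter closes the parenthesis after [Y], and [Y] is balanced too.
    By injectivity of [wi1] that parenthesis is the root of [l] and the closing letter its right
    child. *)
Lemma wi1_rotate_close l Y Y' : depth Y' 0 = Some 0 ->
  wi1 l = Y ++ Type_open :: Y' ++ [:: Type_close] ->
  exists B C, [/\ l = Node B (Node C Leaf), Y = wi1 B & Y' = wi1 C].
Proof.
move=> dY' e; have := all_inner true l; rewrite e all_cat /= all_cat =>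
  /and3P[iY iY' _].
have [C eC] := parse_wi1 dY' iY'.
have [B eB] : exists B, Y = wi1 B.
  apply: parse_wi1 => //; have := depth_wi1 l 0.
  rewrite e depth_cat; case: (depth Y 0) => //= d.
  by rewrite depth_cons /= depth_cat eC depth_wi1.
by exists B, C; split => //; apply: wi1_inj; rewrite e eB eC.
Qed.

(** Since [Y'] is balanced, the letter [Type_b] is the next caret on the right spine begun by the
    parenthesis; the strict run over [Y''] says that all that follows belongs to its right subtree.
    So the parenthesis is the root of [l]. *)
Lemma wi1_rotate_b l Y Y' Y'' : depth Y' 0 = Some 0 -> strict_depth Y'' 1 = Some 0 ->
  wi1 l = Y ++ Type_open :: Y' ++ Type_b :: Y'' ->
  exists B C D, [/\ l = Node B (Node C D), ~~ isleaf D, Y = wi1 B, Y' = wi1 C &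
    Y'' = wi2 D].
Proof.
move=> dY' dY'' e; have := all_inner true l; rewrite e all_cat /= all_cat.
move=> /and3P[iY iY' /andP[_ iY'']].
have [C eC] := parse_wi1 dY' iY'; have [D nD eD] := parse_wi2 dY'' iY''.
have [B eB] : exists B, Y = wi1 B.
  apply: parse_wi1 => //; have := depth_wi1 l 0.
  rewrite e depth_cat; case: (depth Y 0) => //= d.
  rewrite depth_cons /= depth_cat eC depth_wi1 /= depth_cons /= eD depth_wi2 //.
by exists B, C, D; split => //; apply: wi1_inj; rewrite e eB eC eD /= (negbTE nD).
Qed.

Definition inner1 (a : Lambda) : bool := inner a.1.

Lemma unzip1_cat (A B : Type) (u v : seq (A * B)) : unzip1 (u ++ v) = unzip1 u
  ++ unzip1 v.
Proof. exact: map_cat. Qed.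

Lemma unzip2_cat (A B : Type) (u v : seq (A * B)) : unzip2 (u ++ v) = unzip2 u
  ++ unzip2 v.
Proof. exact: map_cat. Qed.

Lemma all_inner1 Y : all inner1 Y = all inner (unzip1 Y).
Proof. by rewrite all_map. Qed.

Lemma all_inner1_zip Y1 Y2 : size Y1 = size Y2 -> all inner Y1 -> all inner1
  (zip Y1 Y2).
Proof. by move=> e h; rewrite all_inner1 unzip1_zip // e. Qed.

Lemma size_split (A : Type) (w : seq A) m n : size w = m + n.+1 ->
  exists w1 x w2, [/\ w = w1 ++ x :: w2, size w1 = m & size w2 = n].
Proof.
elim: m w => [|m IH] [|x w] //=; first by move=> [h]; exists [::], x, w.
by rewrite addSn => -[/IH[w1 [y [w2 [-> <- <-]]]]]; exists (x :: w1), y, w2.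
Qed.

Definition insert_after (c : caret_type) : caret_type * caret_type :=
  match c with
  | Type_a => (Type_open, Type_close)
  | Type_close => (Type_b, Type_close)
  | _ => (c, Type_a)
  end.

Lemma insert_caret_middle w1 c w2 : insert_caret (size w1).+1 (w1 ++ c :: w2) =
  w1 ++ (insert_after c).1 :: (insert_after c).2 :: w2.
Proof. by rewrite -addn1 insert_caret_catr; case: c. Qed.

(** The steps of [x0_step] as seen in the words. The condition on [Y] makes the boundary letters
    around it consecutive carets on a side of the domain tree. *)
Inductive x0_relation : seq Lambda -> seq Lambda -> Prop :=
| X0rel_rotate X s1 Y s2 Z of all inner1 Y :
    x0_relation (X ++ (Type_e, s1) :: Y ++ (Type_r, s2) :: Z)
                (X ++ (Type_r, s1) :: Y ++ (Type_e, s2) :: Z)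
| X0rel_add s Y :
    x0_relation ((Type_r, s) :: Y) ((Type_r, Type_e) :: (Type_e, s) :: Y)
| X0rel_contract X s of boundary s :
    x0_relation (X ++ [:: (Type_e, s); (Type_r, Type_e)]) (X ++ [:: (Type_r, s)]).

(** The rotation gives three cases according to the subtree [C] of [X1_rotate]: a leaf, a caret with
    no right child, a caret with one. The root of [C] passes from the second to the first kind, so
    [Type_close] becomes [Type_a] and [Type_b] becomes [Type_open]. *)
Inductive x1_relation : seq Lambda -> seq Lambda -> Prop :=
| X1rel_rotate_a X s0 Y s1 s2 Z of all inner1 Y :
    x1_relation
      (X ++ (Type_r, s0) :: Y ++ (Type_a, s1) :: (Type_e, s2) :: Z)
      (X ++ (Type_r, s0) :: Y ++ (Type_e, s1) :: (Type_e, s2) :: Z)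
| X1rel_rotate_close X s0 Y s1 Y' s2 s3 Z of all inner1 Y & all inner1 Y' :
    x1_relation
      (X ++ (Type_r, s0) :: Y ++ (Type_open, s1) :: Y' ++
        (Type_close, s2) :: (Type_e, s3) :: Z)
      (X ++ (Type_r, s0) :: Y ++ (Type_e, s1) :: Y' ++
        (Type_a, s2) :: (Type_e, s3) :: Z)
| X1rel_rotate_b X s0 Y s1 Y' s2 Y'' s3 Z
    of all inner1 Y & all inner1 Y' & all inner1 Y'' :
    x1_relation
      (X ++ (Type_r, s0) :: Y ++ (Type_open, s1) :: Y' ++
        (Type_b, s2) :: Y'' ++ (Type_e, s3) :: Z)
      (X ++ (Type_r, s0) :: Y ++ (Type_e, s1) :: Y' ++
        (Type_open, s2) :: Y'' ++ (Type_e, s3) :: Z)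
| X1rel_add X s0 s1 Z :
    x1_relation
      (X ++ (Type_r, s0) :: (Type_e, s1) :: Z)
      (X ++ (Type_r, (insert_after s0).1) :: (Type_e, (insert_after s0).2) ::
        (Type_e, s1) :: Z)
| X1rel_add2 X s of boundary s :
    x1_relation (X ++ [:: (Type_r, s)])
      (X ++ [:: (Type_r, s); (Type_e, Type_a); (Type_e, Type_e)])
| X1rel_contract X s0 Y s of all inner1 Y & boundary s :
    x1_relation
      (X ++ (Type_r, s0) :: Y ++ [:: (Type_a, s); (Type_e, Type_e)])
      (X ++ (Type_r, s0) :: Y ++ [:: (Type_e, s)])
| X1rel_contract2 X s of boundary s :
    x1_relation (X ++ [:: (Type_r, s); (Type_a, Type_e); (Type_e, Type_e)])
      (X ++ [:: (Type_r, s)]).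

Definition unzipped (u : seq Lambda) (t s : tree) : Prop :=
  unzip1 u = word t /\ unzip2 u = word s.

Lemma unzipped_zip t s : ncarets t = ncarets s ->
  unzipped (zip (word t) (word s)) t s.
Proof. by move=> ts; split; rewrite ?unzip1_zip ?unzip2_zip ?size_word ?ts. Qed.

Lemma cat_rcons2 (T : Type) (w : seq T) a b : w ++ [:: a; b] = rcons (rcons w a) b.
Proof. by rewrite -!cats1 -catA. Qed.

Lemma x0_relation_sound u v t s : x0_relation u v -> unzipped u t s ->
  exists t' s', x0_step t s t' s' /\ unzipped v t' s'.
Proof.
case=> {u v} [X s1 Y s2 Z iY|s1 Y|X s1 bs] [].
- rewrite !unzip1_cat /= !unzip1_cat /= => et es.
  rewrite all_inner1 in iY; rewrite -[_ ++ _ :: _]/(_ ++ (_ :: _) ++ _) catA in et.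
  have [A' [C [et' eX eZ]]] := word_split (esym et).
  have [A [B [eA' eX' eY]]] := wl_split (esym eX) iY.
  exists (Node A (Node B C)), s; rewrite et' eA'; split; first exact: X0_rotate.
  split; first by rewrite !unzip1_cat /= !unzip1_cat /= eX' eY eZ.
  by rewrite -es !unzip2_cat /= !unzip2_cat.
- move=> /= et es.
  have [A [C [et' eA eC]]] := @word_split t [::] _ (esym et).
  have lA : A = Leaf by case: A eA {et'} => //= A1 A2; case: (wl A1).
  exists (Node Leaf (Node Leaf C)), (add_caret 0 s); rewrite et' lA.
  split; first exact: X0_add.
  split; first by rewrite /= eC.
  by rewrite /= word_add_caret -?es //; case: s es.
- rewrite unzip1_cat unzip2_cat /= => et es.
  rewrite -[_ ++ _]/(_ ++ [:: _] ++ [:: _]) catA in et.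
  have [A' [C [et' eA eC]]] := word_split (esym et).
  rewrite cats1 -cats1 in eA.
  have [A [B [eA' eX' eY]]] := @wl_split A' _ [::] (esym eA) isT.
  have lB : B = Leaf by apply: wi1_inj.
  have lC : C = Leaf by apply: wr_inj.
  rewrite cat_rcons2 in es; have [s' es' [ls' ws']] := word_rcons_e bs (esym es).
  exists (Node A Leaf), s'; rewrite et' eA' lB lC es'; split; first exact: X0_contract.
  by split; rewrite ?unzip1_cat ?unzip2_cat /= ?eX' // ws' cats1.
Qed.

Lemma x0_relation_complete t s t' s' : x0_step t s t' s' ->
  ncarets t = ncarets s -> x0_relation (zip (word t) (word s)) (zip (word t')
    (word s')).
Proof.
case=> {t s t' s'} [A B C S|C S|A S] /= e.
- have sS : size (word S) = size (wl A) + (size (wi1 B) + (size (wr C)).+1).+1.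
    by rewrite size_word -e size_wl size_wr size_interior_word; lia.
  have [S1 [s1 [S' [-> z1 /size_split[S2 [s2 [S3 [-> z2 z3]]]]]]]] := size_split sS.
  rewrite -catA /= !zip_cat //= ?zip_cat //=.
  exact/X0rel_rotate/all_inner1_zip/all_inner.
- have lS : ~~ isleaf S by rewrite isleafE -e.
  rewrite word_add_caret //.
  case: (word S) (size_word S) => [|s w]; first by rewrite -e.
  by move=> _; exact: X0rel_add.
- have lS : ~~ isleaf S by move: e; rewrite ncarets_add_caret isleafE; lia.
  rewrite word_add_last //; have [w [c [bc ew]]] := word_last_boundary lS.
  have sw : size w = size (wl A).
    by have := size_word S; rewrite ew size_rcons size_wl; move: e; rewrite
      ncarets_add_caret; lia.
  rewrite ew -!cats1 -!catA /= !zip_cat //=.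
  exact: X0rel_contract.
Qed.

Notation Padded := (option Lambda * option Lambda)%type.

(** * Convolutions and the check by the third counter *)

Section Otimes.
Variable A : Type.
Implicit Types (u v : seq A).

Lemma mkseqSr (T : Type) (f : nat -> T) n :
  mkseq f n.+1 = f 0 :: mkseq (fun i => f i.+1) n.
Proof.
by rewrite /mkseq /= -[1]addn0 iotaDl -map_comp; congr (_ :: _); apply: eq_map.
Qed.

Lemma otimes_cons a u b v : otimes (a :: u) (b :: v) = (Some a, Some b) :: otimes u v.
Proof. by rewrite /otimes /= maxnSS mkseqSr. Qed.

Lemma otimes_consl a u : otimes (a :: u) [::] = (Some a, None) :: otimes u [::].
Proof.
rewrite /otimes /= !maxn0 mkseqSr; congr (_ :: _).
by apply: eq_mkseq => -[|i].
Qed.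

Lemma otimes_consr b v : otimes [::] (b :: v) = (None, Some b) :: otimes [::] v.
Proof.
rewrite /otimes /= !max0n mkseqSr; congr (_ :: _).
by apply: eq_mkseq => -[|i].
Qed.

Lemma otimes_cat u1 v1 u2 v2 : size u1 = size v1 ->
  otimes (u1 ++ u2) (v1 ++ v2) = otimes u1 v1 ++ otimes u2 v2.
Proof.
elim: u1 v1 => [|a u1 IH] [|b v1] //= [s].
by rewrite !otimes_cons IH.
Qed.

Lemma pmap_otimes u v : pmap fst (otimes u v) = u /\ pmap snd (otimes u v) = v.
Proof.
elim: u v => [|a u IH] [|b v] //.
- elim: v b => // c v IH b; rewrite (otimes_consr b).
  by move: (otimes _ _) (IH c) => w /= [-> ->].
- by rewrite otimes_consl; move: (otimes _ _) (IH [::]) => w /= [-> ->].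
- by rewrite otimes_cons; move: (otimes _ _) (IH v) => w /= [-> ->].
Qed.

Lemma otimes_swap u v : otimes v u = map (fun x => (x.2, x.1)) (otimes u v).
Proof. by rewrite /otimes maxnC /mkseq -map_comp. Qed.

End Otimes.

(* The states are: before the root or after the first exterior caret on its   *)
(* right; between these two carets; and there, after the parenthesis that     *)
(* becomes exterior, before and after the caret that becomes its counterpart. *)
Inductive phase : Type := Outside | After_root | After_open | After_b.

Definition phase_code (p : phase) : bool * bool :=
  match p with
  | Outside => (false, false) | After_root => (true, false)
  | After_open => (false, true) | After_b => (true, true)
  end.

Definition phase_decode (c : bool * bool) : phase :=
  match c with
  | (false, false) => Outside | (true, false) => After_root
  | (false, true) => After_open | (true, true) => After_b
  end.

Lemma phase_codeK : cancel phase_code phase_decode.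
Proof. by case. Qed.

HB.instance Definition _ := Finite.copy phase (can_type phase_codeK).

(** The depth count starts at the parenthesis that turns into [Type_e], and its counterpart must be
    met at depth zero. After a [Type_b] that turns into [Type_open], a strict count starts from 1
    and has to be back at zero at the next [Type_e]. The pair of letters shows which change occurs,
    so no guess is made. *)
Definition rotation_move (p : phase) (x : Padded) : phase * counter_op :=
  match p, omap fst x.1, omap fst x.2 with
  | Outside, Some Type_r, _ => (After_root, Nop)
  | Outside, _, _ => (Outside, Nop)
  | After_root, Some Type_e, _ => (Outside, Nop)
  | After_root, Some Type_open, Some Type_e => (After_open, Nop)
  | After_root, _, _ => (After_root, Nop)
  | After_open, Some Type_e, _ => (Outside, Nop)
  | After_open, Some Type_b, Some Type_open => (After_b, Zero_push)
  | After_open, Some Type_close, Some Type_a => (Outside, Zero)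
  | After_open, Some c, _ => (After_open, depth_op c)
  | After_b, Some Type_e, _ => (Outside, Zero)
  | After_b, Some c, _ => (After_b, strict_op c)
  | p, _, _ => (p, Nop)
  end.

Fixpoint rotation_trace (p : phase) (w : seq Padded) : seq counter_op :=
  if w is x :: w' then
    (rotation_move p x).2 :: rotation_trace (rotation_move p x).1 w'
  else [::].

Definition rotation_phase := foldl (fun p x => (rotation_move p x).1).

Lemma rotation_trace_cat p w1 w2 : rotation_trace p (w1 ++ w2) =
  rotation_trace p w1 ++ rotation_trace (rotation_phase p w1) w2.
Proof. by elim: w1 p => //= x w1 IH p; rewrite IH. Qed.

Lemma crun_nop n d : crun (nseq n Nop) d = Some d.
Proof. by elim: n. Qed.

Lemma trace_outside w : Type_r \notin unzip1 (pmap fst w) ->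
  rotation_trace Outside w = nseq (size w) Nop /\ rotation_phase Outside w = Outside.
Proof.
elim: w => //= -[[[c s]|] y] w IH /=; last first.
  by move=> /IH[-> ->].
rewrite inE negb_or => /andP[cr /IH[h1 h2]].
by case: c cr => //; rewrite ?h1 ?h2 //; rewrite eqxx.
Qed.

Lemma trace_after_root Y : all inner1 Y ->
  rotation_trace After_root (otimes Y Y) = nseq (size Y) Nop /\
  rotation_phase After_root (otimes Y Y) = After_root.
Proof.
elim: Y => // -[c s] Y IH /= /andP[ic /IH[h1 h2]].
by rewrite otimes_cons; case: c ic => //= _; rewrite h1 h2.
Qed.

Lemma trace_after_open Y : all inner1 Y ->
  rotation_trace After_open (otimes Y Y) = map depth_op (unzip1 Y) /\
  rotation_phase After_open (otimes Y Y) = After_open.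
Proof.
elim: Y => // -[c s] Y IH /= /andP[ic /IH[h1 h2]].
by rewrite otimes_cons; case: c ic => //= _; rewrite h1 h2.
Qed.

Lemma trace_after_b Y : all inner1 Y ->
  rotation_trace After_b (otimes Y Y) = map strict_op (unzip1 Y) /\
  rotation_phase After_b (otimes Y Y) = After_b.
Proof.
elim: Y => // -[c s] Y IH /= /andP[ic /IH[h1 h2]].
by rewrite otimes_cons; case: c ic => //= _; rewrite h1 h2.
Qed.

Definition rotation_checked (u v : seq Lambda) : Prop :=
  crun (rotation_trace Outside (otimes u v)) 0 = Some 0.

Lemma checked_after_root X s s' u v : Type_r \notin unzip1 X ->
  crun (rotation_trace Outside (otimes (X ++ (Type_r, s) :: u) (X ++ (Type_r,
    s') :: v))) 0 =
  crun (rotation_trace After_root (otimes u v)) 0.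
Proof.
move=> rX; rewrite otimes_cat // rotation_trace_cat.
have [|-> ->] := @trace_outside (otimes X X); first by rewrite (pmap_otimes X X).1.
by rewrite otimes_cons crun_cat crun_nop.
Qed.

Lemma checked_inner Y u v : all inner1 Y ->
  crun (rotation_trace After_root (otimes (Y ++ u) (Y ++ v))) 0 =
  crun (rotation_trace After_root (otimes u v)) 0.
Proof.
move=> /trace_after_root[h1 h2].
by rewrite otimes_cat // rotation_trace_cat h1 h2 crun_cat crun_nop.
Qed.

Lemma checked_outside u v d : Type_r \notin unzip1 u ->
  crun (rotation_trace Outside (otimes u v)) d = Some d.
Proof.
move=> ru; have [|-> _] := @trace_outside (otimes u v); rewrite ?(pmap_otimes u v).1 //.
exact: crun_nop.
Qed.

Lemma rotation_checked_close X s0 Y s1 Y' s2 s3 Z :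
  all inner1 Y -> all inner1 Y' -> Type_r \notin unzip1 X -> Type_r \notin unzip1 Z ->
  rotation_checked
    (X ++ (Type_r, s0) :: Y ++ (Type_open, s1) :: Y' ++ (Type_close, s2) ::
      (Type_e, s3) :: Z)
    (X ++ (Type_r, s0) :: Y ++ (Type_e, s1) :: Y' ++ (Type_a, s2) :: (Type_e,
      s3) :: Z) <->
  depth (unzip1 Y') 0 = Some 0.
Proof.
move=> iY iY' rX rZ; rewrite /rotation_checked checked_after_root // checked_inner //.
rewrite otimes_cons /= otimes_cat // rotation_trace_cat.
have [-> ->] := trace_after_open iY'.
rewrite crun_cat -/(depth _ 0); case: (depth _ 0) => //= d.
rewrite !otimes_cons /=; case: d => //=.
by rewrite checked_outside.
Qed.

Lemma rotation_checked_b X s0 Y s1 Y' s2 Y'' s3 Z :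
  all inner1 Y -> all inner1 Y' -> all inner1 Y'' ->
  Type_r \notin unzip1 X -> Type_r \notin unzip1 Z ->
  rotation_checked
    (X ++ (Type_r, s0) :: Y ++ (Type_open, s1) :: Y' ++ (Type_b, s2) :: Y'' ++
      (Type_e, s3) :: Z)
    (X ++ (Type_r, s0) :: Y ++ (Type_e, s1) :: Y' ++ (Type_open, s2) :: Y'' ++
      (Type_e, s3) :: Z) <->
  depth (unzip1 Y') 0 = Some 0 /\ strict_depth (unzip1 Y'') 1 = Some 0.
Proof.
move=> iY iY' iY'' rX rZ; rewrite /rotation_checked checked_after_root //
  checked_inner //.
rewrite otimes_cons /= otimes_cat // rotation_trace_cat.
have [-> ->] := trace_after_open iY'.
rewrite crun_cat -/(depth _ 0); case: (depth _ 0) => [d|]; last by split=> // -[].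
rewrite !otimes_cons /=; case: d => //=; last by move=> d; split=> // -[].
rewrite otimes_cat // rotation_trace_cat.
have [-> ->] := trace_after_b iY''.
rewrite crun_cat -/(strict_depth _ 1); case: (strict_depth _ 1) => [d|]; last
  by split=> // -[].
rewrite !otimes_cons /=; case: d => //=; last by move=> d; split=> // -[].
by rewrite checked_outside.
Qed.

Lemma wl_r_notin (X : seq Lambda) A : unzip1 X = wl A -> Type_r \notin unzip1 X.
Proof. by move=> ->; exact: r_wl. Qed.

(** The relation leaves open whether the two changed letters belong together. The check supplies the
    depth conditions from which [wi1_rotate_close] and [wi1_rotate_b] recover the shape of the
    domain tree. *)
Lemma x1_relation_sound u v t s : x1_relation u v -> rotation_checked u v ->
  unzipped u t s -> exists t' s', x1_step t s t' s' /\ unzipped v t' s'.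
Proof.
case=> {u v} [X s0 Y s1 s2 Z iY|X s0 Y s1 Y' s2 s3 Z iY iY'
  |X s0 Y s1 Y' s2 Y'' s3 Z iY iY' iY''|X s0 s1 Z|X c bc|X s0 Y c iY bc|X c bc] chk [].
- rewrite !unzip1_cat /= !unzip1_cat /= => et es.
  have [A [B' [et' eA eB']]] := word_split (esym et).
  move: eB'; rewrite -[_ ++ _]/(_ ++ [:: _] ++ _ :: _) catA =>
    /esym/wr_split[|l [D [eB el eD]]].
    by rewrite all_cat -all_inner1 iY.
  move: el; rewrite cats1 => /esym/rcons_wi1[B el eY].
  exists (Node A (Node B (Node Leaf D))), s; rewrite et' eB el; split; first
    exact: X1_rotate.
  split; first by rewrite !unzip1_cat /= !unzip1_cat /= eA eY eD.
  by rewrite -es !unzip2_cat /= !unzip2_cat.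
- rewrite !unzip1_cat /= !unzip1_cat /= !unzip1_cat /= => et es.
  have [A [B' [et' eA eB']]] := word_split (esym et).
  have rX := wl_r_notin eA.
  have rZ : Type_r \notin unzip1 Z.
    have := r_wr B'; rewrite -eB' !mem_cat !inE !mem_cat !inE !negb_or.
    by case/and5P=> _ _ _ _ /andP[].
  move: chk => /rotation_checked_close-/(_ iY iY' rX rZ) dY'.
  move: eB'.
  have -> : unzip1 Y ++ Type_open :: unzip1 Y' ++ [:: Type_close, Type_e & unzip1 Z] =
    (unzip1 Y ++ Type_open :: unzip1 Y' ++ [:: Type_close]) ++ Type_e :: unzip1 Z.
    by rewrite -!catA /= -!catA.
  move=> /esym/wr_split[|l [D [eB el eD]]].
    by rewrite all_cat /= all_cat /= -!all_inner1 iY iY'.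
  have [B [C [el' eY eY']]] := wi1_rotate_close dY' (esym el).
  exists (Node A (Node B (Node (Node C Leaf) D))), s; rewrite et' eB el'.
  split; first exact: X1_rotate.
  split.
    by rewrite !unzip1_cat /= !unzip1_cat /= !unzip1_cat /= eA eY eY' eD -!catA.
  by rewrite -es !unzip2_cat /= !unzip2_cat /= !unzip2_cat.
- rewrite !unzip1_cat /= !unzip1_cat /= !unzip1_cat /= !unzip1_cat /= => et es.
  have [A [B' [et' eA eB']]] := word_split (esym et).
  have rX := wl_r_notin eA.
  have rZ : Type_r \notin unzip1 Z.
    have := r_wr B'; rewrite -eB' !mem_cat !inE !mem_cat !inE !mem_cat !inE !negb_or.
    by case/and5P=> _ _ _ _ /andP[_ /andP[]].
  move: chk => /rotation_checked_b-/(_ iY iY' iY'' rX rZ)[dY' dY''].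
  move: eB'.
  have -> : unzip1 Y ++ Type_open :: unzip1 Y' ++ Type_b :: unzip1 Y'' ++
    Type_e :: unzip1 Z =
    (unzip1 Y ++ Type_open :: unzip1 Y' ++ Type_b :: unzip1 Y'') ++ Type_e :: unzip1 Z.
    by rewrite -!catA /= -!catA.
  move=> /esym/wr_split[|l [D [eB el eD]]].
    by rewrite all_cat /= all_cat /= -!all_inner1 iY iY' iY''.
  have [B [C1 [C2 [el' nC2 eY eY' eY'']]]] := wi1_rotate_b dY' dY'' (esym el).
  exists (Node A (Node B (Node (Node C1 C2) D))), s; rewrite et' eB el'.
  split; first exact: X1_rotate.
  split.
    rewrite !unzip1_cat /= !unzip1_cat /= !unzip1_cat /= !unzip1_cat /= eA eY
      eY' eY'' eD.
    by rewrite (negbTE nC2) -!catA.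
  by rewrite -es !unzip2_cat /= !unzip2_cat /= !unzip2_cat /= !unzip2_cat.
- rewrite unzip1_cat unzip2_cat /= => et es.
  have [A [B' [et' eA eB']]] := word_split (esym et).
  have [l [D [eB el eD]]] := @wr_split B' [::] _ (esym eB') isT.
  have ll : l = Leaf by apply: wi1_inj.
  exists (Node A (Node Leaf (Node Leaf D))), (add_caret (ncarets A).+1 s).
  rewrite et' eB ll; split; first exact: X1_add.
  split; first by rewrite unzip1_cat /= eA eD.
  have sA : ncarets A = size (unzip2 X) by rewrite -size_wl -eA !size_map.
  have sS : ncarets s = (size X + (size Z).+2)%N.
    by rewrite -size_word -es size_cat /= !size_map.
  have ls : ~~ isleaf s by rewrite isleafE sS; lia.
  have sX : size (unzip2 X) = size X by rewrite size_map.
  rewrite word_add_caret // ?sS ?sA; last by rewrite sX; lia.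
  have -> : ((size (unzip2 X)).+1 == 0) = false by [].
  have -> : ((size (unzip2 X)).+1 == size X + (size Z).+2) = false by lia.
  by rewrite -es insert_caret_middle unzip2_cat.
- rewrite unzip1_cat unzip2_cat /= => et es.
  have [A [B [et' eA eB]]] := word_split (esym et).
  have lB : B = Leaf by apply: wr_inj.
  have ls : ~~ isleaf s by case: s es => //; case: X {chk et eA}.
  exists (Node A (Node Leaf (Node Leaf Leaf))), (add_caret (ncarets s)
    (add_caret (ncarets s) s)).
  rewrite et' lB; split; first exact: X1_add2.
  split; first by rewrite unzip1_cat /= eA.
  rewrite unzip2_cat /= word_add_caret ?isleaf_add_caret // ncarets_add_caret //.
  have -> : (ncarets s == (ncarets s).+1) = false by lia.
  rewrite -isleafE (negbTE ls) word_add_last // -es.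
  have -> : ncarets s = (size (unzip2 X)).+1 by rewrite -size_word -es size_cat addn1.
  rewrite -cats1 -catA -[[:: c] ++ _]/(c :: [:: Type_e]) insert_caret_middle.
  congr (_ ++ _).
  by case: c bc {chk es}.
- rewrite !unzip1_cat /= !unzip1_cat /= !unzip2_cat /= !unzip2_cat /= => et es.
  have [A [B' [et' eA eB']]] := word_split (esym et).
  move: eB'; rewrite -[_ ++ _]/(_ ++ [:: _] ++ [:: _]) catA =>
    /esym/wr_split[|l [D [eB el eD]]].
    by rewrite all_cat -all_inner1 iY.
  have lD : D = Leaf by apply: wr_inj.
  move: el; rewrite cats1 => /esym/rcons_wi1[B el eY].
  move: es; rewrite -cat_cons catA cat_rcons2 => /esym/(word_rcons_e bc)[s' es'
    [ls' ws']].
  exists (Node A (Node B Leaf)), s'; rewrite et' eB el lD es'.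
  split; first exact: X1_contract.
  split; first by rewrite !unzip1_cat /= !unzip1_cat /= eA eY.
  by rewrite ws' !unzip2_cat /= !unzip2_cat /= -cats1 -catA.
- rewrite unzip1_cat unzip2_cat /= => et es.
  have [A [B' [et' eA eB']]] := word_split (esym et).
  have [|l [D [eB el eD]]] := @wr_split B' [:: Type_a] [::] (esym eB'); first by [].
  have lD : D = Leaf by apply: wr_inj.
  have ll : l = Node Leaf Leaf by apply: wi1_inj.
  move: es; rewrite -[_ ++ _]/(_ ++ [:: _] ++ _) catA cat_rcons2 cats1.
  move=> /esym/(@word_rcons_e _ _ Type_e isT)[s1 es1 [ls1 ws1]].
  have [s' es' [ls' ws']] := word_rcons_e bc ws1.
  exists (Node A Leaf), s'; rewrite et' eB ll lD es1 es' ncarets_add_caret.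
  split; first exact: X1_contract2.
  by split; rewrite ?unzip1_cat ?unzip2_cat /= ?eA // ws' cats1.
Qed.

Lemma r_wl_zip A (w : seq caret_type) : size w = size (wl A) -> Type_r \notin
  unzip1 (zip (wl A) w).
Proof. by move=> e; rewrite unzip1_zip ?e // r_wl. Qed.

Lemma r_wr_zip A (w : seq caret_type) : size w = size (wr A) -> Type_r \notin
  unzip1 (zip (wr A) w).
Proof. by move=> e; rewrite unzip1_zip ?e // r_wr. Qed.

Lemma depth_zip t (w : seq caret_type) : size w = size (wi1 t) ->
  depth (unzip1 (zip (wi1 t) w)) 0 = Some 0.
Proof. by move=> e; rewrite unzip1_zip ?e // depth_wi1. Qed.

Lemma strict_depth_zip t (w : seq caret_type) : ~~ isleaf t -> size w = size (wi2 t) ->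
  strict_depth (unzip1 (zip (wi2 t) w)) 1 = Some 0.
Proof. by move=> lt e; rewrite unzip1_zip ?e // strict_wi2. Qed.

Lemma inner1_zip b t (w : seq caret_type) : size w = size (interior_word b t) ->
  all inner1 (zip (interior_word b t) w).
Proof. by move=> e; apply: all_inner1_zip; rewrite ?e ?all_inner. Qed.

Lemma checked_add X s0 s0' s1 s2 Z : Type_r \notin unzip1 X -> Type_r \notin unzip1 Z ->
  rotation_checked (X ++ (Type_r, s0) :: (Type_e, s1) :: Z)
    (X ++ (Type_r, s0') :: (Type_e, s2) :: (Type_e, s1) :: Z).
Proof.
move=> rX rZ; rewrite /rotation_checked checked_after_root // otimes_cons /=.
exact: checked_outside.
Qed.

Lemma x1_relation_complete t s t' s' : x1_step t s t' s' ->
  ncarets t = ncarets s ->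
  x1_relation (zip (word t) (word s)) (zip (word t') (word s')) /\
  rotation_checked (zip (word t) (word s)) (zip (word t') (word s')).
Proof.
case=> {t s t' s'} [A B C D S|A D S|A S|A B S|A S] /= e.
- have sS : size (word S) = size (wl A) + (size (wi1 B) + (size (wi2 C) + (size
  (wr D)).+1).+1).+1.
    by rewrite size_word -e size_wl size_wr !size_interior_word; lia.
  have [S1 [s1 [S' [-> z1 /size_split[S2 [s2 [S'' [-> z2 /size_split[S3 [s3 [S4
    [-> z3 z4]]]]]]]]]]]] :=
    size_split sS.
  have rX := r_wl_zip z1; have rZ := r_wr_zip z4; have iY := inner1_zip z2.
  (* The three forms of the rotation: [C] is a leaf, or its root lacks a right child, or has one. *)
  case: C {sS e} z3 => [|C1 C2] /=.
    case: S3 => // _; rewrite /= -!catA /= !zip_cat //= !zip_cat //=.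
    split; first exact: X1rel_rotate_a.
    rewrite /rotation_checked checked_after_root // checked_inner //.
    by rewrite !otimes_cons /= checked_outside.
  rewrite size_cat /= addnS -addnS => /size_split[S5 [s5 [S6 [-> z5 z6]]]].
  have iY' := inner1_zip z5.
  case: C2 z6 => [|C2 C3] z6.
    case: S6 z6 => // _; rewrite /= -!catA /= !zip_cat //= !zip_cat //= -!catA
      /= !zip_cat //=.
    split; first exact: X1rel_rotate_close.
    by apply/rotation_checked_close => //; exact: depth_zip.
  have iY'' := inner1_zip z6.
  rewrite -[isleaf (Node C2 C3)]/false.
  move: (Node C2 C3) (isT : ~~ isleaf (Node C2 C3)) z6 iY'' => C lC z6 iY''.
  rewrite -!catA /= -!catA /= !zip_cat //= !zip_cat //= !zip_cat //= !zip_cat //=.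
  split; first exact: X1rel_rotate_b.
  by apply/rotation_checked_b => //; split; [exact: depth_zip|exact: strict_depth_zip].
- have sS : size (word S) = size (wl A) + ((size (wr D)).+1).+1.
    by rewrite size_word -e size_wl size_wr; lia.
  have lS : ~~ isleaf S by rewrite isleafE; lia.
  rewrite word_add_caret //; last by rewrite -e; lia.
  have -> : ((ncarets A).+1 == 0) = false by [].
  have -> : ((ncarets A).+1 == ncarets S) = false by lia.
  rewrite -size_wl; have [S1 [s1 [S2 [-> z1 z2]]]] := size_split sS.
  case: S2 z2 => // s2 S2 [z2].
  rewrite -z1 insert_caret_middle /= !zip_cat //=.
  have rX := r_wl_zip z1; have rZ := r_wr_zip z2.
  by split; [exact: X1rel_add|exact: checked_add].
- have lS : ~~ isleaf S by rewrite isleafE -e; lia.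
  rewrite word_add_caret ?isleaf_add_caret // ncarets_add_caret //.
  have -> : (ncarets S == (ncarets S).+1) = false by lia.
  rewrite -isleafE (negbTE lS) word_add_last //.
  have [w [c [bc ew]]] := word_last_boundary lS.
  have sw : size w = size (wl A).
    by move: (size_word S); rewrite ew size_rcons size_wl; lia.
  have -> : ncarets S = (size w).+1 by rewrite -size_word ew size_rcons.
  have -> : rcons (word S) Type_e = w ++ c :: [:: Type_e] by rewrite ew -!cats1 -catA.
  rewrite insert_caret_middle ew -cats1 !zip_cat //=.
  have -> : insert_after c = (c, Type_a) by case: c bc {ew}.
  split; first exact: X1rel_add2.
  by rewrite /rotation_checked checked_after_root ?r_wl_zip // !otimes_consr.
- have lS : ~~ isleaf S by move: e; rewrite ncarets_add_caret isleafE; lia.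
  rewrite word_add_last //; have [w [c [bc ew]]] := word_last_boundary lS.
  have : size (word S) = size (wl A) + (size (wi1 B)).+1.+1.
    by rewrite size_word size_wl size_interior_word; move: e; rewrite
      ncarets_add_caret; lia.
  rewrite ew size_rcons => -[] sw.
  have {sw} /size_split[S1 [s1 [S2 [ew' z1 z2]]]] : size w = size (wl A) +
    (size (wi1 B)).+1.
    by lia.
  rewrite ew' -!cats1 -!catA /= !zip_cat //= !zip_cat //=.
  have iY := inner1_zip z2.
  split; first exact: X1rel_contract.
  by rewrite /rotation_checked checked_after_root ?r_wl_zip // checked_inner //.
- have lS : ~~ isleaf S by move: e; rewrite !ncarets_add_caret isleafE; lia.
  have [w [c [bc ew]]] := word_last_boundary lS.
  have sw : size w = size (wl A).
    by move: (size_word S); rewrite ew size_rcons size_wl; move: e; rewrite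
      !ncarets_add_caret; lia.
  have -> : word (add_caret (ncarets S).+1 (add_caret (ncarets S) S)) = w ++
    [:: c; Type_e; Type_e].
    rewrite -[(ncarets S).+1](ncarets_add_caret (ncarets S)) !word_add_last
      ?isleaf_add_caret //.
    by rewrite ew -!cats1 -!catA.
  rewrite ew -cats1 !zip_cat //=.
  split; first exact: X1rel_contract2.
  by rewrite /rotation_checked checked_after_root ?r_wl_zip // !otimes_consl.
Qed.

(** * Regular relations between words *)

Section RegularRelations.
Variable A : finType.
Local Notation relation := (seq A -> seq A -> Prop).
Implicit Types (r : relation) (P : pred A).

Definition relation_language r : set (seq (option A * option A)) :=
  [set w | exists u v, r u v /\ w = otimes u v].

Definition regular_relation r : Prop := regular (relation_language r).

Inductive cat_relation r1 r2 : relation :=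
| Cat_relation u1 v1 u2 v2 of r1 u1 v1 & r2 u2 v2 :
    cat_relation r1 r2 (u1 ++ u2) (v1 ++ v2).

Inductive copy P : relation :=
| Copy u of all P u : copy P u u.

Inductive single (u v : seq A) : relation :=
| Single : single u v u v.

Inductive shift (a : A) : relation :=
| Shift u : shift a u (a :: u).

Lemma cat_relation_cons r1 r2 a b u v : r1 [:: a] [:: b] -> r2 u v ->
  cat_relation r1 r2 (a :: u) (b :: v).
Proof. by move=> h1 h2; exact: (Cat_relation h1 h2). Qed.

Lemma regular_relation_ext r1 r2 : (forall u v, r1 u v <-> r2 u v) ->
  regular_relation r2 -> regular_relation r1.
Proof.
move=> h; congr regular; apply/seteqP.
by split=> w [u [v [/h ruv ->]]]; exists u, v.
Qed.

Lemma regular_relationU r1 r2 : regular_relation r1 -> regular_relation r2 ->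
  regular_relation (fun u v => r1 u v \/ r2 u v).
Proof.
move=> h1 h2; have := regularU h1 h2; congr regular; apply/seteqP.
split=> w.
  by move=> [[u [v [h ->]]]|[u [v [h ->]]]]; exists u, v; split => //; [left|right].
by move=> [u [v [[h|h] ->]]]; [left|right]; exists u, v.
Qed.

Lemma regular_relation_bigU (I : finType) (r : I -> relation) :
  (forall i, regular_relation (r i)) ->
  regular_relation (fun u v => exists i, r i u v).
Proof.
move=> /regular_bigU; congr regular; apply/seteqP.
split=> w; first by move=> [i [u [v [h ->]]]]; exists u, v; split => //; exists i.
by move=> [u [v [[i h] ->]]]; exists i, u, v.
Qed.

Lemma regular_relation_guard (b : bool) r : regular_relation r ->
  regular_relation (fun u v => b /\ r u v).
Proof.
case: b => h; first by apply: regular_relation_ext h => u v; split=> [[]|].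
exists unit, tt, (fun q _ => q), (fun _ => false) => w; split => //.
by move=> [u [v [[]]]].
Qed.

(** Equal lengths in the first factor keep the tracks aligned, so the convolution of the
    concatenations is the concatenation of the convolutions. *)
Lemma regular_relation_cat r1 r2 : (forall u v, r1 u v -> size u = size v) ->
  regular_relation r1 -> regular_relation r2 ->
  regular_relation (cat_relation r1 r2).
Proof.
move=> s1 h1 h2; have := regular_cat h1 h2; congr regular; apply/seteqP.
split=> w.
  move=> [_ [_ [[u1 [v1 [r1uv ->]]] [u2 [v2 [r2uv ->]]] ->]]].
  by exists (u1 ++ u2), (v1 ++ v2); rewrite otimes_cat ?(s1 _ _ r1uv).
move=> [_ [_ [[u1 v1 u2 v2 r1uv r2uv] ->]]].
exists (otimes u1 v1), (otimes u2 v2); rewrite otimes_cat ?(s1 _ _ r1uv) //.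
by split; [exists u1, v1|exists u2, v2|].
Qed.

Lemma regular_copy P : regular_relation (copy P).
Proof.
pose Q (x : option A * option A) :=
  match x with (Some a, Some b) => (a == b) && P a | _ => false end.
have := regular_all Q; congr regular; apply/seteqP; split=> w.
  rewrite /all_letters /=; elim: w => [_|[[a|] [b|]] w IH] //=.
    by exists [::], [::].
  move=> /andP[/andP[/eqP<- Pa] /IH[_ [_ [[u Pu] ->]]]].
  exists (a :: u), (a :: u); rewrite otimes_cons; split => //.
  by apply: Copy; rewrite /= Pa.
move=> [_ [_ [[u Pu] ->]]]; rewrite /all_letters /=.
by elim: u Pu => //= a u IH /andP[Pa Pu]; rewrite otimes_cons /= eqxx Pa IH.
Qed.

Lemma regular_word (B : finType) (w : seq B) : regular [set w].
Proof.
elim: w => [|a w IH].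
  have := regular_all (@pred0 B); congr regular; apply/seteqP.
  by split=> [[|b w]|_ ->].
have := regular_cat (regular_one (pred1 a)) IH; congr regular; apply/seteqP.
split=> [_ [_ [_ [[b -> /eqP->] -> ->]]]|_ ->] //.
by exists [:: a], w; split => //; exists a => /=.
Qed.

Lemma regular_single u v : regular_relation (single u v).
Proof.
have := regular_word (otimes u v); congr regular; apply/seteqP.
split=> [_ ->|_ [_ [_ [[] ->]]]] //; exists u, v; split=> //.
Qed.

(** Every letter of the second track equals the first-track letter one place earlier, initially [a],
    and the first track stops exactly one place before the second. Both conditions concern
    neighbouring letters only. *)
Lemma regular_shift a : regular_relation (shift a).
Proof.
pose P (p : option (option A * option A)) (x : option A * option A)
    (n : option (option A * option A)) :=
  (x.2 == oapp fst (Some a) p) && (isSome x.1 == isSome n).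
have key w p b : oapp fst (Some a) p = Some b ->
    (windowed P p w && ~~ nilp w) <-> exists u, w = otimes u (b :: u).
  elim: w p b => [|[x1 x2] w IH] p b pb.
    by split=> // -[[|c u]]; rewrite ?otimes_cons ?otimes_consr.
  rewrite /= /P /= pb andbT; case: w IH => [|y w] IH /=.
    rewrite andbT; split.
      move=> /andP[/eqP->]; case: x1 => // _; by exists [::].
    case=> [[|c u]]; rewrite ?otimes_cons ?otimes_consr; first by case=> -> ->;
      rewrite eqxx.
    by case: u => [|d u]; rewrite ?otimes_cons ?otimes_consr.
  split.
    move=> /andP[/andP[/eqP->]]; case: x1 => // c _ h.
    have [|u eu] := iffLR (IH (Some (Some c, Some b)) c erefl); first by rewrite andbT.
    by exists (c :: u); rewrite otimes_cons -eu.
  case=> [[|c u]]; rewrite ?otimes_cons ?otimes_consr; first by case=> _ _;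
    case: w {IH}.
  case=> -> -> e; rewrite !eqxx /=.
  have := iffRL (IH (Some (Some c, Some b)) c erefl).
  by rewrite andbT; apply; exists u.
have := regularI (regular_windowed P) (regular_first (A := (option A * option
  A)%type) predT).
congr regular; apply/seteqP; split=> w /=.
  move=> [h1 h2]; have [|u ->] := iffLR (key w None a erefl); last first.
    by exists u, (a :: u).
  by rewrite h1; case: w h2 {h1}.
move=> [_ [_ [[u] ->]]].
have : exists u', otimes u (a :: u) = otimes u' (a :: u') by exists u.
by move=> /(key _ None a erefl)/andP[-> ]; case: (otimes _ _).
Qed.

End RegularRelations.

Inductive change (c d : caret_type) : seq Lambda -> seq Lambda -> Prop :=
| Change s : change c d [:: (c, s)] [:: (d, s)].

Lemma regular_change c d : regular_relation (change c d).
Proof.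
apply: (@regular_relation_ext _ _ (fun u v => exists s, single [:: (c, s)] [::
  (d, s)] u v)).
  by move=> u v; split=> [[s]|[s []]]; [exists s|].
by apply: regular_relation_bigU => s; exact: regular_single.
Qed.

Local Notation "r1 ** r2" := (cat_relation r1 r2) (at level 40, r2 at level 40,
  right associativity).

Ltac solve_regular_relation :=
  repeat first
    [ apply: regular_relation_cat; [by move=> ? ? []| |]
    | exact: regular_copy | exact: regular_change | exact: regular_single
    | exact: regular_shift ].

Lemma regular_x0_relation : regular_relation x0_relation.
Proof.
pose rotate := copy predT ** change Type_e Type_r ** copy inner1 **
  change Type_r Type_e ** copy predT.
pose add s := single [:: (Type_r, s)] [:: (Type_r, Type_e)] ** shift (Type_e, s).
pose contract s := copy predT ** single [:: (Type_e, s)] [:: (Type_r, s)] **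
  single [:: (Type_r, Type_e)] [::].
apply: (@regular_relation_ext _ _ (fun u v => rotate u v \/
  (exists s, add s u v) \/ (exists s, boundary s /\ contract s u v))); last first.
  apply: regular_relationU; first by solve_regular_relation.
  apply: regular_relationU; apply: regular_relation_bigU => s.
    by solve_regular_relation.
  by apply: regular_relation_guard; solve_regular_relation.
move=> u v; split.
  case=> {u v} [X s1 Y s2 Z iY|s Y|X s bs].
  - left; apply: Cat_relation; first by apply: Copy; rewrite all_predT.
    apply: cat_relation_cons; first exact: Change.
    apply: Cat_relation; first exact: Copy.
    apply: cat_relation_cons; first exact: Change.
    by apply: Copy; rewrite all_predT.
  - right; left; exists s; apply: cat_relation_cons; first exact: Single.
    exact: Shift.
  - right; right; exists s; split => //.
    apply: Cat_relation; first by apply: Copy; rewrite all_predT.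
    apply: cat_relation_cons; first exact: Single.
    exact: Single.
move=> [|[[s]|[s [bs]]]].
- case=> _ _ _ _ [X _] [_ _ _ _ [s1] [_ _ _ _ [Y iY] [_ _ _ _ [s2] [Z _]]]].
  exact: X0rel_rotate.
- case=> _ _ _ _ [] [Y]; exact: X0rel_add.
- case=> _ _ _ _ [X _] [_ _ _ _ [] []]; exact: X0rel_contract.
Qed.

Lemma regular_x1_relation : regular_relation x1_relation.
Proof.
pose pre := copy inner1.
pose any := copy (@predT Lambda).
pose root := change Type_r Type_r.
pose rotate_a := any ** root ** pre ** change Type_a Type_e ** change Type_e
  Type_e ** any.
pose rotate_close := any ** root ** pre ** change Type_open Type_e ** pre **
  change Type_close Type_a ** change Type_e Type_e ** any.
pose rotate_b := any ** root ** pre ** change Type_open Type_e ** pre **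
  change Type_b Type_open ** pre ** change Type_e Type_e ** any.
pose add s0 s1 := any **
  single [:: (Type_r, s0)] [:: (Type_r, (insert_after s0).1)] **
  single [:: (Type_e, s1)] [:: (Type_e, (insert_after s0).2)] ** shift (Type_e, s1).
pose add2 s := any ** single [:: (Type_r, s)]
  [:: (Type_r, s); (Type_e, Type_a); (Type_e, Type_e)].
pose contract s := any ** root ** pre **
  single [:: (Type_a, s); (Type_e, Type_e)] [:: (Type_e, s)].
pose contract2 s := any **
  single [:: (Type_r, s); (Type_a, Type_e); (Type_e, Type_e)] [:: (Type_r, s)].
apply: (@regular_relation_ext _ _ (fun u v => rotate_a u v \/ rotate_close u v \/
  rotate_b u v \/ (exists s0 s1, add s0 s1 u v) \/
  (exists s, boundary s /\ (add2 s u v \/ contract s u v \/ contract2 s u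
    v)))); last first.
  apply: regular_relationU; first by solve_regular_relation.
  apply: regular_relationU; first by solve_regular_relation.
  apply: regular_relationU; first by solve_regular_relation.
  apply: regular_relationU; apply: regular_relation_bigU => s.
    by apply: regular_relation_bigU => s1; solve_regular_relation.
  apply: regular_relation_guard.
  by do ![apply: regular_relationU]; solve_regular_relation.
have anyP X : any X X by apply: Copy; rewrite all_predT.
move=> u v; split.
  case=> {u v} [X s0 Y s1 s2 Z iY|X s0 Y s1 Y' s2 s3 Z iY iY'
    |X s0 Y s1 Y' s2 Y'' s3 Z iY iY' iY''|X s0 s1 Z|X c bc|X s0 Y c iY bc|X c bc].
  - left; apply: Cat_relation => //; apply: cat_relation_cons; first exact: Change.
    apply: Cat_relation; first exact: Copy.
    apply: cat_relation_cons; first exact: Change.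
    by apply: cat_relation_cons; first exact: Change.
  - right; left; apply: Cat_relation => //; apply: cat_relation_cons; first
    exact: Change.
    apply: Cat_relation; first exact: Copy.
    apply: cat_relation_cons; first exact: Change.
    apply: Cat_relation; first exact: Copy.
    apply: cat_relation_cons; first exact: Change.
    by apply: cat_relation_cons; first exact: Change.
  - right; right; left; apply: Cat_relation => //.
    apply: cat_relation_cons; first exact: Change.
    apply: Cat_relation; first exact: Copy.
    apply: cat_relation_cons; first exact: Change.
    apply: Cat_relation; first exact: Copy.
    apply: cat_relation_cons; first exact: Change.
    apply: Cat_relation; first exact: Copy.
    by apply: cat_relation_cons; first exact: Change.
  - right; right; right; left; exists s0, s1; apply: Cat_relation => //.
    apply: cat_relation_cons; first exact: Single.
    by apply: cat_relation_cons; first exact: Single.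
  - right; right; right; right; exists c; split => //; left.
    by apply: Cat_relation => //; exact: Single.
  - right; right; right; right; exists c; split => //; right; left.
    apply: Cat_relation => //; apply: cat_relation_cons; first exact: Change.
    by apply: Cat_relation; [exact: Copy|exact: Single].
  - right; right; right; right; exists c; split => //; right; right.
    by apply: Cat_relation => //; exact: Single.
move=> [|[|[|[[s0 [s1]]|[c [bc [|[|]]]]]]]].
- case=> _ _ _ _ [X _] [_ _ _ _ [s0] [_ _ _ _ [Y iY] [_ _ _ _ [s1]
    [_ _ _ _ [s2] [Z _]]]]].
  exact: X1rel_rotate_a.
- case=> _ _ _ _ [X _] [_ _ _ _ [s0] [_ _ _ _ [Y iY] [_ _ _ _ [s1]
    [_ _ _ _ [Y' iY'] [_ _ _ _ [s2] [_ _ _ _ [s3] [Z _]]]]]]].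
  exact: X1rel_rotate_close.
- case=> _ _ _ _ [X _] [_ _ _ _ [s0] [_ _ _ _ [Y iY] [_ _ _ _ [s1]
    [_ _ _ _ [Y' iY'] [_ _ _ _ [s2] [_ _ _ _ [Y'' iY''] [_ _ _ _ [s3] [Z _]]]]]]]].
  exact: X1rel_rotate_b.
- case=> _ _ _ _ [X _] [_ _ _ _ [] [_ _ _ _ [] [Z]]]; exact: X1rel_add.
- case=> _ _ _ _ [X _] []; exact: X1rel_add2.
- case=> _ _ _ _ [X _] [_ _ _ _ [s0] [_ _ _ _ [Y iY] []]]; exact: X1rel_contract.
- case=> _ _ _ _ [X _] []; exact: X1rel_contract2.
Qed.

(** * Automata for the multiplication languages *)

Section StepLanguage.
Variables (step : tree -> tree -> tree -> tree -> Prop)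
  (r : seq Lambda -> seq Lambda -> Prop).
Variables (C : finType) (c0 : C) (move : C -> Padded -> C)
  (op : C -> Padded -> counter_op).

Fixpoint third_trace (c : C) (w : seq Padded) : seq counter_op :=
  if w is x :: w' then op c x :: third_trace (move c x) w' else [::].

Hypothesis r_sound : forall u v t s, r u v ->
  crun (third_trace c0 (otimes u v)) 0 = Some 0 -> unzipped u t s ->
  exists t' s', step t s t' s' /\ unzipped v t' s'.
Hypothesis r_complete : forall t s t' s', step t s t' s' ->
  ncarets t = ncarets s ->
  r (zip (word t) (word s)) (zip (word t') (word s')) /\
  crun (third_trace c0
    (otimes (zip (word t) (word s)) (zip (word t') (word s')))) 0 = Some 0.
Hypothesis step_leaf : forall t s t' s', step t s t' s' -> ~~ isleaf t'.
Hypothesis regular_r : regular_relation r.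

(** Counters 0 and 1 check the depths of [u], counter 2 checks the step. By [r_sound] the word [v]
    then comes from a pair of trees, so no counters are spent on its parentheses; its reducedness is
    read off by the finite automaton. *)
Lemma step_language_3counter : deterministic_counter_language 3
  [set w | exists u v, step_words step u v /\ w = otimes u v].
Proof.
pose o (c : C) (x : Padded) (i : 'I_3) : counter_op :=
  match (i : nat) with
  | 0 => oapp (depth_op \o fst) Nop x.1
  | 1 => oapp (depth_op \o snd) Nop x.1
  | _ => op c x
  end.
pose L : set (seq Padded) := relation_language r `&`
  ([set w | local_word (pmap fst w)] `&` [set w | local_word (pmap snd w)]).
have regL : regular L.
  apply: regularI regular_r _.
  by apply: regularI; apply: regular_pmap; exact: regular_local_word.
have := @counter_machine _ 3 C move o c0 L regL.
congr (deterministic_counter_language _ _).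
have run_nop (f : Lambda -> counter_op) w d :
    crun (map (fun x : Padded => oapp f Nop x.1) w) d = crun (map f (pmap fst w)) d.
  elim: w d => //= -[[a|] y] w IH d /=; last exact: IH.
  by case: cstep.
pose trace (w : seq Padded) (i : nat) : seq counter_op :=
  match i with
  | 0 => map (fun x : Padded => oapp (depth_op \o fst) Nop x.1) w
  | 1 => map (fun x : Padded => oapp (depth_op \o snd) Nop x.1) w
  | _ => third_trace c0 w
  end.
have traceE w (i : 'I_3) : counter_trace move o c0 w i = trace w i.
  rewrite /trace; case: i => [[|[|[|//]]] i3]; move: c0; elim: w => //= x w IH c;
    by rewrite IH.
have iffE w : (forall i : 'I_3, crun (counter_trace move o c0 w i) 0 = Some 0) <->
    depth_matched (pmap fst w) /\ crun (third_trace c0 w) 0 = Some 0.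
  have -> : (forall i : 'I_3, crun (counter_trace move o c0 w i) 0 = Some 0) <->
      forall i : 'I_3, crun (trace w i) 0 = Some 0.
    by split=> h i; rewrite -?traceE ?h ?traceE.
  rewrite (forall_I3 (fun i => crun (trace w i) 0 = Some 0)) /trace !run_nop.
  rewrite /depth_matched /depth /unzip1 /unzip2 -!map_comp.
  by split=> [[]|[[]]].
apply/seteqP; split=> w /=.
  move=> [[[u [v [ruv ->]]] [lu lv]] /iffE[dm t0]].
  have [eu1 ev1] := pmap_otimes u v; rewrite eu1 in dm.
  have {}lu : local_word u by rewrite -eu1.
  have {}lv : local_word v by rewrite -ev1.
  have [t [s [ts lt red eu]]] := iffRL (reduced_wordE u) (conj lu dm).
  have zu : unzipped u t s by rewrite eu; exact: unzipped_zip.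
  have [t' [s' [st [v1 v2]]]] := r_sound ruv t0 zu.
  have ev : v = zip (word t') (word s') by rewrite -v1 -v2 zip_unzip.
  have ts' : ncarets t' = ncarets s' by rewrite -!size_word -v1 -v2 !size_map.
  exists u, v; split => //; exists t, s, t', s'; split => //.
  - by split => //; exact: step_leaf st.
  - by split => //; apply/local_word_reduced => //; rewrite -ev; case: lv.
move=> [u [v [[t [s [t' [s' [[ts lt] [ts' lt'] [red red'] st [-> ->]]]]]] ->]]].
have [ruv t0] := r_complete st ts.
have [lu dm] : local_word (zip (word t) (word s)) /\ depth_matched (zip (word
  t) (word s)).
  by apply/reduced_wordE; exists t, s.
have [lv _] : local_word (zip (word t') (word s')) /\ depth_matched (zip (word
  t') (word s')).
  by apply/reduced_wordE; exists t', s'.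
split; last first.
  by apply/iffE; rewrite (pmap_otimes _ _).1.
split; first by exists (zip (word t) (word s)), (zip (word t') (word s')).
by rewrite /= (pmap_otimes _ _).1 (pmap_otimes _ _).2.
Qed.

End StepLanguage.

Lemma x0_language_3counter : deterministic_counter_language 3
  [set w | exists u v, step_words x0_step u v /\ w = otimes u v].
Proof.
have nop (w : seq Padded) : crun (third_trace (fun (c : unit) _ => c) (fun _ _
  => Nop) tt w) 0 = Some 0.
  by elim: w.
apply: (@step_language_3counter _ x0_relation unit tt (fun c _ => c) (fun _ _ => Nop)).
- by move=> u v t s ruv _; exact: x0_relation_sound.
- by move=> t s t' s' st ts; split; [exact: x0_relation_complete|exact: nop].
- exact: x0_step_leaf.
- exact: regular_x0_relation.
Qed.

Lemma x1_language_3counter : deterministic_counter_language 3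
  [set w | exists u v, step_words x1_step u v /\ w = otimes u v].
Proof.
have traceE p w : third_trace (fun p x => (rotation_move p x).1)
    (fun p x => (rotation_move p x).2) p w = rotation_trace p w.
  by elim: w p => //= x w IH p; rewrite IH.
apply: (@step_language_3counter _ x1_relation phase Outside
  (fun p x => (rotation_move p x).1) (fun p x => (rotation_move p x).2)).
- by move=> u v t s ruv; rewrite traceE; exact: x1_relation_sound.
- by move=> t s t' s' st ts; rewrite traceE; exact: x1_relation_complete.
- exact: x1_step_leaf.
- exact: regular_x1_relation.
Qed.

Lemma counter_language_map (A B : finType) k (f : A -> B) (L : set (seq B)) :
  deterministic_counter_language k L ->
  deterministic_counter_language k [set w | L (map f w)].
Proof.
move=> [M dM <-].
exists (@CounterAutomaton A k (state M) (initial M) (accepting M)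
  (fun q a => moves q (f a))).
  by move=> s a; exact: (dM s (f a)).
apply/seteqP; rewrite /accepts; split=> w /=; move: (initial M, _) => s.
  elim: w s => //= a w IH s /hasP[s' s's h]; apply/hasP; exists s' => //.
  exact: IH.
elim: w s => //= a w IH s /hasP[s' s's h]; apply/hasP; exists s' => //.
exact: IH.
Qed.

(** * Inverse generators and the theorem *)

Section Conclusion.
Variable R : realType.
Local Notation F := (thompsonF R).

Lemma multiplication_language_step (x : F) step : step_of x step ->
  (forall t s t' s', step t s t' s' -> ~~ isleaf t') ->
  multiplication_language (caret_language R) (@bar R) x =
  [set w | exists u v, step_words step u v /\ w = otimes u v].
Proof.
move=> sx sl; apply/seteqP; split=> w [u [v]].
  by move=> [Lu Lv e ->]; exists u, v; split => //; apply/(step_wordsE sx sl).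
by move=> [/(step_wordsE sx sl)[Lu Lv e] ->]; exists u, v.
Qed.

(** An element is the product of another with the inverse of [x] exactly when the latter is the
    product of the former with [x], so the two tracks trade places. *)
Lemma multiplication_language_inv (x : F) :
  multiplication_language (caret_language R) (@bar R) (x^-1)%g =
  [set w | multiplication_language (caret_language R) (@bar R) x
             (map (fun y => (y.2, y.1)) w)].
Proof.
have swapK : cancel (fun y : Padded => (y.2, y.1)) (fun y => (y.2, y.1)) by case.
apply/seteqP; split=> w [u [v]] [Lu Lv e ew].
  exists v, u; split => //; first by rewrite e mulgVK.
  by rewrite ew -otimes_swap.
exists v, u; split => //; first by rewrite e mulgK.
by rewrite otimes_swap -ew -map_comp map_id_in // => y _ /=; case: y.
Qed.

Lemma caret_graph_automatic : counter_graph_automatic 3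
  [set x0 R; (x0 R)^-1; x1 R; (x1 R)^-1]%g (caret_language R) (@bar R).
Proof.
have h0 := multiplication_language_step (@x0_step_of R) x0_step_leaf.
have h1 := multiplication_language_step (@x1_step_of R) x1_step_leaf.
split.
- exact: caret_normal_form.
- by rewrite caret_languageE; exact: caret_language_3counter.
move=> x [[[->|->]|->]|->].
- by rewrite h0; exact: x0_language_3counter.
- rewrite multiplication_language_inv h0.
  exact: counter_language_map x0_language_3counter.
- by rewrite h1; exact: x1_language_3counter.
- rewrite multiplication_language_inv h1.
  exact: counter_language_map x1_language_3counter.
Qed.

End Conclusion.

Theorem theorem4p1 (R : realType) :
  let X : set (thompsonF R) := [set x0 R; (x0 R)^-1; x1 R; (x1 R)^-1]%g in
  counter_graph_automatic 3 X (caret_language R) (@bar R) /\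
  quasigeodesic X (caret_language R) (@bar R).
Proof. by split; [exact: caret_graph_automatic|exact: caret_quasigeodesic]. Qed.
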